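(* Let $m\geq3$, $G=G(2m,m,2)$, $H=G\cap\mathrm{SL}(2,\mathbb{C})$, $A=G/H\simeq\mathbb{Z}/2$, and $Y=H\text{-}\mathrm{Hilb}(\mathbb{C}^2)$. The following statements describe the action of $A$ on the exceptional locus of $Y\to\mathbb{C}^2/H$, whose irreducible components are the $m+2$ curves $E(\rho_1'),E(\rho_2),\ldots,E(\rho_m),E(\rho_{m+1}'),E(\rho_{m+2}')$; write $E(\rho_1):=E(\rho_1')$. (a) When $m$ is even, the action of $A$ maps each of the $m+2$ exceptional curves to itself. (b) When $m$ is odd, $A$ interchanges $E(\rho_{m+1}')$ and $E(\rho_{m+2}')$, and maps each of the other $m$ exceptional curves to itself. (c) When $m$ is odd or even, $A$ fixes $E(\rho_k)$ pointwise for each even value of $k$ with $2\leq k\leq m$. (d) When $m$ is odd or even, $A$ fixes exactly two points of $E(\rho_k)$ for each odd value of $k$ with $1\leq k\leq m$. When $k\neq1,m$, these are the points of intersection with the adjacent exceptional curves. When $k=1$, one fixed point is the intersection of $E(\rho_1)$ with $E(\rho_2)$, and when $k=m$ is odd, one fixed point is the intersection of $E(\rho_m)$ with $E(\rho_{m-1})$. (e) Within the exceptional locus, we have the following isolated fixed points of $A$: (i) when $m$ is odd or even, there is an isolated fixed point on $E(\rho_1)$ given by $V_2(\rho_1')=(xy)$; (ii) when $m$ is odd, there is an isolated fixed point on $E(\rho_m)$ given by $V_{m+1}'(\rho_m)=(x^{m+1},y^{m+1})$; (iii) when $m$ is even, $E(\rho_{m+1}')$ and $E(\rho_{m+2}')$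 each contain an isolated fixed point, given by $V_m(\rho_{m+1}')=(x^m-i^{m+2}y^m)$ and $V_m(\rho_{m+2}')=(x^m+i^{m+2}y^m)$ respectively.
   Context: Set $\zeta=e^{\pi i/m}$. $G(2m,m,2)\leq\mathrm{GL}(2,\mathbb{C})$ is generated by $\begin{pmatrix}0&1\\1&0\end{pmatrix}$, $\begin{pmatrix}-1&0\\0&1\end{pmatrix}$, $\begin{pmatrix}0&\zeta^{-1}\\\zeta&0\end{pmatrix}$. The subgroup $H=G\cap\mathrm{SL}(2,\mathbb{C})$ (index $2$, binary dihedral of order $4m$) is generated by $\begin{pmatrix}\zeta&0\\0&\zeta^{-1}\end{pmatrix}$ and $\begin{pmatrix}0&1\\-1&0\end{pmatrix}$. The group $G$ acts on $\mathbb{C}[x,y]$ by linear substitutions: $\begin{pmatrix}a&b\\c&d\end{pmatrix}$ sends $x\mapsto ax+cy$, $y\mapsto bx+dy$. $Y=H\text{-}\mathrm{Hilb}(\mathbb{C}^2)$ is the unique component of $\mathrm{Hilb}^{|H|}(\mathbb{C}^2)^H$ dominating $\mathbb{C}^2/H$ via the Hilbert--Chow morphism; it is the minimal (crepant) resolution of $\mathbb{C}^2/H$. Its points are the $H$-invariant ideals $I\subset\mathbb{C}[x,y]$ with $\mathbb{C}[x,y]/I\cong\mathbb{C}[H]$ as $H$-modules. $G$ acts on $Y$ by $I\mapsto g\cdot I$, and this factors through $A=G/H$ (the nontrivial element is represented by $x\mapsto-x$, $y\mapsto y$). The exceptional locus consists of the ideals supported at the origin. Let $\mathfrak{m}=(x,y)$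 and let $\mathfrak{n}\subset\mathbb{C}[x,y]$ be the ideal generated by the $H$-invariant polynomials vanishing at the origin. For $I$ in the exceptional locus, $\mathfrak{n}\subseteq I\subseteq\mathfrak{m}$ and $V(I):=I/(\mathfrak{m}I+\mathfrak{n})$, a finite-dimensional $H$-module. For a nontrivial irreducible representation $\rho$ of $H$ with module $V(\rho)$, $E(\rho):=\{I\text{ in the exceptional locus}: V(\rho)\subseteq V(I)\}\simeq\mathbb{P}^1$; these are the irreducible components of the exceptional locus, and $E(\rho)$, $E(\rho')$ with $\rho\ne\rho'$ meet (transversally, in one point) iff $\rho,\rho'$ are adjacent in the McKay graph of $H$; adjacent exceptional curves are ones that meet. $V_i(\rho)$ denotes the sum of the $\rho$-summands of the degree-$i$ homogeneous part of $\mathfrak{m}/\mathfrak{n}$. A point of $Y$ ''given by'' an $H$-submodule $W\subseteq\mathfrak{m}/\mathfrak{n}$ is the ideal of $\mathbb{C}[x,y]$ generated by $\mathfrak{n}$ and lifts of $W$; $(f_1,\ldots,f_k)$ denotes the submodule with these generators. Labeling of irreducible representations of $H$: the McKay graph (extended Dynkin diagram of type $D_{m+2}$) has vertices $\rho_0$ (trivial), $\rho_1'$, $\rho_2,\ldots,\rho_m$, $\rho_{m+1}'$, $\rho_{m+2}'$, with edges $\rho_0-\rho_2$, $\rho_1'-\rho_2$, $\rho_k-\rho_{k+1}$ for $2\leq k\leq m-1$, $\rho_m-\rho_{m+1}'$, $\rho_m-\rho_{m+2}'$. The representations $\rho'_{m+1},\rho'_{m+2}$ are distinguished by $V_m(\rho_{m+1}')=(x^m-i^{m+2}y^m)$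 and $V_m(\rho_{m+2}')=(x^m+i^{m+2}y^m)$. $V_{m+1}(\rho_m)$ consists of two $\rho_m$-summands, $V_{m+1}'(\rho_m)=(x^{m+1},y^{m+1})$ and $V_{m+1}''(\rho_m)=(x^my,xy^m)$. ''Isolated fixed point within the exceptional locus'' means isolated in the fixed locus of $A$ restricted to the exceptional locus. *)

(* Defs.v *)
From mathcomp Require Import all_boot all_order all_algebra.
From mathcomp Require Import classical_sets fsbigop reals trigo.
From mathcomp Require Import complex mxtens.
From mathcomp Require Import mpoly.

Set Implicit Arguments.
Unset Strict Implicit.
Unset Printing Implicit Defensive.
Import Order.TTheory GRing.Theory Num.Theory.
Local Open Scope ring_scope.
Local Open Scope classical_set_scope.

Section BinaryDihedralHilb.
Variables (R : realType) (m : nat).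
Local Notation C := R[i].
Local Notation P := {mpoly C[2]}.
Local Notation x := ('X_ord0 : P).
Local Notation y := ('X_ord_max : P).

Definition mx22 (a b c d : C) : 'M[C]_2 :=
  \matrix_(i, j) nth 0 (nth [::] [:: [:: a; b]; [:: c; d]] i) j.

Definition zeta : C := (cos (pi / m%:R) +i* sin (pi / m%:R))%C.

Definition is_subgroup (K : set 'M[C]_2) : Prop :=
  [/\ K 1%:M,
      forall g h, K g -> K h -> K (g *m h)
    & forall g, K g -> K (invmx g)].

(* G(2m, m, 2) *)
Definition G : set 'M[C]_2 :=
  smallest is_subgroup
    [set g | [\/ g = mx22 0 1 1 0, g = mx22 (-1) 0 0 1
               | g = mx22 0 zeta^-1 zeta 0]].

Definition H : set 'M[C]_2 := [set h | G h /\ \det h = 1].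

(* The automorphism of C[x, y] given by x |-> a x + c y, y |-> b x + d y
   for g = (a b; c d): the images are read off the columns of g, which makes
   this a left action. *)
Definition act (g : 'M[C]_2) (f : P) : P :=
  f \mPo [tuple \sum_(i < 2) g i j *: 'X_i | j < 2].

Definition gact (g : 'M[C]_2) (I : set P) : set P := act g @` I.

Definition is_ideal (I : set P) : Prop :=
  [/\ I 0, forall f g, I f -> I g -> I (f + g)
    & forall f g, I g -> I (f * g)].

Definition ideal_gen (S : set P) : set P := smallest is_ideal S.

Definition is_subspace (W : set P) : Prop :=
  [/\ W 0, forall f g, W f -> W g -> W (f + g)
    & forall (a : C) f, W f -> W (a *: f)].

Definition H_stable (W : set P) : Prop :=
  forall h f, H h -> W f -> W (act h f).

Definition mm : set P := ideal_gen [set x; y].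

Definition nn : set P :=
  ideal_gen [set f : P | (forall h, H h -> act h f = f) /\ f.@[fun _ => 0] = 0].

(* C[x, y] / I is isomorphic to the group algebra C[H] as an H-module: f h is a
   lift of the image of the basis vector e_h, on which g acts by
   g e_h = e_(g h). *)
Definition regular_quotient (I : set P) : Prop :=
  exists f : 'M[C]_2 -> P,
    [/\ forall g h, H g -> H h -> I (act g (f h) - f (g *m h)),
        forall p : P, exists c : 'M[C]_2 -> C,
          I (p - \sum_(h \in H) c h *: f h)
      & forall c : 'M[C]_2 -> C,
          I (\sum_(h \in H) c h *: f h) -> forall h, H h -> c h = 0].

(* The points of Y = H-Hilb(C^2). *)
Definition HHilb : set (set P) :=
  [set I | [/\ is_ideal I, H_stable I & regular_quotient I]].

Definition supported_at_origin (I : set P) : Prop :=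
  forall a : 'I_2 -> C,
    (forall f : P, I f -> f.@[a] = 0) <-> (forall i, a i = 0).

Definition exceptional : set (set P) :=
  [set I | HHilb I /\ supported_at_origin I].

(* Finite-dimensional representations of H, acting on column vectors. The
   values of rep_mx outside H are irrelevant. *)
Record rep := Rep {
  rep_dim : nat;
  rep_mx :> 'M[C]_2 -> 'M[C]_rep_dim;
  rep_mx1 : rep_mx 1%:M = 1%:M;
  rep_mxM : forall g h, H g -> H h -> rep_mx (g *m h) = rep_mx g *m rep_mx h }.

(* Subspaces of the column module are row spaces of matrices U, on which h
   acts by right multiplication with the transpose of r h. *)
Definition irreducible (r : rep) : Prop :=
  (0 < rep_dim r)%N /\
  forall U : 'M[C]_(rep_dim r),
    (forall h, H h -> stablemx U (r h)^T) -> U != 0 -> row_full U.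

Definition rep_iso (r s : rep) : Prop :=
  exists (T : 'M[C]_(rep_dim r, rep_dim s)) (T' : 'M[C]_(rep_dim s, rep_dim r)),
    [/\ T *m T' = 1%:M, T' *m T = 1%:M
      & forall h, H h -> r h *m T = T *m s h].

Definition trivial_rep (r : rep) : Prop :=
  rep_dim r = 1%N /\ forall h, H h -> r h = 1%:M.

(* Adjacency in the McKay graph: s embeds in the tensor product of r with the
   natural two-dimensional representation of H; row_full T says that the
   columns of T are independent. *)
Definition mckay_adjacent (r s : rep) : Prop :=
  exists T : 'M[C]_(rep_dim r * 2, rep_dim s),
    row_full T /\ forall h, H h -> tensmx (r h) h *m T = T *m s h.

(* Modulo the subspace U, sending the j-th standard basis vector of V(r) to
   the class of f j is a homomorphism of H-modules. *)
Definition equivariant_mod (U : set P) (r : rep) (f : 'I_(rep_dim r) -> P) :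
    Prop :=
  forall h, H h -> forall j, U (act h (f j) - \sum_i r h i j *: f i).

(* V(r) is isomorphic to an H-submodule of W / U. *)
Definition embeds_in_quotient (r : rep) (W U : set P) : Prop :=
  exists f : 'I_(rep_dim r) -> P,
    [/\ forall j, W (f j), equivariant_mod U f
      & forall c : 'I_(rep_dim r) -> C,
          U (\sum_j c j *: f j) -> forall j, c j = 0].

(* V(I) is the quotient of I by mI_n I. *)
Definition mI_n (I : set P) : set P :=
  ideal_gen ([set f * g | f in mm & g in I] `|` nn).

Definition E (r : rep) : set (set P) :=
  [set I | exceptional I /\ embeds_in_quotient r I (mI_n I)].

(* H-submodules of m / n are represented by their preimages in C[x, y]. *)
Definition submodule (S : set P) : set P :=
  smallest (fun W => is_subspace W /\ H_stable W) (nn `|` S).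

(* V_i(r), for r irreducible: the span of the images of all homomorphisms from
   V(r) to the degree-i part of m / n. *)
Definition Vdeg (i : nat) (r : rep) : set P :=
  smallest is_subspace
    (nn `|` [set f | exists (F : 'I_(rep_dim r) -> P) (j : 'I_(rep_dim r)),
              [/\ forall k, mm (F k) /\ F k \is i.-homog,
                  equivariant_mod nn F & f = F j]]).

(* The ideal generated by n and lifts of an H-submodule of m / n; the
   preimage W already contains n. *)
Definition point_given_by (W : set P) : set P := ideal_gen W.

Definition poly_minus : P := x ^+ m - ('i%C ^+ (m + 2)) *: y ^+ m.
Definition poly_plus : P := x ^+ m + ('i%C ^+ (m + 2)) *: y ^+ m.

(* V'_{m+1}(rho_m) *)
Definition V'_m1 : set P := submodule [set x ^+ m.+1; y ^+ m.+1].

(* The extended Dynkin diagram of type D_{m+2} on the vertices 0, ..., m+2. *)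
Definition dynkin_arrow (j k : nat) : bool :=
  [|| (j == 0) && (k == 2), (j == 1) && (k == 2),
      [&& 2 <= j, j < m & k == j.+1],
      (j == m) && (k == m.+1) | (j == m) && (k == m.+2)]%N.
Definition dynkin_edge (j k : nat) : bool := dynkin_arrow j k || dynkin_arrow k j.

(* rho k is the representation of index k; the primes on rho'_1, rho'_{m+1}
   and rho'_{m+2} are dropped. Only the values at k <= m + 2 matter. *)
Definition mckay_labeling (rho : nat -> rep) : Prop :=
  [/\ [/\ forall k, (k <= m.+2)%N -> irreducible (rho k),
          forall j k, (j <= m.+2)%N -> (k <= m.+2)%N ->
            rep_iso (rho j) (rho k) -> j = k
        & forall r, irreducible r ->
            exists2 k, (k <= m.+2)%N & rep_iso r (rho k)],
      trivial_rep (rho 0%N),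
      forall j k, (j <= m.+2)%N -> (k <= m.+2)%N ->
        (mckay_adjacent (rho j) (rho k) <-> dynkin_edge j k),
      Vdeg m (rho m.+1) = submodule [set poly_minus]
    & Vdeg m (rho m.+2) = submodule [set poly_plus]].

(* H fixes every point of H-Hilb, so the action of A = G / H is that of any
   coset representatives in G. *)
Definition A_fixed (I : set P) : Prop := forall g, G g -> gact g I = I.

Definition fixed_exceptional : set (set P) :=
  [set I | exceptional I /\ A_fixed I].

Definition maps_curve (g : 'M[C]_2) (E1 E2 : set (set P)) : Prop :=
  gact g @` E1 = E2.

(* The exceptional curves are the E(rho j) with 1 <= j <= m + 2. *)
Definition adjacent_curves (rho : nat -> rep) (k j : nat) : Prop :=
  [/\ (1 <= j <= m.+2)%N, j <> k & E (rho k) `&` E (rho j) !=set0].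

Definition basis_mod (I : set P) (N : nat) (B : 'I_N -> P) : Prop :=
  (forall p : P, exists c : 'I_N -> C, I (p - \sum_j c j *: B j)) /\
  (forall c : 'I_N -> C, I (\sum_j c j *: B j) -> forall j, c j = 0).

(* The Zariski topology of the Hilbert scheme of N points: it is covered by
   the affine opens U_B of ideals modulo which B is a basis, and the
   coordinate ring of U_B is generated by the coefficients of polynomials
   modulo I in the basis B. A basic open set is the locus in U_B where a
   polynomial Q in the coefficients c of finitely many polynomials F does not
   vanish. *)
Definition basic_open (N s : nat) (B : 'I_N -> P) (F : 'I_s -> P)
    (Q : {mpoly C[s * N]}) : set (set P) :=
  [set I | basis_mod I B /\
     exists c : 'M[C]_(s, N),
       (forall i, I (F i - \sum_j c i j *: B j)) /\
       Q.@[fun k => mxvec c 0 k] != 0].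

(* U is open in X for the induced topology. *)
Definition zariski_open_in (X U : set (set P)) : Prop :=
  U `<=` X /\
  forall I, U I -> exists (N s : nat) (B : 'I_N -> P) (F : 'I_s -> P)
      (Q : {mpoly C[s * N]}),
    basic_open B F Q I /\ X `&` basic_open B F Q `<=` U.

Definition isolated_fixed_point (I : set P) : Prop :=
  zariski_open_in fixed_exceptional [set I].

End BinaryDihedralHilb.

Arguments G R m _ : clear implicits.
Arguments H R m _ : clear implicits.
Arguments nn R m _ : clear implicits.
Arguments HHilb R m _ : clear implicits.
Arguments exceptional R m _ : clear implicits.
Arguments fixed_exceptional R m _ : clear implicits.
Arguments submodule R m S _ : clear implicits.
Arguments V'_m1 R m _ : clear implicits.
Arguments isolated_fixed_point R m I : clear implicits.
Arguments A_fixed R m I : clear implicits.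

(* Main.v *)
From HB Require Import structures.
Require Import Defs.
From mathcomp Require Import all_boot all_order all_algebra.
From mathcomp Require Import boolp classical_sets fsbigop reals trigo.
From mathcomp Require Import complex mxtens.
From mathcomp Require Import mpoly.
From mathcomp Require Import ring zify.

(** Write N = 2m. The diagonal generator of H splits C[x, y] into weight spaces,
   one for each residue a modulo N, and tau : x |-> - y, y |-> x
   exchanges the weights a and - a. In these terms an exceptional point is an
   H-stable ideal I that contains n, vanishes at the origin, and leaves in every
   weight a quotient of dimension two that is compatible with tau ([good],
   [exceptional_good], [good_exceptional]). Modulo n a weight space with 0 < a < N
   is spanned by x ^ a, y ^ (N - a), x ^ (a + 1) y and x y ^ (N - a + 1)
   ([weight_span]), so everything about I is linear algebra with four vectors in
   a space of dimension two ([weight_le2], [weight_ge2]).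

   For 1 <= k <= m it follows that I contains exactly one point of the pencil
   spanned by x ^ k y and y ^ (N - k + 1) ([line_ex], [line_proper]). If the
   representation of index k occurs in V(I), then x ^ (k + 1) y and y ^ (N - k + 2)
   are in I ([gen_curve]), and the point of the pencil is the coordinate of I on
   the k-th curve. Its two extreme values are the ideals [curve_pt k] and
   [curve_pt k.+1], where [curve_pt k] is generated over n by x ^ k y,
   y ^ (N - k + 2) and their mirror images. An inclusion of exceptional ideals is
   an equality because both have colength 2N ([good_sub_eq]), so to identify a
   point it is enough to find the generators of [curve_pt k] in it; this also
   gives all intersections of curves. The substitution x |-> - x, which represents
   the nontrivial element of A, multiplies x ^ k y by (-1) ^ k and fixes the power
   of y: for odd k it fixes only the two extreme points ([odd_fixed]), for even k
   the whole curve ([even_fixed]).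

   An element g of G maps E(r) to E(s) as soon as s is the twist of r by g
   ([maps_curve_twist]). The representations of dimension two and the character of
   x y are their own twists; the character of x ^ m + c y ^ m is twisted to that of
   x ^ m + (-1) ^ m c y ^ m, which gives the exchange of the two end curves for odd
   m.

   A fixed point I is isolated as soon as some polynomial q outside I lies in
   every other fixed exceptional ideal: a basis of the quotient that contains q
   defines an open neighborhood without other fixed points ([isolated_by]). This is
   applied with y ^ N, with x ^ m y, and with x y (x ^ m - c y ^ m).

   All this concerns explicit representations [vertex_rep k]. They are identified
   with the representations rho k of a McKay labeling by exhibiting the edges of
   the Dynkin diagram between them and walking along the diagram from the trivial
   vertex; only the exchange of the last two vertices is left open by this, and it
   is excluded by the prescribed spaces of degree m ([label]). *)

Set Implicit Arguments.
Unset Strict Implicit.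
Unset Printing Implicit Defensive.
Import Order.TTheory GRing.Theory Num.Theory.
Local Open Scope ring_scope.
Local Open Scope classical_set_scope.

(** * Monomials, coefficients and the action *)

(** Monomials, coefficients and the action are locked: unification would
   otherwise unfold polynomials in the attempt to match them. *)
HB.lock Definition mon (R : realType) (i j : nat) : {mpoly R[i][2]} :=
  'X_ord0 ^+ i * 'X_ord_max ^+ j.

Definition mnm2 (i j : nat) : 'X_{1..2} := (U_(ord0) *+ i + U_(ord_max) *+ j)%MM.

HB.lock Definition cf (R : realType) (p : {mpoly R[i][2]}) (i j : nat) : R[i] :=
  p@_(mnm2 i j).

HB.lock Definition ac (R : realType) (g : 'M[R[i]]_2) (p : {mpoly R[i][2]}) :
  {mpoly R[i][2]} := act g p.

Section Monomials.
Variable R : realType.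
Local Notation C := R[i].
Local Notation P := {mpoly C[2]}.
Local Notation x := ('X_ord0 : P).
Local Notation y := ('X_ord_max : P).

Local Notation mon := (@mon R).
Local Notation cf := (@cf R).
Implicit Types p q : P.

Lemma mon_def i j : mon i j = x ^+ i * y ^+ j.
Proof. by rewrite unlock. Qed.

Lemma cf_def (p : P) i j : cf p i j = p@_(mnm2 i j).
Proof. by rewrite unlock. Qed.

Lemma mnm2_eta (d : 'X_{1..2}) : d = mnm2 (d ord0) (d ord_max).
Proof.
apply/mnmP => i; rewrite /mnm2 mnmDE !mulmnE !mnm1E.
by case: i => [[|[|//]] hi] /=; rewrite !mul0n !mul1n ?addn0;
  congr (d _); apply/val_inj.
Qed.

Lemma monE i j : mon i j = 'X_[mnm2 i j].
Proof. by rewrite mon_def /mnm2 mpolyXD -!mpolyXn. Qed.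

Lemma mnm2_eq i j k l : (mnm2 i j == mnm2 k l) = (i == k) && (j == l).
Proof.
apply/eqP/andP => [|[/eqP -> /eqP ->] //] e.
have := congr1 (fun d : 'X_{1..2} => d ord0) e.
have := congr1 (fun d : 'X_{1..2} => d ord_max) e.
rewrite /mnm2 !mnmDE !mulmnE !mnm1E /= !mul0n !mul1n !addn0 !add0n.
by move=> -> ->.
Qed.

Lemma cf_mon i j k l : cf (mon i j) k l = ((i == k) && (j == l))%:R.
Proof. by rewrite cf_def monE mcoeffX mnm2_eq. Qed.

Lemma cf0 i j : cf 0 i j = 0. Proof. by rewrite !cf_def mcoeff0. Qed.
Lemma cfD p q i j : cf (p + q) i j = cf p i j + cf q i j.
Proof. by rewrite !cf_def mcoeffD. Qed.
Lemma cfB p q i j : cf (p - q) i j = cf p i j - cf q i j.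
Proof. by rewrite !cf_def mcoeffB. Qed.
Lemma cfN p i j : cf (- p) i j = - cf p i j.
Proof. by rewrite !cf_def mcoeffN. Qed.
Lemma cfZ a p i j : cf (a *: p) i j = a * cf p i j.
Proof. by rewrite !cf_def mcoeffZ. Qed.

Lemma mon_expansion p :
  p = \sum_(d <- msupp p) cf p (d ord0) (d ord_max) *: mon (d ord0) (d ord_max).
Proof.
rewrite [LHS]mpolyE; apply: eq_bigr => d _.
by rewrite monE cf_def -mnm2_eta.
Qed.

Lemma mon_ind (S : P -> Prop) :
  S 0 -> (forall p q, S p -> S q -> S (p + q)) ->
  (forall a i j, S (a *: mon i j)) -> forall p, S p.
Proof.
move=> S0 SD Sm p; rewrite [p]mon_expansion.
by elim/big_ind: _ => // d _; exact: Sm.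
Qed.

Lemma eq_cf p q : (forall i j, cf p i j = cf q i j) -> p = q.
Proof.
move=> e; apply/mpolyP => d; have := e (d ord0) (d ord_max).
by rewrite !cf_def -mnm2_eta.
Qed.

Lemma mulx_mon i j : x * mon i j = mon i.+1 j.
Proof. by rewrite !mon_def exprS mulrA. Qed.

Lemma muly_mon i j : y * mon i j = mon i j.+1.
Proof. by rewrite !mon_def exprS mulrCA. Qed.

Lemma mul_mon i j k l : mon i j * mon k l = mon (i + k) (j + l).
Proof. by rewrite !mon_def !exprD mulrACA. Qed.

Lemma cfMx p i j : cf (x * p) i j = if i is i'.+1 then cf p i' j else 0.
Proof.
elim/mon_ind: p => [|p q hp hq|a k l].
- by rewrite mulr0; case: i => *; rewrite !cf0.
- by rewrite mulrDr cfD hp hq; case: i {hp hq} => *; rewrite ?cfD ?addr0.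
- rewrite -scalerAr mulx_mon cfZ cf_mon.
  by case: i => [|i]; rewrite ?cfZ ?cf_mon ?mulr0.
Qed.

Lemma cfMy p i j : cf (y * p) i j = if j is j'.+1 then cf p i j' else 0.
Proof.
elim/mon_ind: p => [|p q hp hq|a k l].
- by rewrite mulr0; case: j => *; rewrite !cf0.
- by rewrite mulrDr cfD hp hq; case: j {hp hq} => *; rewrite ?cfD ?addr0.
- rewrite -scalerAr muly_mon cfZ cf_mon.
  by case: j => [|j]; rewrite ?cfZ ?cf_mon ?mulr0 // eqE /= andbF mulr0.
Qed.

Lemma meval_mon (a : 'I_2 -> C) i j :
  (mon i j).@[a] = a ord0 ^+ i * a ord_max ^+ j.
Proof. by rewrite mon_def mevalM !rmorphXn /= !mevalXU. Qed.

Lemma eval0_cf p : p.@[fun _ => 0] = cf p 0 0.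
Proof.
elim/mon_ind: p => [|p q hp hq|a k l].
- by rewrite meval0 cf0.
- by rewrite mevalD cfD hp hq.
- rewrite mevalZ cfZ cf_mon meval_mon; congr (_ * _).
  by case: k => [|k]; case: l => [|l]; rewrite ?expr0 ?mul1r ?expr0n ?mulr0 ?mul0r.
Qed.

Lemma mon00 : mon 0 0 = 1. Proof. by rewrite mon_def !expr0 mulr1. Qed.
Lemma mon11 : mon 1 1 = x * y. Proof. by rewrite mon_def. Qed.
Lemma monx0 i : mon i 0 = x ^+ i. Proof. by rewrite mon_def expr0 mulr1. Qed.
Lemma mon0y j : mon 0 j = y ^+ j. Proof. by rewrite mon_def expr0 mul1r. Qed.

Definition dg (s t : C) : 'M[C]_2 := mx22 s 0 0 t.
Definition ad (s t : C) : 'M[C]_2 := mx22 0 s t 0.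

Lemma sum2 (V : zmodType) (F : 'I_2 -> V) : \sum_i F i = F ord0 + F ord_max.
Proof. by rewrite big_ord_recr big_ord1; congr (F _ + F _); apply/val_inj. Qed.

Lemma mx22M a b c d a' b' c' d' :
  mx22 (a : C) b c d *m mx22 a' b' c' d' =
  mx22 (a * a' + b * c') (a * b' + b * d') (c * a' + d * c') (c * b' + d * d').
Proof.
apply/matrixP => i j; rewrite mxE sum2 !mxE /=.
by case: i => [[|[|//]] hi]; case: j => [[|[|//]] hj].
Qed.

Lemma mx22_1 : 1%:M = mx22 1 0 0 1 :> 'M[C]_2.
Proof.
by apply/matrixP => i j; rewrite !mxE; case: i => [[|[|//]] hi]; case: j => [[|[|//]] hj].
Qed.

Lemma det_mx22 a b c d : \det (mx22 a b c d : 'M[C]_2) = a * d - b * c.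
Proof. by rewrite (expand_det_row _ ord0) sum2 /cofactor !det_mx11 !mxE /= !expr0 !mul1r mulN1r mulrN. Qed.

Lemma dgM s t s' t' : dg s t *m dg s' t' = dg (s * s') (t * t').
Proof. by rewrite mx22M; congr mx22; ring. Qed.
Lemma adM s t s' t' : ad s t *m ad s' t' = dg (s * t') (t * s').
Proof. by rewrite mx22M; congr mx22; ring. Qed.
Lemma dgadM s t s' t' : dg s t *m ad s' t' = ad (s * s') (t * t').
Proof. by rewrite mx22M; congr mx22; ring. Qed.
Lemma addgM s t s' t' : ad s t *m dg s' t' = ad (s * t') (t * s').
Proof. by rewrite mx22M; congr mx22; ring. Qed.

Lemma acE g (p : P) : ac g p = act g p.
Proof. by rewrite unlock. Qed.

Lemma act0 g : ac g (0 : P) = 0. Proof. by rewrite !acE; exact: comp_mpoly0. Qed.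
Lemma actD g (p q : P) : ac g (p + q) = ac g p + ac g q. Proof. by rewrite !acE; exact: comp_mpolyD. Qed.
Lemma actB g (p q : P) : ac g (p - q) = ac g p - ac g q. Proof. by rewrite !acE; exact: comp_mpolyB. Qed.
Lemma actN g (p : P) : ac g (- p) = - ac g p. Proof. by rewrite !acE; exact: comp_mpolyN. Qed.
Lemma actZ g a (p : P) : ac g (a *: p) = a *: ac g p. Proof. by rewrite !acE; exact: comp_mpolyZ. Qed.
Lemma actM g (p q : P) : ac g (p * q) = ac g p * ac g q.
Proof. by rewrite !acE; exact: rmorphM. Qed.
Lemma act_1 g : ac g (1 : P) = 1. Proof. by rewrite !acE; exact: comp_mpoly1. Qed.
Lemma actXn g (p : P) n : ac g (p ^+ n) = ac g p ^+ n.
Proof. by rewrite !acE; exact: rmorphXn. Qed.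
Lemma act_sum g I (r : seq I) (Q : pred I) (F : I -> P) :
  ac g (\sum_(i <- r | Q i) F i) = \sum_(i <- r | Q i) ac g (F i).
Proof. by apply: (big_morph _ (actD g) (act0 g)). Qed.

Lemma act_X g j : ac g ('X_j : P) = g ord0 j *: x + g ord_max j *: y.
Proof. by rewrite acE /act comp_mpolyXU -tnth_nth tnth_mktuple sum2. Qed.

Lemma act_mon g i j : ac g (mon i j) = ac g x ^+ i * ac g y ^+ j.
Proof. by rewrite mon_def actM !actXn. Qed.

Lemma act_mulmx_X g h j : ac (g *m h) ('X_j : P) = ac g (ac h 'X_j).
Proof.
rewrite (act_X h) actD !actZ !(act_X g) (act_X (g *m h)) !mxE !sum2.
rewrite !scalerDr !scalerDl !scalerA [h ord0 j * g ord0 _]mulrC.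
rewrite [h ord0 j * _]mulrC [h _ j * g ord0 _]mulrC [h _ j * g ord_max _]mulrC.
exact: addrACA.
Qed.

Lemma act_mulmx g h (p : P) : ac (g *m h) p = ac g (ac h p).
Proof.
elim/mon_ind: p => [|p q hp hq|a i j]; first by rewrite !act0.
  by rewrite !actD hp hq.
by rewrite !actZ (act_mon (g *m h)) (act_mon h) actM !actXn !act_mulmx_X.
Qed.

Lemma act_dg s t i j : ac (dg s t) (mon i j) = (s ^+ i * t ^+ j) *: mon i j.
Proof.
rewrite act_mon !act_X !mxE /= !scale0r addr0 add0r !exprZn.
by rewrite -scalerAl -scalerAr scalerA -mon_def.
Qed.

Lemma act_ad s t i j : ac (ad s t) (mon i j) = (t ^+ i * s ^+ j) *: mon j i.
Proof.
rewrite act_mon !act_X !mxE /= !scale0r addr0 add0r !exprZn.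
rewrite -scalerAl -scalerAr scalerA; congr (_ *: _).
by rewrite mon_def mulrC.
Qed.

Lemma act_id (p : P) : ac 1%:M p = p.
Proof.
elim/mon_ind: p => [|p q hp hq|a i j]; first by rewrite act0.
  by rewrite actD hp hq.
by rewrite actZ mx22_1 (act_dg 1 1) !expr1n mul1r scale1r.
Qed.

Lemma cf_dg s t p i j : cf (ac (dg s t) p) i j = s ^+ i * t ^+ j * cf p i j.
Proof.
elim/mon_ind: p => [|p q hp hq|a k l]; first by rewrite act0 cf0 mulr0.
  by rewrite actD !cfD hp hq mulrDr.
rewrite actZ act_dg !cfZ cf_mon.
by case: eqP => [->|_]; case: eqP => [->|_] /=; rewrite ?mulr0 // !mulr1 mulrC.
Qed.

Lemma cf_ad s t p i j : cf (ac (ad s t) p) i j = t ^+ j * s ^+ i * cf p j i.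
Proof.
elim/mon_ind: p => [|p q hp hq|a k l]; first by rewrite act0 !cf0 mulr0.
  by rewrite actD !cfD hp hq mulrDr.
rewrite actZ act_ad !cfZ !cf_mon.
case: (k =P j) => [->|_]; case: (l =P i) => [->|_] /=; rewrite ?mulr0 //; ring.
Qed.

End Monomials.

(** * The groups G and H *)

Section Group.
Variables (R : realType) (m : nat) (hm : (3 <= m)%N).
Local Notation C := R[i].
Local Notation P := {mpoly C[2]}.
Local Notation z := (zeta R m).
Local Notation N := m.*2.

Lemma m_gt0 : (0 < m)%N. Proof. by lia. Qed.

Lemma zetaX k :
  z ^+ k = (cos (k%:R * (pi / m%:R)) +i* sin (k%:R * (pi / m%:R)))%C.
Proof.
elim: k => [|k ih]; first by rewrite mul0r cos0 sin0 expr0.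
have -> : k.+1%:R * (pi / m%:R) = k%:R * (pi / m%:R) + pi / m%:R :> R.
  by rewrite -addn1 natrD mulrDl mul1r.
rewrite exprSr ih cosD sinD /zeta; simpc.
by congr (_ +i* _)%C; ring.
Qed.

Lemma zetam : z ^+ m = -1.
Proof.
have m0 : (m%:R : R) != 0 by rewrite pnatr_eq0; lia.
rewrite zetaX mulrC divfK // cospi sinpi.
by apply/eqP; rewrite eq_complex /= oppr0 !eqxx.
Qed.

(** The imaginary part sin (j pi / m) of zeta ^ j is positive for 0 < j < m, and
   the powers beyond m are the negatives of these. *)
Lemma zeta_neq1 k : (0 < k < N)%N -> z ^+ k != 1.
Proof.
have key j : (0 < j < m)%N -> z ^+ j != 1 /\ z ^+ j != -1.
  move=> /andP[j0 jm].
  have h : 0 < sin (j%:R * (pi / m%:R)) :> R.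
    apply: sin_gt0_pi; rewrite mulr_gt0 ?ltr0n ?divr_gt0 ?pi_gt0 ?ltr0n ?m_gt0 //=.
    rewrite mulrA ltr_pdivrMr ?ltr0n ?m_gt0 // mulrC ltr_pM2l ?pi_gt0 //.
    by rewrite ltr_nat.
  rewrite zetaX !eq_complex /= !negb_and oppr0.
  by rewrite (gt_eqF h) !orbT.
move=> /andP[k0 kN]; case: (ltngtP k m) => km.
- by have [] := key k _; rewrite ?k0.
- have -> : k = (m + (k - m))%N by lia.
  rewrite exprD zetam mulN1r eqr_oppLR.
  by have [] := key (k - m)%N; first by lia.
- by rewrite km zetam -subr_eq0 -opprD oppr_eq0 (_ : 1 + 1 = 2%:R) ?pnatr_eq0.
Qed.

Lemma zetaN : z ^+ N = 1.
Proof. by rewrite -addnn exprD zetam mulrNN mulr1. Qed.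

Lemma zeta_prim : N.-primitive_root z.
Proof.
apply/andP; split; first by lia.
apply/forallP => i; rewrite unity_rootE; apply/eqP.
case: (i.+1 =P N) => [->|/eqP hi]; first by rewrite zetaN eqxx.
by apply/negbTE/zeta_neq1; have := ltn_ord i; lia.
Qed.

Lemma zeta_neq0 k : z ^+ k != 0.
Proof.
rewrite expf_neq0 //; apply/eqP => e; have := zetaN; rewrite e expr0n.
have -> : (N == 0)%N = false by lia.
by move/esym/eqP; rewrite oner_eq0.
Qed.

Lemma eq_zetaX i j : (z ^+ i == z ^+ j) = (i == j %[mod N]).
Proof. exact: eq_prim_root_expr zeta_prim _ _. Qed.

Lemma zetaX_mod i j : i = j %[mod N] -> z ^+ i = z ^+ j.
Proof. by move=> e; apply/eqP; rewrite eq_zetaX e. Qed.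

Lemma zetaXN i : z ^+ (i * N) = 1.
Proof. by rewrite mulnC exprM zetaN expr1n. Qed.

Lemma zetaVX i j : (N %| i + j)%N -> (z ^+ i)^-1 = z ^+ j.
Proof.
move=> /dvdnP[q e]; apply: (mulfI (zeta_neq0 i)).
by rewrite mulfV ?zeta_neq0 // -exprD e zetaXN.
Qed.

Definition hs (s : C) := dg s s^-1.
Definition ht (s : C) := ad s (- s^-1).

(** The substitution x |-> -x, y |-> y, which represents the nontrivial element
   of A. *)
Definition dl : 'M[C]_2 := dg (-1) 1.

(** Entries s, t with s ^ N = 1 and s t = 1 or -1; this set of matrices is a
   subgroup that contains the generators of G. *)
Definition Gform (g : 'M[C]_2) := exists s t : C,
  [/\ s ^+ N = 1, (s * t) ^+ 2 = 1 & g = dg s t \/ g = ad s t].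

Lemma unity_neq0 (s : C) : s ^+ N = 1 -> s != 0.
Proof.
apply: contra_eqN => /eqP ->; rewrite expr0n.
by have -> : (N == 0)%N = false; rewrite 1?eq_sym ?oner_eq0 //; lia.
Qed.

Lemma unity_inv_m (s : C) : s ^+ N = 1 -> s^-1 ^+ m = s ^+ m.
Proof.
move=> s1; rewrite exprVn; apply: (mulfI (expf_neq0 m (unity_neq0 s1))).
by rewrite mulfV ?expf_neq0 ?(unity_neq0 s1) // -exprD addnn s1.
Qed.

Lemma Gform_unity (s t : C) : s ^+ N = 1 -> (s * t) ^+ 2 = 1 -> t ^+ N = 1.
Proof.
move=> hs1 hst; have : (s * t) ^+ N = 1 by rewrite -mul2n exprM hst expr1n.
by rewrite exprMn hs1 mul1r.
Qed.

Lemma det_dg s t : \det (dg s t) = s * t :> C.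
Proof. by rewrite det_mx22 mulr0 subr0. Qed.
Lemma det_ad s t : \det (ad s t) = - (s * t) :> C.
Proof. by rewrite det_mx22 mulr0 sub0r. Qed.

Lemma invmx_eq (g h : 'M[C]_2) : g *m h = 1%:M -> invmx g = h.
Proof.
move=> e; have u : g \in unitmx by apply/(mulmx1_unit e).1.
by rewrite -[RHS]mul1mx -(mulVmx u) -mulmxA e mulmx1.
Qed.

Lemma dg1 : dg 1 1 = 1%:M :> 'M[C]_2. Proof. by rewrite mx22_1. Qed.

Lemma inv_dg s t : s != 0 -> t != 0 -> invmx (dg s t) = dg s^-1 t^-1 :> 'M[C]_2.
Proof. by move=> s0 t0; apply: invmx_eq; rewrite dgM !mulfV // dg1. Qed.
Lemma inv_ad s t : s != 0 -> t != 0 -> invmx (ad s t) = ad t^-1 s^-1 :> 'M[C]_2.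
Proof. by move=> s0 t0; apply: invmx_eq; rewrite adM !mulfV // dg1. Qed.

Lemma Gform_subgroup : is_subgroup Gform.
Proof.
split.
- by exists 1, 1; rewrite mulr1 !expr1n dg1; split=> //; left.
- move=> g h [s [t [hs1 hst eg]]] [s' [t' [hs1' hst' eh]]].
  have ht1 := Gform_unity hs1 hst; have ht1' := Gform_unity hs1' hst'.
  case: eg => ->; case: eh => ->.
  + exists (s * s'), (t * t'); rewrite dgM exprMn hs1 hs1' mulr1; split=> //; last by left.
    by rewrite mulrACA exprMn hst hst' mulr1.
  + exists (s * s'), (t * t'); rewrite dgadM exprMn hs1 hs1' mulr1; split=> //; last by right.
    by rewrite mulrACA exprMn hst hst' mulr1.
  + exists (s * t'), (t * s'); rewrite addgM exprMn hs1 ht1' mulr1; split=> //; last by right.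
    by rewrite mulrACA [t' * _]mulrC exprMn hst hst' mulr1.
  + exists (s * t'), (t * s'); rewrite adM exprMn hs1 ht1' mulr1; split=> //; last by left.
    by rewrite mulrACA [t' * _]mulrC exprMn hst hst' mulr1.
- move=> g [s [t [hs1 hst eg]]].
  have ht1 := Gform_unity hs1 hst.
  have s0 := unity_neq0 hs1; have t0 := unity_neq0 ht1.
  case: eg => ->.
  + exists s^-1, t^-1; rewrite inv_dg // exprVn hs1 invr1 -invfM exprVn hst invr1.
    by split=> //; left.
  + exists t^-1, s^-1; rewrite inv_ad // exprVn ht1 invr1 -invfM exprVn [t * s]mulrC hst invr1.
    by split=> //; right.
Qed.

Lemma G_form g : G R m g -> Gform g.
Proof.
apply: smallest_sub; first exact: Gform_subgroup.
have zN : z ^+ N = 1 := zetaN.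
have z0 : z != 0 by have := zeta_neq0 1; rewrite expr1.
move=> h [] ->.
- by exists 1, 1; rewrite mulr1 !expr1n; split=> //; right.
- exists (-1), 1; rewrite mulr1 -mul2n exprM sqrrN !expr1n; split=> //; by left.
- by exists z^-1, z; rewrite mulVf // expr1n exprVn zN invr1; split=> //; right.
Qed.

Lemma G_subgroup : is_subgroup (G R m).
Proof.
split.
- by move=> K [[]].
- move=> g h Gg Gh K KK; have [[_ KM _] _] := KK.
  by apply: KM; [exact: Gg | exact: Gh].
- move=> g Gg K KK; have [[_ _ KV] _] := KK; apply: KV; exact: Gg.
Qed.

Lemma G1 : G R m 1%:M. Proof. by case: G_subgroup. Qed.
Lemma GM g h : G R m g -> G R m h -> G R m (g *m h).
Proof. by case: G_subgroup => _ GMul _; exact: GMul. Qed.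
Lemma GV g : G R m g -> G R m (invmx g).
Proof. by case: G_subgroup => _ _; apply. Qed.

Lemma G_unit g : G R m g -> g \in unitmx.
Proof.
move=> /G_form[s [t [_ e eg]]]; rewrite unitmxE unitfE.
have : s * t != 0 by apply: contra_eqN e => /eqP ->; rewrite expr0n eq_sym oner_eq0.
by case: eg => ->; rewrite ?det_dg ?det_ad ?oppr_eq0.
Qed.

Lemma G_dl : G R m dl.
Proof. by apply: sub_gen_smallest; rewrite /= /dl /dg; constructor 2. Qed.

Lemma G_swap : G R m (ad 1 1).
Proof. by apply: sub_gen_smallest; constructor 1. Qed.

Lemma G_hs k : G R m (hs (z ^+ k)).
Proof.
have Gz : G R m (hs z).
  have -> : hs z = ad 1 1 *m ad z^-1 z by rewrite adM !mul1r.
  by apply: GM; [exact: G_swap | apply: sub_gen_smallest; constructor 3].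
elim: k => [|k ih]; first by rewrite expr0 /hs invr1 dg1; exact: G1.
have -> : hs (z ^+ k.+1) = hs z *m hs (z ^+ k) by rewrite /hs dgM exprS invfM.
exact: GM.
Qed.

Lemma H_hs k : H R m (hs (z ^+ k)).
Proof. by split; [exact: G_hs | rewrite det_dg mulfV // zeta_neq0]. Qed.

Lemma htE s : ht s = hs s *m (ad 1 1 *m dl).
Proof. by rewrite /ht /hs /dl addgM dgadM !(mulr1, mulrN1). Qed.

Lemma H_ht k : H R m (ht (z ^+ k)).
Proof.
split; last by rewrite det_ad mulrN opprK mulfV // zeta_neq0.
rewrite htE; apply: GM; first exact: G_hs.
by apply: GM; [exact: G_swap | exact: G_dl].
Qed.

(** The determinant leaves t = 1 / s in the diagonal and t = - 1 / s in the
   antidiagonal case. *)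
Lemma H_cases h : H R m h ->
  exists2 k, (k < N)%N & h = hs (z ^+ k) \/ h = ht (z ^+ k).
Proof.
move=> [/G_form[s [t [s1 _ eh]]] d1].
have s0 := unity_neq0 s1.
have [k es] := prim_rootP zeta_prim s1.
exists (k : nat) => //; rewrite -es /hs /ht.
case: eh d1 => ->; rewrite ?det_dg ?det_ad => e.
- by left; congr dg; apply: (mulfI s0); rewrite mulfV.
- by right; congr ad; apply: (mulfI s0); rewrite mulrN mulfV // -e opprK.
Qed.

Definition Hseq : seq 'M[C]_2 :=
  [seq hs (z ^+ k) | k <- iota 0 N] ++ [seq ht (z ^+ k) | k <- iota 0 N].

Lemma H_Hseq : H R m = [set` Hseq].
Proof.
apply/seteqP; split=> h.
- move=> /H_cases[k kN [] ->] /=; rewrite mem_cat; apply/orP; [left|right];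
  by apply/mapP; exists k; rewrite ?mem_iota.
- rewrite /= mem_cat => /orP[] /mapP[k _ ->]; [exact: H_hs | exact: H_ht].
Qed.

Lemma hs_inj : injective hs.
Proof. by move=> s s' /matrixP/(_ ord0 ord0); rewrite !mxE. Qed.
Lemma ht_inj : injective ht.
Proof. by move=> s s' /matrixP/(_ ord0 ord_max); rewrite !mxE. Qed.
Lemma hs_ht k l : hs (z ^+ k) <> ht (z ^+ l).
Proof.
move=> /matrixP/(_ ord0 ord0); rewrite !mxE /= => /eqP.
by rewrite (negbTE (zeta_neq0 k)).
Qed.

Lemma zetaX_inj i j : (i < N)%N -> (j < N)%N -> z ^+ i = z ^+ j -> i = j.
Proof. by move=> iN jN /eqP; rewrite eq_zetaX !modn_small // => /eqP. Qed.

Lemma Hseq_uniq : uniq Hseq.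
Proof.
rewrite cat_uniq !map_inj_in_uniq ?iota_uniq ?andbT /=; last first.
- by move=> i j; rewrite !mem_iota /= => iN jN /hs_inj/zetaX_inj; apply.
- by move=> i j; rewrite !mem_iota /= => iN jN /ht_inj/zetaX_inj; apply.
apply/hasPn => h /mapP[k _ ->]; apply/negP => /mapP[l _ /esym]; exact: hs_ht.
Qed.

Lemma sum_H (V : nmodType) (F : 'M[C]_2 -> V) : \sum_(h \in H R m) F h =
  \sum_(k < N) F (hs (z ^+ k)) + \sum_(k < N) F (ht (z ^+ k)).
Proof.
rewrite H_Hseq -fsbig_seq ?Hseq_uniq // big_cat !big_map.
by rewrite -!(big_mkord xpredT (fun k => F (_ (z ^+ k)))) /index_iota subn0.
Qed.

Lemma G_cases g : G R m g -> H R m g \/ exists2 h, H R m h & g = dl *m h.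
Proof.
move=> Gg; have [s [t [_ e eg]]] := G_form Gg.
have : \det g ^+ 2 = 1 by case: eg => ->; rewrite ?det_dg ?det_ad ?sqrrN.
move/eqP; rewrite sqrf_eq1 => /orP[] /eqP d; first by left.
right; exists (dl *m g).
- by split; [exact: GM G_dl Gg | rewrite det_mulmx d det_dg mulr1 mulrNN mulr1].
- by rewrite mulmxA dgM mulrNN !mulr1 dg1 mul1mx.
Qed.

Lemma HM g h : H R m g -> H R m h -> H R m (g *m h).
Proof. by move=> [Gg dg] [Gh dh]; split; [exact: GM | rewrite det_mulmx dg dh mulr1]. Qed.
Lemma HV g : H R m g -> H R m (invmx g).
Proof. by move=> [Gg dg]; split; [exact: GV | rewrite det_inv dg invr1]. Qed.
Lemma H1 : H R m 1%:M. Proof. by split; [exact: G1 | rewrite det1]. Qed.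
Lemma HJ g h : G R m g -> H R m h -> H R m (invmx g *m h *m g).
Proof.
move=> Gg [Gh dh]; split; first by apply: GM => //; apply: GM => //; exact: GV.
rewrite !det_mulmx dh mulr1 det_inv mulVf //.
by have := G_unit Gg; rewrite unitmxE unitfE.
Qed.

End Group.

(** * Ideals and weights *)

Section Ideals.
Variables (R : realType).
Local Notation C := R[i].
Local Notation P := {mpoly C[2]}.
Local Notation x := ('X_ord0 : P).
Local Notation y := ('X_ord_max : P).
Local Notation mon := (@mon R).

Implicit Types (a : C) (f g : P).

Lemma ideal_gen_ideal (S : set P) : is_ideal (ideal_gen S).
Proof.
split.
- by move=> K [[]].
- move=> f g If Ig K KK; have [[_ KD _] _] := KK.
  by apply: KD; [exact: If | exact: Ig].
- move=> f g Ig K KK; have [[_ _ KM] _] := KK; apply: KM; exact: Ig.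
Qed.

Lemma ideal_gen_sub (S : set P) : S `<=` ideal_gen S.
Proof. exact: sub_gen_smallest. Qed.

Lemma ideal_gen_min (S I : set P) : is_ideal I -> S `<=` I -> ideal_gen S `<=` I.
Proof. exact: smallest_sub. Qed.

(** Every multiplication is a combination of iterated multiplications by x and y. *)
Lemma xy_ideal (S : set P) : S 0 -> (forall f g, S f -> S g -> S (f + g)) ->
  (forall a f, S f -> S (a *: f)) -> (forall f, S f -> S (x * f)) ->
  (forall f, S f -> S (y * f)) -> is_ideal S.
Proof.
move=> S0 SD SZ Sx Sy; split=> // f g Sg.
elim/mon_ind: f => [|f h hf hh|a i j].
- by rewrite mul0r.
- by rewrite mulrDl; exact: SD.
- rewrite -scalerAl mon_def -mulrA; apply: SZ.
  elim: i => [|i ih]; last by rewrite exprS -mulrA; exact: Sx.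
  rewrite expr0 mul1r.
  by elim: j => [|j ih]; rewrite ?expr0 ?mul1r // exprS -mulrA; exact: Sy.
Qed.

Section Closure.
Variables (I : set P) (idI : is_ideal I).

Lemma idl0 : I 0. Proof. by case: idI. Qed.
Lemma idlD f g : I f -> I g -> I (f + g). Proof. by case: idI => _ h _; exact: h. Qed.
Lemma idlM f g : I g -> I (f * g). Proof. by case: idI => _ _; apply. Qed.
Lemma idlZ a f : I f -> I (a *: f).
Proof. by move=> If; rewrite -mul_mpolyC; exact: idlM. Qed.
Lemma idlN f : I f -> I (- f). Proof. by move=> If; rewrite -scaleN1r; exact: idlZ. Qed.
Lemma idlB f g : I f -> I g -> I (f - g). Proof. by move=> If /idlN; exact: idlD. Qed.
Lemma idl_sum (T : Type) (r : seq T) (Q : pred T) (F : T -> P) :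
  (forall i, Q i -> I (F i)) -> I (\sum_(i <- r | Q i) F i).
Proof. by move=> h; elim/big_ind: _ => //; [exact: idl0 | exact: idlD]. Qed.
Lemma idl_mon i j k l : I (mon i j) -> (i <= k)%N -> (j <= l)%N -> I (mon k l).
Proof.
move=> Iij ik jl; rewrite -(subnK ik) -(subnK jl) -mul_mon; exact: idlM.
Qed.
Lemma idlZr a f : a != 0 -> I (a *: f) -> I f.
Proof. by move=> a0 /(idlZ a^-1); rewrite scalerA mulVf // scale1r. Qed.
Lemma idl_cong f g : I (f - g) -> I g -> I f.
Proof. by move=> h Ig; rewrite -(subrK g f); exact: idlD. Qed.
Lemma idl_swap a f g : a != 0 -> I (f + a *: g) -> I (g + a^-1 *: f).
Proof.
move=> a0 h; have := idlZ a^-1 h.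
by rewrite scalerDr addrC [a^-1 *: (a *: g)]scalerA (mulVf a0) scale1r.
Qed.
Lemma idlDr f g : I f -> I (f + g) -> I g.
Proof. by move=> If Ifg; rewrite -(addKr f g) addrC; apply: idlB. Qed.
Lemma idlDl f g : I g -> I (f + g) -> I f.
Proof. by move=> Ig; rewrite addrC; exact: idlDr. Qed.
End Closure.

End Ideals.

(** Projection onto the weight a, by averaging over the powers of the diagonal
   generator. *)
HB.lock Definition pr (R : realType) (m a : nat) (f : {mpoly R[i][2]}) : {mpoly R[i][2]} :=
  (m.*2)%:R^-1 *:
    \sum_(k < m.*2) zeta R m ^- (a * k) *: ac (hs (zeta R m ^+ k)) f.

Section Weights.
Variables (R : realType) (m : nat) (hm : (3 <= m)%N).
Local Notation C := R[i].
Local Notation P := {mpoly C[2]}.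
Local Notation z := (zeta R m).
Local Notation N := m.*2.
Local Notation mon := (@mon R).
Implicit Types (f g p q : P) (I : set P) (c : C).

Local Notation pr := (@pr R m).

Lemma prE a f : pr a f = N%:R^-1 *: \sum_(k < N) z ^- (a * k) *: ac (hs (z ^+ k)) f.
Proof. by rewrite unlock. Qed.

(** The eigenspace of eigenvalue zeta ^ a of the diagonal generator of H,
   described by the monomials that may occur. *)
Definition Wt (a : nat) f := forall i j, i != a + j %[mod N] -> cf f i j = 0.

(** This element of H exchanges the weights a and - a. *)
Definition tau : 'M[C]_2 := ad 1 (- 1).

Lemma ht_tau (s : C) : ht s = hs s *m tau.
Proof. by rewrite /ht /hs /tau dgadM !(mulr1, mulrN1). Qed.

Lemma H_tau : H R m tau.
Proof. by have := H_ht R hm 0; rewrite expr0 /ht invr1. Qed.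

Lemma cf_hs k f i j : cf (ac (hs (z ^+ k)) f) i j = z ^+ (k * i) / z ^+ (k * j) * cf f i j.
Proof. by rewrite cf_dg exprVn -!exprM. Qed.

Lemma cf_tau f i j : cf (ac tau f) i j = (-1) ^+ j * cf f j i.
Proof. by rewrite cf_ad expr1n mulr1. Qed.

Lemma tau_mon i j : ac tau (mon i j) = (-1) ^+ i *: mon j i.
Proof. by rewrite act_ad expr1n mulr1. Qed.

Lemma dl_mon i j : ac (dl R) (mon i j) = (-1) ^+ i *: mon i j.
Proof. by rewrite act_dg expr1n mulr1. Qed.

Lemma Wt_hs a k f : Wt a f -> ac (hs (z ^+ k)) f = z ^+ (a * k) *: f.
Proof.
move=> wf; apply: eq_cf => i j; rewrite cf_hs cfZ.
have [e|ne] := eqVneq (i %% N)%N ((a + j) %% N)%N; last by rewrite wf ?mulr0.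
congr (_ * _); apply: (mulIf (zeta_neq0 R hm (k * j))).
rewrite mulfVK ?(zeta_neq0 R hm) // -exprD.
by apply: zetaX_mod => //; rewrite -modnMmr e modnMmr mulnDr [(a * k)%N]mulnC.
Qed.

Lemma WtD a f g : Wt a f -> Wt a g -> Wt a (f + g).
Proof. by move=> hf hg i j e; rewrite cfD hf // hg // addr0. Qed.
Lemma WtZ a c f : Wt a f -> Wt a (c *: f).
Proof. by move=> hf i j e; rewrite cfZ hf // mulr0. Qed.
Lemma WtN a f : Wt a f -> Wt a (- f).
Proof. by move=> hf i j e; rewrite cfN hf // oppr0. Qed.
Lemma Wt_mon a i j : i = a + j %[mod N] -> Wt a (mon i j).
Proof.
move=> e k l; rewrite cf_mon; case: (i =P k) => [<-|] //=.
by have [<-|//] := eqVneq j l; rewrite e eqxx.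
Qed.
Lemma Wt_tau a b f : (N %| a + b)%N -> Wt b f -> Wt a (ac tau f).
Proof.
move=> hab wf i j ne; rewrite cf_tau wf ?mulr0 //.
apply: contra ne => /eqP e; apply/eqP.
by rewrite -modnDmr e modnDmr addnA -modnDml (eqP hab) add0n.
Qed.

Lemma Wt_dl a f : Wt a f -> Wt a (ac (dl R) f).
Proof. by move=> wf i j ne; rewrite cf_dg wf ?mulr0. Qed.

Lemma two_neq0 : (2%:R : C) != 0. Proof. by rewrite pnatr_eq0. Qed.

Lemma N_neq0 : (N%:R : C) != 0.
Proof. by rewrite pnatr_eq0; lia. Qed.

Lemma sum_unity (w : C) : w ^+ N = 1 -> \sum_(k < N) w ^+ k = (w == 1)%:R * N%:R.
Proof.
move=> w1; have [->|ne] := eqVneq w 1.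
  by rewrite mul1r (eq_bigr (fun=> 1)) ?sumr_const ?card_ord // => k _; rewrite expr1n.
rewrite mul0r; have := subrX1 w N; rewrite w1 subrr => /esym/eqP.
by rewrite mulf_eq0 subr_eq0 (negbTE ne) => /eqP.
Qed.

Lemma cf_sum (T : Type) (r : seq T) (Q : pred T) (F : T -> P) i j :
  cf (\sum_(k <- r | Q k) F k) i j = \sum_(k <- r | Q k) cf (F k) i j.
Proof.
by apply: (big_morph (fun p => cf p i j)) => [p q|]; rewrite ?cfD ?cf0.
Qed.

Lemma cf_pr a f i j : cf (pr a f) i j = (i == a + j %[mod N])%:R * cf f i j.
Proof.
rewrite prE cfZ cf_sum.
pose w : C := z ^+ i / z ^+ (a + j).
have wN : w ^+ N = 1.
  by rewrite exprMn exprVn -!exprM !zetaXN // invr1 mulr1.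
under eq_bigr => k _.
  rewrite cfZ cf_hs mulrA.
  have -> : z ^- (a * k) * (z ^+ (k * i) / z ^+ (k * j)) = w ^+ k.
    rewrite /w exprMn exprVn -!exprM mulnDl exprD invfM [(i * k)%N]mulnC [(j * k)%N]mulnC.
    by rewrite mulrCA mulrA.
  over.
rewrite -mulr_suml sum_unity //.
have -> : (w == 1) = (i == a + j %[mod N]).
  rewrite -(eq_zetaX R hm) -(inj_eq (mulIf (zeta_neq0 R hm (a + j)))).
  by rewrite /w mulfVK ?(zeta_neq0 R hm) // mul1r.
by case: (_ == _); rewrite ?mul0r ?mulr0 // mul1r mulrA mulVf ?N_neq0.
Qed.

Lemma Wt_pr a f : Wt a (pr a f).
Proof. by move=> i j ne; rewrite cf_pr (negbTE ne) mul0r. Qed.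

Lemma pr_id a f : Wt a f -> pr a f = f.
Proof.
move=> wf; apply: eq_cf => i j; rewrite cf_pr.
by have [e|ne] := eqVneq (i %% N)%N ((a + j) %% N)%N; rewrite ?mul1r // mul0r wf.
Qed.

Lemma pr_Wt0 a b f : (a < N)%N -> (b < N)%N -> a != b -> Wt b f -> pr a f = 0.
Proof.
move=> aN bN ab wf; apply: eq_cf => i j; rewrite cf_pr cf0.
have [e|ne] := eqVneq (i %% N)%N ((a + j) %% N)%N; last by rewrite mul0r.
rewrite mul1r wf // e eqn_modDr !modn_small //.
Qed.

Lemma prD a f g : pr a (f + g) = pr a f + pr a g.
Proof. by apply: eq_cf => i j; rewrite [RHS]cfD !cf_pr cfD mulrDr. Qed.
Lemma prZ a c f : pr a (c *: f) = c *: pr a f.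
Proof. by apply: eq_cf => i j; rewrite cf_pr cfZ [RHS]cfZ cf_pr mulrCA. Qed.
Lemma pr0 a : pr a 0 = 0.
Proof. by apply: eq_cf => i j; rewrite cf_pr cf0 mulr0. Qed.
Lemma prN a f : pr a (- f) = - pr a f.
Proof. by rewrite -scaleN1r prZ scaleN1r. Qed.
Lemma pr_sum a (T : Type) (r : seq T) (Q : pred T) (F : T -> P) :
  pr a (\sum_(k <- r | Q k) F k) = \sum_(k <- r | Q k) pr a (F k).
Proof. exact: (big_morph _ (prD a) (pr0 a)). Qed.

Lemma pr_hs a k f : pr a (ac (hs (z ^+ k)) f) = z ^+ (a * k) *: pr a f.
Proof.
rewrite -(Wt_hs k (@Wt_pr a f)); apply: eq_cf => i j.
by rewrite cf_pr !cf_hs cf_pr mulrCA.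
Qed.

Lemma pr_tau a b f : (N %| a + b)%N -> pr a (ac tau f) = ac tau (pr b f).
Proof.
move=> hab; apply: eq_cf => i j; rewrite cf_tau !cf_pr cf_tau mulrCA.
congr (_ * (_%:R * _)); rewrite -(eqn_modDl b) addnA [(b + a)%N]addnC -[in RHS]modnDml.
by rewrite -[in LHS](modnDml (a + b)) (eqP hab) !add0n eq_sym modnDml.
Qed.

Lemma sum_pr f : f = \sum_(a < N) pr a f.
Proof.
apply: eq_cf => i j; rewrite cf_sum.
under eq_bigr => a _ do rewrite cf_pr.
rewrite -mulr_suml -natr_sum.
have hN : (0 < N)%N by lia.
pose a0 := Ordinal (ltn_pmod (i + (N - j %% N)) hN).
rewrite (bigD1 a0) //= big1 => [|a ne].
  rewrite addn0 (_ : (_ == _) = true) ?mul1r //.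
  apply/eqP; rewrite modnDml -modnDmr -addnA.
  by rewrite subnK ?modnDr // ltnW // ltn_pmod.
apply/eqP; rewrite eqb0; apply: contra ne => /eqP e.
rewrite -val_eqE /= -modnDml e modnDml -addnA.
have -> : (a + (j + (N - j %% N)) = (j %/ N).+1 * N + a)%N.
  by rewrite {1}(divn_eq j N); have := ltn_pmod j hN; lia.
by rewrite modnMDl modn_small.
Qed.

Lemma pr_stable I a f : is_ideal I -> H_stable m I -> I f -> I (pr a f).
Proof.
move=> idI HI If; rewrite prE; apply: idlZ => //; apply: idl_sum => // k _; apply: idlZ => //.
by rewrite acE; apply: HI => //; exact: H_hs.
Qed.

Lemma tau_stable I f : H_stable m I -> I f -> I (ac tau f).
Proof. by move=> HI If; rewrite acE; apply: HI => //; exact: H_tau. Qed.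

Lemma tau_tau f : ac tau (ac tau f) = ac (hs (z ^+ m)) f.
Proof.
rewrite -act_mulmx /tau adM mul1r mulr1; congr (ac _ f).
by rewrite /hs zetam // invrN invr1.
Qed.

End Weights.

(** * The regular representation, weight by weight *)

Section Regular.
Variables (R : realType) (m : nat) (hm : (3 <= m)%N).
Local Notation C := R[i].
Local Notation P := {mpoly C[2]}.
Local Notation z := (zeta R m).
Local Notation N := m.*2.
Local Notation tau := (tau R).
Implicit Types (f g p q : P) (I : set P).

Definition orb (p : P) (c d : 'I_N -> C) : P :=
  \sum_(k < N) c k *: ac (hs (z ^+ k)) p + \sum_(k < N) d k *: ac (ht (z ^+ k)) p.

(** The H-orbit of p is a basis of the quotient by I; orb p c d is the general
   combination of the orbit. *)
Definition cyclic_basis I p :=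
  (forall q, exists c d, I (q - orb p c d)) /\
  (forall c d, I (orb p c d) -> forall k, c k = 0 /\ d k = 0).

Definition glue (c d : 'I_N -> C) (h : 'M[C]_2) : C :=
  if [pick k : 'I_N | h == hs (z ^+ k)] is Some k then c k
  else if [pick k : 'I_N | h == ht (z ^+ k)] is Some k then d k else 0.

Lemma glue_hs c d (k : 'I_N) : glue c d (hs (z ^+ k)) = c k.
Proof.
rewrite /glue; case: pickP => [l /eqP/hs_inj e|/(_ k)]; last by rewrite eqxx.
by congr c; apply/val_inj/esym/(zetaX_inj hm _ _ e); exact: ltn_ord.
Qed.

Lemma glue_ht c d (k : 'I_N) : glue c d (ht (z ^+ k)) = d k.
Proof.
rewrite /glue; case: pickP => [l /eqP/esym/(hs_ht hm)//|_].
case: pickP => [l /eqP/ht_inj e|/(_ k)]; last by rewrite eqxx.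
by congr d; apply/val_inj/esym/(zetaX_inj hm _ _ e); exact: ltn_ord.
Qed.

(** Modulo I the lift attached to h is the h-translate of the lift attached
   to 1, which is therefore a cyclic vector. *)
Lemma regular_quotient_cyclic I : is_ideal I ->
  regular_quotient m I -> exists p, cyclic_basis I p.
Proof.
move=> idI [f [f1 f2 f3]]; exists (f 1%:M).
have eqf h : H R m h -> I (f h - ac h (f 1%:M)).
  move=> Hh; have := f1 h 1%:M Hh (H1 R m); rewrite mulmx1 -acE => e.
  by rewrite -opprB; exact: idlN.
have cong (c : 'M[C]_2 -> C) : I (\sum_(h \in H R m) c h *: f h -
    orb (f 1%:M) (fun k => c (hs (z ^+ k))) (fun k => c (ht (z ^+ k)))).
  rewrite (sum_H hm) /orb opprD addrACA -!sumrB.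
  apply: idlD => //; apply: idl_sum => // k _; rewrite -scalerBr; apply: idlZ => //;
    apply: eqf; [exact: H_hs | exact: H_ht].
split.
- move=> q; have [c hc] := f2 q.
  exists (fun k => c (hs (z ^+ k))), (fun k => c (ht (z ^+ k))).
  by have := idlD idI hc (cong c); rewrite addrA subrK.
- move=> c d h k; have := cong (glue c d).
  rewrite /orb; under [X in _ - (X + _)]eq_bigr => j _ do rewrite glue_hs.
  under [X in _ - (_ + X)]eq_bigr => j _ do rewrite glue_ht.
  move=> /(idl_cong idI)/(_ h)/f3 e.
  by rewrite -(glue_hs c d k) -(glue_ht c d k) !e //; [exact: H_ht | exact: H_hs].
Qed.

Lemma cyclic_regular_quotient I p : is_ideal I ->
  cyclic_basis I p -> regular_quotient m I.
Proof.
move=> idI [b1 b2]; exists (fun h => act h p).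
have E c : \sum_(h \in H R m) c h *: act h p =
    orb p (fun k => c (hs (z ^+ k))) (fun k => c (ht (z ^+ k))).
  rewrite (sum_H hm) /orb.
  by congr (_ + _); apply: eq_bigr => k _; rewrite acE.
split.
- by move=> g h _ _; rewrite -!acE act_mulmx subrr; exact: idl0.
- move=> q; have [c [d h]] := b1 q; exists (glue c d); rewrite E /orb.
  under eq_bigr => j _ do rewrite glue_hs.
  under [X in _ - (_ + X)]eq_bigr => j _ do rewrite glue_ht.
  exact: h.
- move=> c; rewrite E => /b2 h g /(H_cases hm)[k kN].
  by have [e1 e2] := h (Ordinal kN); case=> ->; [exact: e1|exact: e2].
Qed.

Lemma cyclic_basis_mod I p : is_ideal I -> cyclic_basis I p ->
  exists B : 'I_(N + N) -> P, basis_mod I B.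
Proof.
move=> idI [b1 b2].
exists (fun i => match split i with
  | inl k => ac (hs (z ^+ k)) p | inr k => ac (ht (z ^+ k)) p end).
have E (c : 'I_(N + N) -> C) : \sum_j c j *: (match split j with
  | inl k => ac (hs (z ^+ k)) p | inr k => ac (ht (z ^+ k)) p end) =
  orb p (fun k => c (lshift N k)) (fun k => c (rshift N k)).
  rewrite big_split_ord /orb; congr (_ + _); apply: eq_bigr => k _.
    by rewrite (unsplitK (inl k)).
  by rewrite (unsplitK (inr k)).
split.
- move=> q; have [c [d h]] := b1 q.
  exists (fun i => match split i with inl k => c k | inr k => d k end).
  rewrite E /orb.
  under eq_bigr => k _ do rewrite (unsplitK (inl k)).
  by under [X in _ - (_ + X)]eq_bigr => k _ do rewrite (unsplitK (inr k)).
- move=> c; rewrite E => /b2 h j.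
  by rewrite -(splitK j); case: (split j) => k; have [] := h k.
Qed.

Definition weight_basis I a (u v : P) :=
  (forall f, Wt m a f -> exists al be : C, I (f - (al *: u + be *: v))) /\
  (forall al be : C, I (al *: u + be *: v) -> al = 0 /\ be = 0).

(** The regular representation of H in terms of weights: every weight a has
   multiplicity two, and tau exchanges the weights a and b when a + b = 0
   modulo N. *)
Definition regular_weights I (u : nat -> P) :=
  (forall a, (a < N)%N -> Wt m a (u a)) /\
  (forall a b, (a < N)%N -> (b < N)%N -> (N %| a + b)%N ->
    weight_basis I a (u a) (ac tau (u b))).

Lemma ex_opp a : (a < N)%N -> exists2 b, (b < N)%N & (N %| a + b)%N.
Proof.
move=> aN; case: a aN => [|a] aN; first by exists 0; rewrite ?dvdn0.
by exists (N - a.+1)%N; [lia | rewrite subnKC ?dvdnn // ltnW].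
Qed.

Lemma pr_orb a b p c d : (a < N)%N -> (N %| a + b)%N ->
  pr m a (orb p c d) = (\sum_(k < N) z ^+ (a * k) * c k) *: pr m a p +
                     (\sum_(k < N) z ^+ (a * k) * d k) *: ac tau (pr m b p).
Proof.
move=> aN hab; rewrite /orb (prD hm) !(pr_sum hm) !scaler_suml; congr (_ + _);
  apply: eq_bigr => k _; rewrite (prZ hm).
- by rewrite pr_hs // scalerA [c k * _]mulrC.
- by rewrite ht_tau act_mulmx pr_hs // (pr_tau hm _ hab) scalerA [d k * _]mulrC.
Qed.

(** The weight components of a cyclic vector serve as u: the passage from the
   orbit to these components and their images under tau is a discrete Fourier
   transform. *)
Lemma cyclic_regular_weights I p : is_ideal I -> H_stable m I ->
  cyclic_basis I p -> exists u, regular_weights I u.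
Proof.
move=> idI HI [b1 b2]; exists (fun a => pr m a p); split=> [a aN|a b aN bN hab].
  exact: Wt_pr.
split=> [f wf|al be h].
- have [c [d h]] := b1 f.
  have := pr_stable hm a idI HI h.
  rewrite (prD hm). rewrite (prN hm). rewrite (pr_id hm wf) (pr_orb _ _ _ aN hab) => {}h.
  by do 2 eexists; exact: h.
- pose w k : C := N%:R^-1 * z ^- (a * k).
  have e1 : pr m a p = \sum_(k < N) w k *: ac (hs (z ^+ k)) p.
    by rewrite prE scaler_sumr; apply: eq_bigr => k _; rewrite scalerA.
  have e2 : ac tau (pr m b p) = \sum_(k < N) w k *: ac (ht (z ^+ k)) p.
    rewrite -(pr_tau hm _ hab) prE scaler_sumr; apply: eq_bigr => k _.
    by rewrite scalerA ht_tau act_mulmx.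
  have hN : (0 < N)%N by lia.
  have := h; rewrite e1 e2 !scaler_sumr.
  under eq_bigr => k _ do rewrite scalerA.
  under [X in _ + X]eq_bigr => k _ do rewrite scalerA.
  move=> /b2/(_ (Ordinal hN)) [/eqP h1 /eqP h2].
  have w0 : w 0 != 0 by rewrite mulf_neq0 ?invr_eq0 ?(N_neq0 R hm) ?(zeta_neq0 R hm).
  by split; apply/eqP; [move: h1 | move: h2]; rewrite mulf_eq0 (negbTE w0) orbF.
Qed.

(** Fourier inversion on the integers modulo N. *)
Lemma fourier0 (c : 'I_N -> C) :
  (forall a, (a < N)%N -> \sum_(k < N) z ^+ (a * k) * c k = 0) -> forall k, c k = 0.
Proof.
move=> h k.
have : \sum_(a < N) z ^- (a * k) * \sum_(l < N) z ^+ (a * l) * c l = 0.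
  by rewrite big1 // => a _; rewrite h ?mulr0.
under eq_bigr => a _ do rewrite mulr_sumr.
rewrite exchange_big /= (bigD1 k) //= [X in _ + X]big1 ?addr0.
  under eq_bigr => a _ do rewrite mulrA mulVf ?(zeta_neq0 R hm) // mul1r.
  rewrite sumr_const card_ord -mulr_natl => /eqP.
  by rewrite mulf_eq0 (negbTE (N_neq0 R hm)) => /eqP.
move=> l ne; pose w : C := z ^+ l / z ^+ k.
under eq_bigr => a _.
  have -> : z ^- (a * k) * (z ^+ (a * l) * c l) = w ^+ a * c l.
    by rewrite /w exprMn exprVn -!exprM [(l * a)%N]mulnC [(k * a)%N]mulnC mulrA [_ * z ^+ _]mulrC.
  over.
rewrite -mulr_suml sum_unity //; last first.
  by rewrite exprMn exprVn -!exprM !zetaXN // invr1 mulr1.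
rewrite (_ : (w == 1) = false) ?mul0r //; apply/negbTE; apply: contra ne => /eqP e.
apply/eqP/val_inj/(zetaX_inj (R := R) hm) => //=.
by rewrite -[LHS](mulfVK (zeta_neq0 R hm k)) -/w e mul1r.
Qed.

(** The sum of the u a is a cyclic vector: averaging recovers each u a from the
   orbit, and Fourier inversion gives the independence of the orbit. *)
Lemma regular_weights_cyclic I u : is_ideal I -> H_stable m I ->
  regular_weights I u -> exists p, cyclic_basis I p.
Proof.
move=> idI HI [wu bu]; pose p := \sum_(a < N) u a; exists p.
have prp a : (a < N)%N -> pr m a p = u a.
  move=> aN; rewrite /p (pr_sum hm) (bigD1 (Ordinal aN)) //= pr_id //; last exact: wu.
  rewrite big1 ?addr0 // => b ne; apply: (@pr_Wt0 _ _ hm a b) => //; last exact: wu.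
  by rewrite eq_sym.
pose S q := exists c d, I (q - orb p c d).
have orbD c d c' d' : orb p (fun k => c k + c' k) (fun k => d k + d' k) =
    orb p c d + orb p c' d'.
  rewrite /orb addrACA; congr (_ + _); rewrite -big_split /=;
  by apply: eq_bigr => k _; rewrite scalerDl.
have orbZ a c d : orb p (fun k => a * c k) (fun k => a * d k) = a *: orb p c d.
  by rewrite /orb scalerDr !scaler_sumr; congr (_ + _); apply: eq_bigr => k _; rewrite scalerA.
have SD q q' : S q -> S q' -> S (q + q').
  move=> [c [d h]] [c' [d' h']]; exists (fun k => c k + c' k), (fun k => d k + d' k).
  by rewrite orbD opprD addrACA; exact: idlD.
have SZ a q : S q -> S (a *: q).
  move=> [c [d h]]; exists (fun k => a * c k), (fun k => a * d k).
  by rewrite orbZ -scalerBr; exact: idlZ.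
have SI q : I q -> S q.
  move=> Iq; exists (fun=> 0), (fun=> 0); rewrite /orb.
  by rewrite !big1 ?addr0 ?subr0 // => k _; rewrite scale0r.
have Ssum (F : nat -> P) : (forall k, (k < N)%N -> S (F k)) -> S (\sum_(k < N) F k).
  move=> h; elim/big_ind: _ => [||k _]; [exact: SI (idl0 idI) | exact: SD | exact: h].
have Shs k : (k < N)%N -> S (ac (hs (z ^+ k)) p).
  move=> kN; exists (fun j => (j == Ordinal kN)%:R), (fun=> 0).
  rewrite /orb [X in _ - (_ + X)]big1 => [|j _]; last by rewrite scale0r.
  rewrite (bigD1 (Ordinal kN)) //= eqxx scale1r big1 ?addr0 ?subrr.
    exact: idl0.
  by move=> j /negbTE ->; rewrite scale0r.
have Sht k : (k < N)%N -> S (ac (ht (z ^+ k)) p).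
  move=> kN; exists (fun=> 0), (fun j => (j == Ordinal kN)%:R).
  rewrite /orb [X in _ - (X + _)]big1 => [|j _]; last by rewrite scale0r.
  rewrite (bigD1 (Ordinal kN)) //= eqxx scale1r big1 ?addr0 ?add0r ?subrr.
    exact: idl0.
  by move=> j /negbTE ->; rewrite scale0r.
split.
- move=> q; rewrite -/(S q) (sum_pr hm q).
  apply: (Ssum (fun a => pr m a q)) => a aN.
  have [b bN hab] := ex_opp aN.
  have [al [be h]] := (bu a b aN bN hab).1 _ (Wt_pr hm q (a := a)).
  rewrite -(subrK (al *: u a + be *: ac tau (u b)) (pr m a q)).
  apply: (SD); first exact: SI.
  apply: (SD); apply: (SZ).
    rewrite -(prp _ aN) prE; apply: (SZ); apply: (Ssum (fun k => z ^- (a * k) *: ac (hs (z ^+ k)) p)) => k kN.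
    by apply: (SZ); exact: Shs.
  rewrite -(prp _ bN) -(pr_tau hm _ hab) prE; apply: (SZ).
  apply: (Ssum (fun k => z ^- (a * k) *: ac (hs (z ^+ k)) (ac tau p))) => k kN.
  by apply: (SZ); rewrite -act_mulmx -ht_tau; exact: Sht.
- move=> c d h k.
  have key a : (a < N)%N -> \sum_(k < N) z ^+ (a * k) * c k = 0 /\ \sum_(k < N) z ^+ (a * k) * d k = 0.
    move=> aN; have [b bN hab] := ex_opp aN.
    have := pr_stable hm a idI HI h; rewrite (pr_orb _ _ _ aN hab) !prp //.
    exact: (bu a b aN bN hab).2.
  split; [apply: (@fourier0 c) | apply: (@fourier0 d)] => a aN; by have [] := key a aN.
Qed.

End Regular.

(** * The ideal n *)

Section Invariants.
Variables (R : realType) (m : nat) (hm : (3 <= m)%N).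
Local Notation C := R[i].
Local Notation P := {mpoly C[2]}.
Local Notation z := (zeta R m).
Local Notation N := m.*2.
Local Notation mon := (@mon R).
Local Notation cf := (@cf R).
Local Notation tau := (tau R).
Local Notation nn := (nn R m).
Implicit Types (f p : P) (I : set P).

Lemma nn_ideal : is_ideal nn.
Proof. exact: ideal_gen_ideal. Qed.

Lemma invariant_nn f :
  (forall s : C, s ^+ N = 1 -> ac (hs s) f = f) ->
  (forall s : C, s ^+ N = 1 -> ac (ht s) f = f) -> cf f 0 0 = 0 -> nn f.
Proof.
move=> h1 h2 h0; apply: ideal_gen_sub; split; last by rewrite eval0_cf.
move=> h /(H_cases hm)[k _ e]; rewrite -acE.
have zk : (z ^+ k) ^+ N = 1 by rewrite -exprM zetaXN.
by case: e => ->; [exact: h1 | exact: h2].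
Qed.

Lemma unity_sN (s : C) : s ^+ N = 1 -> s^-1 ^+ N = 1.
Proof. by move=> e; rewrite exprVn e invr1. Qed.

Lemma sqrN1 k : (- 1 : C) ^+ k.*2 = 1.
Proof. by rewrite -mul2n exprM sqrrN !expr1n. Qed.

Lemma htE_ad (s : C) : ht s = ad s (-1 * s^-1).
Proof. by rewrite mulN1r. Qed.

Lemma nn_x2y2 : nn (mon 2 2).
Proof.
apply: invariant_nn => [s s1|s s1|]; last by rewrite cf_mon.
- by rewrite act_dg -exprMn mulfV ?(unity_neq0 hm s1) // expr1n scale1r.
- rewrite htE_ad act_ad -exprMn -mulrA mulVf ?(unity_neq0 hm s1) // mulr1.
  by rewrite (sqrN1 1) scale1r.
Qed.

Lemma nn_sum : nn (mon N 0 + mon 0 N).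
Proof.
apply: invariant_nn => [s s1|s s1|].
- by rewrite actD !act_dg !expr0 unity_sN // s1 !mulr1 !scale1r.
- rewrite htE_ad actD !act_ad !expr0 exprMn unity_sN // s1 sqrN1 !mulr1 !scale1r.
  exact: addrC.
- by rewrite cfD !cf_mon andbC /= eqn0Ngt double_gt0 (ltnW (ltnW hm)) addr0.
Qed.

Lemma nn_diff : nn (mon N.+1 1 - mon 1 N.+1).
Proof.
apply: invariant_nn => [s s1|s s1|].
- have s0 := unity_neq0 hm s1.
  rewrite actB !act_dg !exprS !expr0 unity_sN // s1 !mulr1 mulfV //.
  by rewrite !scale1r.
- have s0 := unity_neq0 hm s1.
  rewrite htE_ad actB !act_ad !exprS !expr0 !exprMn unity_sN // s1 sqrN1 !mulr1.
  rewrite -!mulrA mulVf // !mulr1 !scaleN1r opprK.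
  exact: addrC.
- by rewrite cfB !cf_mon subrr.
Qed.

(** The monomials with exponents N + 1 and 1 are obtained by adding and
   subtracting the invariant x y (x ^ N - y ^ N) and the multiple x y (x ^ N + y ^ N)
   of an invariant. *)
Lemma nn_mon i j : [|| (2 <= i)%N && (2 <= j)%N, (j == 1)%N && (N < i)%N,
  (i == 1)%N && (N < j)%N, N.+1 < i | N.+1 < j]%N -> nn (mon i j).
Proof.
have idn := nn_ideal.
have h22 i' j' : (2 <= i')%N -> (2 <= j')%N -> nn (mon i' j').
  by move=> hi hj; apply: (idl_mon idn nn_x2y2).
have two0 := two_neq0 R.
have e1 : nn (mon N.+1 1 + mon 1 N.+1).
  have := idlM idn (mon 1 1) nn_sum.
  by rewrite mulrDr !mul_mon !(addn0, add1n, add0n).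
have hx : nn (mon N.+1 1).
  apply: (idlZr idn two0); have := idlD idn e1 nn_diff.
  by rewrite addrACA subrr addr0 -mulr2n scaler_nat.
have hy : nn (mon 1 N.+1).
  by apply: (idlDr idn hx).
have hxx : nn (mon N.+2 0).
  have := idlM idn (mon 2 0) nn_sum; rewrite mulrDr !mul_mon addn0 add0n addn0 add2n.
  by apply: (idlDl idn); apply: h22 => //; lia.
have hyy : nn (mon 0 N.+2).
  have := idlM idn (mon 0 2) nn_sum; rewrite mulrDr !mul_mon addn0 !add0n add2n.
  by apply: (idlDr idn); apply: h22 => //; lia.
case/or4P => [/andP[]|/andP[/eqP -> hi]|/andP[/eqP -> hj]|/orP[]h].
- exact: h22.
- by apply: (idl_mon idn hx).
- by apply: (idl_mon idn hy).
- by apply: (idl_mon idn hxx).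
- by apply: (idl_mon idn hyy).
Qed.

Lemma nn_xN1 : nn (mon N.+1 0 + mon 1 N).
Proof. by have := idlM nn_ideal (mon 1 0) nn_sum; rewrite mulrDr !mul_mon addn0 add1n. Qed.

Lemma nn_yN1 : nn (mon 0 N.+1 + mon N 1).
Proof.
have := idlM nn_ideal (mon 0 1) nn_sum; rewrite mulrDr !mul_mon !add0n addn0 add1n.
by rewrite addrC.
Qed.

(** Invariance under the diagonal generator and tau is a condition on coefficients,
   so the test of n against I becomes a matter of coefficients. *)
Lemma nn_min I : is_ideal I ->
  (forall f, Wt m 0 f -> ac tau f = f -> cf f 0 0 = 0 -> I f) -> nn `<=` I.
Proof.
move=> idI h; apply: ideal_gen_min => // f [finv f0]; apply: h.
- move=> i j ne; apply/eqP; apply: contraNT ne => c0.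
  have := congr1 (fun p => cf p i j) (finv _ (H_hs R hm 1)).
  rewrite -acE cf_hs !mul1n => /eqP.
  rewrite -subr_eq0 -{2}[cf f i j]mul1r -mulrBl mulf_eq0 (negbTE c0) orbF subr_eq0.
  rewrite add0n -(eq_zetaX R hm) => /eqP e; apply/eqP.
  by rewrite -[LHS](mulfVK (zeta_neq0 R hm j)) e mul1r.
- by rewrite acE; apply: finv; exact: H_tau.
- by rewrite -eval0_cf.
Qed.

Lemma cf_ac_00 g f : G R m g -> cf (ac g f) 0 0 = cf f 0 0.
Proof.
move=> /(G_form hm)[s [t [_ _ [] ->]]].
  by rewrite cf_dg !expr0 !mul1r.
by rewrite cf_ad !expr0 !mul1r.
Qed.

(** H is normal in G, so G permutes the invariants of H. *)
Lemma nn_G g f : G R m g -> nn f -> nn (ac g f).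
Proof.
move=> Gg; move: f; apply: ideal_gen_min.
  split.
  - by rewrite act0; exact: idl0 nn_ideal.
  - by move=> p q hp hq; rewrite actD; exact: idlD nn_ideal _ _ hp hq.
  - by move=> p q hq; rewrite actM; exact: idlM nn_ideal _ _ hq.
move=> f [finv f0]; apply: ideal_gen_sub; split; last by rewrite eval0_cf cf_ac_00 // -eval0_cf.
move=> h Hh; rewrite -acE -act_mulmx.
have e : h *m g = g *m (invmx g *m h *m g) by rewrite !mulmxA mulmxV ?mul1mx // (G_unit hm Gg).
by rewrite e act_mulmx acE [ac _ f]acE (finv _ (HJ hm Gg Hh)) -acE.
Qed.

Lemma Wt_ind a (S : P -> Prop) : S 0 -> (forall p q, S p -> S q -> S (p + q)) ->
  (forall (c : C) p, S p -> S (c *: p)) ->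
  (forall i j, i = a + j %[mod N] -> S (mon i j)) -> forall f, Wt m a f -> S f.
Proof.
move=> S0 SD SZ Sm f wf; rewrite [f]mon_expansion.
elim/big_ind: _ => // d _.
have [e|ne] := eqVneq (d ord0 %% N)%N ((a + d ord_max) %% N)%N.
  by apply: (SZ); exact: Sm.
by rewrite wf // scale0r.
Qed.

Lemma mod_cases i b : i = b %[mod N] -> exists q, i = (b + q * N)%N \/ b = (i + q * N)%N.
Proof.
move=> e; have [le|lt] := leqP b i.
- exists ((i - b) %/ N)%N; left.
  have : (N %| i - b)%N by rewrite -eqn_mod_dvd // e.
  by move=> /divnK ->; rewrite subnKC.
- exists ((b - i) %/ N)%N; right.
  have : (N %| b - i)%N by rewrite -eqn_mod_dvd ?e // ltnW.
  by move=> /divnK ->; rewrite subnKC // ltnW.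
Qed.

Lemma add3 (V : zmodType) (a b c a' b' c' : V) :
  a + b + c + (a' + b' + c') = a + a' + (b + b') + (c + c').
Proof. by rewrite addrACA; congr (_ + _); rewrite addrACA. Qed.

Lemma add4 (V : zmodType) (a b c d a' b' c' d' : V) :
  a + b + c + d + (a' + b' + c' + d') = a + a' + (b + b') + (c + c') + (d + d').
Proof. by rewrite addrACA add3. Qed.

(** A monomial x ^ i y ^ j of weight a has i = a + j modulo N. Unless it is one of
   the four, it is divisible by x ^ 2 y ^ 2 or of degree large enough to be reduced
   by x ^ N + y ^ N and x y (x ^ N - y ^ N). *)
Lemma weight_span a f : (1 <= a < N)%N -> Wt m a f ->
  exists c1 c2 c3 c4 : C, nn (f - (c1 *: mon a 0 + c2 *: mon 0 (N - a) +
                               c3 *: mon a.+1 1 + c4 *: mon 1 (N - a).+1)).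
Proof.
move=> /andP[a1 aN]; have idn := nn_ideal.
pose S f := exists c1 c2 c3 c4 : C, nn (f - (c1 *: mon a 0 + c2 *: mon 0 (N - a) +
                               c3 *: mon a.+1 1 + c4 *: mon 1 (N - a).+1)).
rewrite -/(S f).
have Sn p : nn p -> S p.
  by move=> hp; exists 0, 0, 0, 0; rewrite !scale0r !addr0 subr0.
have S1 : S (mon a 0).
  by exists 1, 0, 0, 0; rewrite !scale0r scale1r !addr0 subrr; exact: idl0.
have S2 : S (mon 0 (N - a)).
  by exists 0, 1, 0, 0; rewrite !scale0r scale1r !addr0 add0r subrr; exact: idl0.
have S3 : S (mon a.+1 1).
  by exists 0, 0, 1, 0; rewrite !scale0r scale1r !addr0 !add0r subrr; exact: idl0.
have S4 : S (mon 1 (N - a).+1).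
  by exists 0, 0, 0, 1; rewrite !scale0r scale1r !addr0 !add0r subrr; exact: idl0.
have SD p (q : P) : S p -> S q -> S (p + q).
  move=> [c1 [c2 [c3 [c4 h]]]] [d1 [d2 [d3 [d4 k]]]].
  exists (c1 + d1), (c2 + d2), (c3 + d3), (c4 + d4).
  by have := idlD idn h k; rewrite addrACA -opprD add4 -!scalerDl.
have SZ (c : C) p : S p -> S (c *: p).
  move=> [c1 [c2 [c3 [c4 h]]]]; exists (c * c1), (c * c2), (c * c3), (c * c4).
  by have := idlZ idn c h; rewrite scalerBr !scalerDr !scalerA.
have Sneg p (q : P) : nn (p + q) -> S q -> S p.
  move=> h /(SZ (-1)); rewrite scaleN1r => hq.
  by rewrite -(addrK q p); apply: SD => //; exact: Sn.
move: f; apply: Wt_ind => //; first by exact: Sn (idl0 idn).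
move=> i j /mod_cases[q e].
have {q}e : (i = a + j \/ i = a + j + N \/ a + j + 2 * N <= i \/ a + j = i + N \/
    a + j = i + 2 * N \/ i + 3 * N <= a + j)%N.
  by case: q e => [|[|[|q]]]; rewrite ?mulSn; nia.
case: j e => [|[|j]].
- rewrite addn0 => e; have [->|e'] : (i = a \/ (i = a + N \/ a + 2 * N <= i))%N by lia.
    by [].
  have [[a1' ei]|h] : (a = 1 /\ i = N.+1 \/ N.+1 < i)%N by lia.
    rewrite ei; apply: (Sneg _ (mon 1 N)); first exact: nn_xN1.
    by have -> : N = (N - a).+1 by lia.
  by apply: Sn; apply: nn_mon; rewrite h !orbT.
- rewrite addn1 => e; have [hi|[[-> ea]|hi]] : i = a.+1 \/ (i = 0 /\ N - a = 1)%N \/ (N < i)%N by lia.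
  + by rewrite hi.
  + by rewrite -ea.
  + by apply: Sn; apply: nn_mon; rewrite hi /= orbT.
- move=> e; have [hi|[hi|hi]] : (i = 0 \/ i = 1 \/ 2 <= i)%N by lia.
  + have [hj|[[hj ha]|hj]] : (j.+2 = N - a \/ (j.+2 = N.+1 /\ a = N.-1) \/ N.+1 < j.+2)%N by lia.
    * by rewrite hi hj.
    * rewrite hi hj; apply: (Sneg _ (mon N 1)); first exact: nn_yN1.
      by have -> : N = a.+1 by lia.
    * by apply: Sn; apply: nn_mon; rewrite hj !orbT.
  + have [hj|hj] : (j.+2 = (N - a).+1 \/ N < j.+2)%N by lia.
    * by rewrite hi hj.
    * by apply: Sn; apply: nn_mon; rewrite hi hj ?orbT.
  + by apply: Sn; apply: nn_mon; rewrite hi.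
Qed.

Lemma weight0_span f : Wt m 0 f ->
  exists c1 c2 c3 : C, nn (f - (c1 *: mon 0 0 + c2 *: mon 1 1 + c3 *: mon 0 N)).
Proof.
have idn := nn_ideal.
pose S f := exists c1 c2 c3 : C, nn (f - (c1 *: mon 0 0 + c2 *: mon 1 1 + c3 *: mon 0 N)).
rewrite -/(S f).
have Sn p : nn p -> S p.
  by move=> hp; exists 0, 0, 0; rewrite !scale0r !addr0 subr0.
have S1 : S (mon 0 0).
  by exists 1, 0, 0; rewrite !scale0r scale1r !addr0 subrr; exact: idl0.
have S2 : S (mon 1 1).
  by exists 0, 1, 0; rewrite !scale0r scale1r !addr0 add0r subrr; exact: idl0.
have S3 : S (mon 0 N).
  by exists 0, 0, 1; rewrite !scale0r scale1r !add0r subrr; exact: idl0.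
have SD p (q : P) : S p -> S q -> S (p + q).
  move=> [c1 [c2 [c3 h]]] [d1 [d2 [d3 k]]].
  exists (c1 + d1), (c2 + d2), (c3 + d3).
  by have := idlD idn h k; rewrite addrACA -opprD add3 -!scalerDl.
have SZ (c : C) p : S p -> S (c *: p).
  move=> [c1 [c2 [c3 h]]]; exists (c * c1), (c * c2), (c * c3).
  by have := idlZ idn c h; rewrite scalerBr !scalerDr !scalerA.
have Sneg p (q : P) : nn (p + q) -> S q -> S p.
  move=> h /(SZ (-1)); rewrite scaleN1r => hq.
  by rewrite -(addrK q p); apply: SD => //; exact: Sn.
move: f; apply: Wt_ind => //; first by exact: Sn (idl0 idn).
move=> i j /mod_cases[q e]; rewrite add0n in e.
have {}e : (i = j \/ (i = j + N \/ j = i + N) \/ (j + N.+2 <= i \/ i + N.+2 <= j))%N.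
  by case: q e => [|[|q]]; rewrite ?mulSn; nia.
have [hij|[[hi hj]|[[hi hj]|h]]] : (i = j /\ (j <= 1)%N \/ (i = N /\ j = 0) \/ (i = 0 /\ j = N) \/
  [|| (2 <= i)%N && (2 <= j)%N, (j == 1)%N && (N < i)%N,
  (i == 1)%N && (N < j)%N, N.+1 < i | N.+1 < j]%N)%N by lia.
- by case: hij => ->; case: j {e} => [|[|]].
- by rewrite hi hj; apply: (Sneg _ (mon 0 N)); first exact: nn_sum.
- by rewrite hi hj.
- by apply: Sn; apply: nn_mon.
Qed.

End Invariants.

(** * Exceptional points as ideals *)

Section Exceptional.
Variables (R : realType) (m : nat) (hm : (3 <= m)%N).
Local Notation C := R[i].
Local Notation P := {mpoly C[2]}.
Local Notation N := m.*2.
Local Notation mon := (@mon R).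
Local Notation cf := (@cf R).
Local Notation tau := (tau R).
Local Notation nn := (nn R m).
Implicit Types (f p : P) (I : set P).

(** A description of the exceptional points by conditions on I alone. The support
   condition becomes that I contains n and vanishes at the origin, and the
   structure of the quotient is expressed by weights. *)
Record good I : Prop := Good {
  good_ideal : is_ideal I;
  good_stable : H_stable m I;
  good_nn : nn `<=` I;
  good_origin : forall f, I f -> cf f 0 0 = 0;
  good_regular : exists u, regular_weights m I u }.

Lemma tau_tau0 f : Wt m 0 f -> ac tau (ac tau f) = f.
Proof. by move=> wf; rewrite (tau_tau hm) (Wt_hs hm m wf) mul0n expr0 scale1r. Qed.

Lemma sub3 (V : zmodType) (a b c a' b' c' : V) :
  a - a' + (b - b') + (c - c') = a + b + c - (a' + b' + c').
Proof. by rewrite !opprD add3. Qed.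

Lemma zmod_swap (V : zmodType) (a b c d : V) : a - b + (c - d) = c - b + (a - d).
Proof. by rewrite addrACA [RHS]addrACA [a + c]addrC. Qed.

(** x ^ 2 y ^ 2 and x ^ N + y ^ N have the origin as their only common zero. *)
Lemma good_exceptional I : good I -> exceptional R m I.
Proof.
move=> [idI HI nnI I0 [u hu]]; split.
  split=> //; have [p hp] := regular_weights_cyclic hm idI HI hu.
  exact: (cyclic_regular_quotient hm idI hp).
move=> a; split=> [h i|a0 f If].
- have := h _ (nnI _ (nn_x2y2 hm)); rewrite meval_mon -exprMn => /eqP.
  rewrite expf_eq0 /= mulf_eq0 => ha.
  have := h _ (nnI _ (nn_sum hm)); rewrite mevalD !meval_mon !expr0 mulr1 mul1r => hs.
  have N0 : (0 < N)%N by lia.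
  have [a00 a10] : a ord0 = 0 /\ a ord_max = 0.
    case/orP: ha => /eqP e; split=> //; apply/eqP; move/eqP: hs;
    by rewrite e expr0n eqn0Ngt N0 /= ?add0r ?addr0 expf_eq0 N0.
  by case: i => [[|[|//]] hi]; [rewrite -[RHS]a00 | rewrite -[RHS]a10]; congr a; apply/val_inj.
- by rewrite -(I0 f If) -eval0_cf; apply: meval_eq => i; rewrite a0.
Qed.

(** To see that I contains n: in weight 0 the quotient has basis u_0, tau u_0, so
   its tau-invariant part is a line. This line is spanned by 1, which is not in I.
   An invariant is thus congruent to a constant modulo I, and the constant is 0
   if the invariant vanishes at the origin. *)
Lemma exceptional_good I : exceptional R m I -> good I.
Proof.
move=> [[idI HI rI] sI].
have [p hp] := regular_quotient_cyclic hm idI rI.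
have [u [wu bu]] := cyclic_regular_weights hm idI HI hp.
have I0 f : I f -> cf f 0 0 = 0.
  by move=> If; rewrite -eval0_cf; apply: (sI (fun=> 0)).2.
split=> //; last by exists u.
have N0 : (0 < N)%N by lia.
have [b1 b2] := bu 0 0 N0 N0 (dvdn0 _).
have key f : Wt m 0 f -> ac tau f = f -> exists al : C, I (f - al *: (u 0 + ac tau (u 0))).
  move=> wf tf; have [al [be h]] := b1 f wf.
  have := tau_stable hm HI h.
  rewrite actB actD !actZ tf (tau_tau0 (wu 0 N0)) => h'.
  have := idlB idI h h'; rewrite opprB addrC subrKA opprD addrACA zmod_swap.
  rewrite -!scalerBl => /b2 [/eqP e _].
  by exists al; move: e h; rewrite subr_eq0 => /eqP ->; rewrite scalerDr.
have w1 : Wt m 0 (1 : P) by rewrite -mon00; apply: Wt_mon.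
have [al hal] := key 1 w1 (act_1 _).
have al0 : al != 0.
  apply/eqP => e; move: hal; rewrite e scale0r subr0 => /I0.
  by rewrite -mon00 cf_mon /= => /eqP; rewrite oner_eq0.
apply: (nn_min hm idI) => f wf tf f0.
have [be hbe] := key f wf tf.
have h : I (f - (be / al) *: 1).
  have := idlB idI hbe (idlZ idI (be / al) hal).
  by rewrite scalerBr scalerA divfK // opprB addrA subrK.
have := I0 _ h; rewrite cfB f0 -mon00 cfZ cf_mon mulr1 sub0r => /eqP.
by rewrite oppr_eq0 => /eqP e; move: h; rewrite e scale0r subr0.
Qed.

Lemma idl_lead I a p (q : P) : is_ideal I -> a != 0 -> I (a *: p + q) -> I q -> I p.
Proof. by move=> idI a0 h hq; apply: (idlZr idI a0); exact: (idlDl idI hq h). Qed.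

Section Facts.
Variables (I : set P) (gI : good I).
Let idI := good_ideal gI.
Let nnI := good_nn gI.

Lemma good_tau f : I f -> I (ac tau f).
Proof. exact: (tau_stable hm (good_stable gI)). Qed.

Lemma good_pr a f : I f -> I (pr m a f).
Proof. exact: (pr_stable hm a idI (good_stable gI)). Qed.

Lemma good_flip i j : I (mon i j) -> I (mon j i).
Proof.
by move=> /good_tau; rewrite tau_mon; apply: (idlZr idI); rewrite signr_eq0.
Qed.

(** Every weight has multiplicity two in the quotient, so a third vector depends on
   the others. *)
Lemma weight_le2 a f1 f2 f3 : (a < N)%N -> Wt m a f1 -> Wt m a f2 -> Wt m a f3 ->
  exists c1 c2 c3 : C, ~~ [&& c1 == 0, c2 == 0 & c3 == 0] /\
    I (c1 *: f1 + c2 *: f2 + c3 *: f3).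
Proof.
move=> aN w1 w2 w3; have [u [wu bu]] := good_regular gI.
have [b bN hab] := ex_opp hm aN.
have [sp _] := bu a b aN bN hab.
have [a1 [b1 h1]] := sp _ w1; have [a2 [b2 h2]] := sp _ w2; have [a3 [b3 h3]] := sp _ w3.
pose M : 'M[C]_(3, 2) := \matrix_(i, j)
  nth 0 (nth [::] [:: [:: a1; b1]; [:: a2; b2]; [:: a3; b3]] i) j.
have : kermx M != 0.
  rewrite kermx_eq0 /row_free; apply/negP => /eqP e.
  by have := rank_leq_col M; rewrite e.
rewrite -nz_row_eq0 => nz.
set c := nz_row (kermx M) in nz.
have cM : c *m M = 0 by apply/sub_kermxP/nz_row_sub.
exists (c 0 0), (c 0 1), (c 0 (inord 2)); split.
  apply: contra nz => /and3P[/eqP e0 /eqP e1 /eqP e2]; apply/eqP/rowP => j; rewrite mxE.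
  case: j => [[|[|[|//]]] hj].
  - by rewrite -[RHS]e0; congr (c _ _); apply/val_inj.
  - by rewrite -[RHS]e1; congr (c _ _); apply/val_inj.
  - by rewrite -[RHS]e2; congr (c _ _); apply/val_inj; rewrite /= inordK.
have s3 (F : 'I_3 -> C) : \sum_i F i = F 0 + F 1 + F (inord 2).
  rewrite 2!big_ord_recr big_ord1 /=; congr (F _ + F _ + F _); apply/val_inj => //=.
  by rewrite inordK.
have e1 := congr1 (fun A : 'rV_2 => A 0 ord0) cM.
have e2 := congr1 (fun A : 'rV_2 => A 0 ord_max) cM.
rewrite !mxE !s3 !mxE /= inordK //= in e1 e2.
have := idlD idI (idlD idI (idlZ idI (c 0 0) h1) (idlZ idI (c 0 1) h2))
  (idlZ idI (c 0 (inord 2)) h3).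
rewrite !scalerBr sub3 !scalerDr !scalerA.
by rewrite [X in _ - (X + _)]addrACA [X in _ - X]addrACA -!scalerDl e1 e2 !scale0r addr0 subr0.
Qed.

Lemma weight_ge2 a p : (a < N)%N -> ~ (forall f, Wt m a f -> exists c : C, I (f - c *: p)).
Proof.
move=> aN h; have [u [wu bu]] := good_regular gI.
have [b bN hab] := ex_opp hm aN.
have [_ ind] := bu a b aN bN hab.
have [c1 h1] := h _ (wu a aN).
have [c2 h2] := h _ (Wt_tau hab (wu b bN)).
have := idlB idI (idlZ idI c2 h1) (idlZ idI c1 h2).
rewrite !scalerBr !scalerA [c1 * c2]mulrC opprB addrA subrK -scaleNr => /ind [_ /eqP].
rewrite oppr_eq0 => /eqP c10.
move: h1; rewrite c10 scale0r subr0 => h1.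
have := ind 1 0; rewrite scale1r scale0r addr0 => /(_ h1) [/eqP].
by rewrite oner_eq0.
Qed.

(** Otherwise I would contain, by symmetry, all polynomials of weight m. *)
Lemma weight_m_proper : I (mon m 0) -> I (mon m.+1 1) -> False.
Proof.
move=> h1 h2; apply: (@weight_ge2 m 0); first by lia.
move=> f wf; have m1N : (1 <= m < N)%N by lia.
have [c1 [c2 [c3 [c4 /nnI h]]]] := weight_span hm m1N wf.
exists 0; rewrite scaler0 subr0; apply: (idl_cong idI h).
have -> : (N - m = m)%N by lia.
by do !apply: (idlD idI); apply: (idlZ idI) => //; exact: good_flip.
Qed.

(** If c1 is nonzero, multiplication by x ^ (m - a) and by x ^ (m - a + 1) y puts
   x ^ m and x ^ (m + 1) y into I, since the other terms go to n or to multiples of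
   monomials already in I. *)
Lemma initial_coef0 a (c1 c2 c3 c4 : C) : (1 <= a < m)%N ->
  I (c1 *: mon a 0 + c2 *: mon 0 (N - a) + c3 *: mon a.+1 1 + c4 *: mon 1 (N - a).+1) ->
  c1 = 0.
Proof.
move=> /andP[a1 am] h; apply/eqP/negP => /negP c10.
have h1 : I (mon m.+1 1).
  have := idlM idI (mon (m - a).+1 1) h.
  rewrite !mulrDr -!scalerAr !mul_mon -!addrA => h'.
  have -> : mon m.+1 1 = mon ((m - a).+1 + a) (1 + 0) by congr mon; lia.
  apply: (idl_lead idI c10 h').
  by do ?apply: (idlD idI); apply: (idlZ idI); apply: nnI; apply: (nn_mon hm); lia.
have h2 : I (mon 1 m.+1) by exact: good_flip.
apply: weight_m_proper (h1).
have := idlM idI (mon (m - a) 0) h.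
rewrite !mulrDr -!scalerAr !mul_mon -!addrA => h'.
have -> : mon m 0 = mon (m - a + a) (0 + 0) by congr mon; lia.
apply: (idl_lead idI c10 h').
have [ea|ea] := eqVneq a m.-1.
- apply: (idlD idI); [|apply: (idlD idI)]; apply: (idlZ idI).
  + by apply: (idl_mon idI h2); lia.
  + by apply: (idl_mon idI h1); lia.
  + by apply: nnI; apply: (nn_mon hm); lia.
- apply: (idlD idI); [|apply: (idlD idI)]; apply: (idlZ idI).
  + by apply: nnI; apply: (nn_mon hm); lia.
  + by apply: (idl_mon idI h1); lia.
  + by apply: nnI; apply: (nn_mon hm); lia.
Qed.

End Facts.

End Exceptional.

(** * Generators of exceptional ideals *)

Section Lines.
Variables (R : realType) (m : nat) (hm : (3 <= m)%N).
Local Notation C := R[i].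
Local Notation P := {mpoly C[2]}.
Local Notation N := m.*2.
Local Notation mon := (@mon R).
Local Notation nn := (nn R m).
Local Notation mI := (@mI_n R m).
Implicit Types (f p : P) (I : set P).

Lemma mm_mon i j : (0 < i + j)%N -> mm (mon i j).
Proof.
have idm : is_ideal (@mm R) := ideal_gen_ideal _.
case: i => [|i] h.
- case: j h => [//|j] _; rewrite -muly_mon mulrC; apply: (idlM idm).
  by apply: ideal_gen_sub; right.
- by rewrite -mulx_mon mulrC; apply: (idlM idm); apply: ideal_gen_sub; left.
Qed.

Lemma mI_ideal I : is_ideal (mI I).
Proof. exact: ideal_gen_ideal. Qed.

Lemma mI_nn I f : nn f -> mI I f.
Proof. by move=> hf; apply: ideal_gen_sub; right. Qed.

Lemma mI_mul I f g : mm f -> I g -> mI I (f * g).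
Proof. by move=> hf hg; apply: ideal_gen_sub; left; exists f => //; exists g. Qed.

Lemma mI_mon I i j g : (0 < i + j)%N -> I g -> mI I (mon i j * g).
Proof. by move=> h; apply: mI_mul; exact: mm_mon. Qed.

Lemma mI_sub I : is_ideal I -> nn `<=` I -> mI I `<=` I.
Proof.
move=> idI nnI; apply: ideal_gen_min => // f [[a _ [b Ib <-]]|/nnI //].
exact: idlM.
Qed.

Lemma mI_mono_mon I i j k l : is_ideal I -> I (mon i j) -> (i <= k)%N -> (j <= l)%N ->
  (i + j < k + l)%N -> mI I (mon k l).
Proof.
move=> idI h ik jl lt; rewrite -(subnK ik) -(subnK jl) -mul_mon.
by apply: mI_mon => //; lia.
Qed.

Section Facts.
Variables (I : set P) (gI : good m I).
Let idI := good_ideal gI.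
Let nnI := good_nn gI.
Let idmI := mI_ideal I.

Let mI_I f : mI I f -> I f.
Proof. exact: mI_sub idI nnI _. Qed.

(** Three elements of weight k - 1 are dependent modulo I, and x ^ (k - 1) cannot
   occur in the relation. The ratio of l1 and l2 is the coordinate of I on the
   k-th curve. *)
Lemma line_ex k : (1 <= k <= m)%N -> exists l1 l2 : C, ~~ ((l1 == 0) && (l2 == 0)) /\
  I (l1 *: mon k 1 + l2 *: mon 0 (N - k).+1).
Proof.
case: k => [//|a] /= am.
have eN : ((N - a.+1).+1 = N - a)%N by lia.
have w1 : Wt m a (mon a 0) by apply: Wt_mon; rewrite addn0.
have w2 : Wt m a (mon a.+1 1) by apply: Wt_mon; rewrite addn1.
have w3 : Wt m a (mon 0 (N - a)) by apply: Wt_mon; rewrite subnKC ?modnn ?mod0n //; lia.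
have aN : (a < N)%N by lia.
have [c1 [c2 [c3 [nz h]]]] := weight_le2 hm gI aN w1 w2 w3.
have c10 : c1 = 0.
  case: a am {eN w1 w2 w3} aN h => [|a] am aN h.
    have := good_origin gI h; rewrite !cfD !cfZ !cf_mon /= !mulr0 !mulr1.
    have -> : (N - 0 == 0)%N = false by lia.
    by rewrite mulr0 !addr0.
  have am' : (1 <= a.+1 < m)%N by [].
  apply: (@initial_coef0 _ _ hm _ gI _ c1 c3 c2 0 am').
  by rewrite scale0r addr0 addrAC.
exists c2, c3; rewrite eN; split.
  by move: nz; rewrite c10 eqxx.
by move: h; rewrite c10 scale0r add0r.
Qed.

(** Otherwise x ^ (k - 1) alone would span the weight k - 1 in the quotient. *)
Lemma line_proper k : (1 <= k <= m)%N -> I (mon k 1) -> I (mon 0 (N - k).+1) -> False.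
Proof.
case: k => [//|a] /= am h1 h2.
have eN : ((N - a.+1).+1 = N - a)%N by lia.
rewrite eN in h2.
have aN : (a < N)%N by lia.
apply: (weight_ge2 hm gI (p := mon a 0) aN) => f wf.
case: a am {eN} aN h1 h2 wf => [|a] am aN h1 h2 wf.
  have [c1 [c2 [c3 /nnI h]]] := weight0_span hm wf; rewrite subn0 in h2.
  exists c1; move: h; rewrite -addrA opprD addrA => h.
  apply: (idl_cong idI h); apply: (idlD idI); exact: (idlZ idI).
have aN' : (1 <= a.+1 < N)%N by lia.
have [c1 [c2 [c3 [c4 /nnI h]]]] := weight_span hm aN' wf.
exists c1; move: h; rewrite -!addrA opprD [f + _]addrA => h.
apply: (idl_cong idI h); apply: (idlD idI); [exact: (idlZ idI)|apply: (idlD idI)].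
  exact: (idlZ idI).
apply: (idlZ idI); apply: (idl_mon idI h2); lia.
Qed.

(** By line_proper the elements of I in the pencil spanned by the two monomials
   are proportional, so the second one is a multiple of the first. *)
Lemma line_unique k (l1 l2 k1 k2 : C) : (1 <= k <= m)%N -> ~~ ((k1 == 0) && (k2 == 0)) ->
  mI I (k1 *: mon k 1 + k2 *: mon 0 (N - k).+1) ->
  I (l1 *: mon k 1 + l2 *: mon 0 (N - k).+1) ->
  mI I (l1 *: mon k 1 + l2 *: mon 0 (N - k).+1).
Proof.
move=> km nz hk hl; have hkI := mI_I hk.
set p := mon k 1 in hk hl hkI *; set q := mon 0 (N - k).+1 in hk hl hkI *.
have ep : k2 *: (l1 *: p + l2 *: q) - l2 *: (k1 *: p + k2 *: q) =
    (l1 * k2 - l2 * k1) *: p.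
  rewrite !scalerDr !scalerA [l2 * k2]mulrC opprD addrACA subrr addr0.
  by rewrite -scalerBl [k2 * _]mulrC.
have eq : l1 *: (k1 *: p + k2 *: q) - k1 *: (l1 *: p + l2 *: q) =
    (l1 * k2 - l2 * k1) *: q.
  rewrite !scalerDr !scalerA [l1 * k1]mulrC opprD addrACA subrr add0r.
  by rewrite -scalerBl [k1 * _]mulrC.
have D0 : l1 * k2 - l2 * k1 = 0.
  apply/eqP/negP => /negP D0; apply: (line_proper km); apply: (idlZr idI D0).
    by rewrite -/p -ep; apply: (idlB idI); apply: (idlZ idI).
  by rewrite -/q -eq; apply: (idlB idI); apply: (idlZ idI).
move: ep eq; rewrite D0 !scale0r => /eqP; rewrite subr_eq0 => /eqP ep /eqP.
rewrite subr_eq0 => /eqP eq.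
have [k10|k10] := eqVneq k1 0.
  have k20 : k2 != 0 by move: nz; rewrite k10 eqxx.
  by apply: (idlZr idmI k20); rewrite ep; apply: (idlZ idmI).
by apply: (idlZr idmI k10); rewrite -eq; apply: (idlZ idmI).
Qed.

(** Multiply the relation of index a + 1 by x y; if it does not involve
   y ^ (N - a), then x y ^ (a + 1) is already in I. *)
Lemma mI_top a : (1 <= a < m)%N -> mI I (mon 1 (N - a).+1).
Proof.
move=> am; have a1m : (1 <= a.+1 <= m)%N by lia.
have [l1 [l2 [nz h]]] := line_ex a1m.
have [l20|l20] := eqVneq l2 0.
- have l10 : l1 != 0 by move: nz; rewrite l20 eqxx andbT.
  move: h; rewrite l20 scale0r addr0 => /(idlZr idI l10)/(good_flip hm gI) h.
  by apply: (mI_mono_mon idI h); lia.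
- have := @mI_mon I 1 1 _ isT h; rewrite mulrDr -!scalerAr !mul_mon addrC.
  have -> : mon (1 + 0) (1 + (N - a.+1).+1) = mon 1 (N - a).+1 by congr mon; lia.
  move=> h'; apply: (idl_lead idmI l20 h'); apply: (idlZ idmI); apply: mI_nn.
  by apply: (nn_mon hm); lia.
Qed.

Section Generator.
Variables (k : nat) (km : (1 <= k <= m)%N) (l1 l2 : C).
Hypotheses (hI : I (l1 *: mon k 1 + l2 *: mon 0 (N - k).+1))
  (hmI : ~ mI I (l1 *: mon k 1 + l2 *: mon 0 (N - k).+1)).

(** For k < m this is the relation of index k + 1: if it involved a power of y,
   then y times this relation would put y ^ (N - k + 1) into m I + n, against the
   minimality of the generator. For k = m the relation among x ^ m, y ^ m and
   x ^ (m + 1) y is used in the same way. *)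
Lemma gen_xy : I (mon k.+1 1).
Proof.
have nokey (c1 c2 : C) : mI I (c1 *: mon k 1 + c2 *: mon 0 (N - k).+1) -> c1 = 0 /\ c2 = 0.
  move=> h; suff /andP[/eqP -> /eqP ->] : (c1 == 0) && (c2 == 0) by [].
  rewrite -[_ && _]negbK; apply/negP => nz.
  by apply: hmI; apply: (line_unique km nz).
have [lt|] := ltnP k m; last first.
- move=> mk; have ek : k = m by lia.
  have mN : (m < N)%N by lia.
  have w1 : Wt m m (mon m 0) by apply: Wt_mon; rewrite addn0.
  have w2 : Wt m m (mon 0 m) by apply: Wt_mon; rewrite addnn modnn mod0n.
  have w3 : Wt m m (mon m.+1 1) by apply: Wt_mon; rewrite addn1.
  have [c1 [c2 [c3 [nz h]]]] := weight_le2 hm gI mN w1 w2 w3.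
  have [c10 c20] : c1 = 0 /\ c2 = 0.
    apply: nokey; have := @mI_mon I 0 1 _ isT h.
    rewrite !mulrDr -!scalerAr !mul_mon => h'.
    have -> : ((N - k).+1 = 1 + m)%N by lia.
    rewrite ek; apply: (idlDl idmI _ h').
    by apply: (idlZ idmI); apply: mI_nn; apply: (nn_mon hm); lia.
  have c30 : c3 != 0 by move: nz; rewrite c10 c20 !eqxx.
  by move: h; rewrite c10 c20 !scale0r !add0r ek; exact: (idlZr idI c30).
- have k1m : (1 <= k.+1 <= m)%N by lia.
  have [c1 [c2 [nz h]]] := line_ex k1m.
  have [c20|c20] := eqVneq c2 0.
    have c10 : c1 != 0 by move: nz; rewrite c20 eqxx andbT.
    by move: h; rewrite c20 scale0r addr0; exact: (idlZr idI c10).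
  have := @mI_mon I 0 1 _ isT h; rewrite mulrDr -!scalerAr !mul_mon addrC => h'.
  have h2 : mI I (mon (0 + 0) (1 + (N - k.+1).+1)).
    apply: (idl_lead idmI c20 h'); apply: (idlZ idmI); apply: mI_nn.
    by apply: (nn_mon hm); lia.
  have [] := nokey 0 1; last by move=> _ /eqP; rewrite oner_eq0.
  by rewrite scale0r scale1r add0r; have -> : mon 0 (N - k).+1 = mon (0 + 0) (1 + (N - k.+1).+1) by congr mon; lia.
Qed.

(** The relation of index k - 1 is y ^ (N - k + 2) itself: if it involved
   x ^ (k - 1) y, then x times this relation would put x ^ k y into m I + n, against
   the minimality of the generator. For k = 1 an element of n plays this part. *)
Lemma gen_y : I (mon 0 (N - k).+2).
Proof.
have [k1|k1] := eqVneq k 1%N.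
  have h1 : I (mon N 1).
    by apply: (good_flip hm gI); apply: mI_I; have := @mI_top 1 _; rewrite (_ : (N - 1).+1 = N)%N; [apply; lia|lia].
  have -> : ((N - k).+2 = N.+1)%N by lia.
  exact: (idlDl idI h1 (nnI (nn_yN1 hm))).
have k1m : (1 <= k.-1 <= m)%N by lia.
have [c1 [c2 [nz h]]] := line_ex k1m.
have e : ((N - k.-1).+1 = (N - k).+2)%N by lia.
rewrite e in h.
have [c10|c10] := eqVneq c1 0.
  have c20 : c2 != 0 by move: nz; rewrite c10 eqxx.
  by move: h; rewrite c10 scale0r add0r; exact: (idlZr idI c20).
have := @mI_mon I 1 0 _ isT h; rewrite mulrDr -!scalerAr !mul_mon => h'.
have h2 : mI I (mon (1 + k.-1) (0 + 1)).
  apply: (idl_lead idmI c10 h'); apply: (idlZ idmI).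
  have h3 : mI I (mon 1 (N - k.-1).+1) by apply: mI_top; lia.
  by apply: (idl_mon idmI h3); lia.
case: hmI; apply: (@line_unique k l1 l2 1 0) => //.
  by rewrite oner_eq0.
rewrite scale1r scale0r addr0.
by have -> : mon k 1 = mon (1 + k.-1) (0 + 1) by congr mon; lia.
Qed.

End Generator.

(** The other spanning monomials of weight k - 1 cannot contribute to a minimal
   generator: the coefficient of x ^ (k - 1) vanishes and x y ^ (N - k + 2) is in
   m I + n. *)
Lemma gen_out k f : (1 <= k <= m)%N -> Wt m k.-1 f -> I f -> ~ mI I f ->
  exists l1 l2 : C, I (l1 *: mon k 1 + l2 *: mon 0 (N - k).+1) /\
    ~ mI I (l1 *: mon k 1 + l2 *: mon 0 (N - k).+1).
Proof.
case: k => [//|a] /= am wf If nf.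
have eN : ((N - a.+1).+1 = N - a)%N by lia.
rewrite eN; case: a am {eN} wf => [|a] am wf.
- have [c1 [c2 [c3 h]]] := weight0_span hm wf.
  have c10 : c1 = 0.
    have := good_origin gI (idlB idI If (nnI h)).
    rewrite opprB addrC subrK !cfD !cfZ !cf_mon /=.
    have -> : (N == 0)%N = false by lia.
    by rewrite !mulr0 !addr0 mulr1.
  move: h; rewrite c10 scale0r add0r subn0 => h.
  exists c2, c3; split.
    by rewrite -(subKr f (c2 *: _ + _)); apply: (idlB idI) => //; exact: nnI.
  by move=> h'; apply: nf; apply: (idl_cong idmI _ h'); exact: mI_nn.
- have aN : (1 <= a.+1 < N)%N by lia.
  have [c1 [c2 [c3 [c4 h]]]] := weight_span hm aN wf.
  have h4 : mI I (c4 *: mon 1 (N - a.+1).+1) by apply: (idlZ idmI); apply: mI_top; lia.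
  have hs : I (c1 *: mon a.+1 0 + c2 *: mon 0 (N - a.+1) + c3 *: mon a.+2 1
       + c4 *: mon 1 (N - a.+1).+1).
    by rewrite -(subKr f (_ + c4 *: _)); apply: (idlB idI) => //; exact: nnI.
  have am' : (1 <= a.+1 < m)%N by [].
  have c10 := initial_coef0 hm gI am' hs.
  move: h hs; rewrite c10 scale0r add0r [c2 *: _ + _]addrC => h hs.
  exists c3, c2; split.
    by apply: (idlDl idI _ hs); exact: mI_I.
  move=> h'; apply: nf; apply: (idl_cong idmI (@mI_nn I _ h)).
  exact: (idlD idmI).
Qed.

(** A point of the k-th curve contains the two monomials next to the pencil of
   index k, so only its coordinate in this pencil is free. *)
Lemma gen_curve k f : (1 <= k <= m)%N -> Wt m k.-1 f -> I f -> ~ mI I f ->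
  I (mon k.+1 1) /\ I (mon 0 (N - k).+2).
Proof.
move=> km wf If nf; have [l1 [l2 [h1 h2]]] := gen_out km wf If nf.
by split; [exact: (gen_xy km h1 h2) | exact: (gen_y km h1 h2)].
Qed.

(** If the relation of index m - 1 involved x ^ (m - 1) y, then x ^ m y would be in I
   and x ^ (m + 1) y in m I + n, which leaves no minimal generator of weight m. *)
Lemma gen_end f : Wt m m f -> I f -> ~ mI I f -> I (mon 0 m.+2).
Proof.
move=> wf If nf.
have mm1 : (1 <= m.-1 <= m)%N by lia.
have [l1 [l2 [nz h]]] := line_ex mm1.
have [l10|l10] := eqVneq l1 0.
  have l20 : l2 != 0 by move: nz; rewrite l10 eqxx.
  move: h; rewrite l10 scale0r add0r => /(idlZr idI l20).
  by have -> : ((N - m.-1).+1 = m.+2)%N by lia.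
(* From here on x ^ (m - 1) y occurs in the relation. *)
exfalso.
have key i : I (l1 *: mon (i + m.-1) 1 + l2 *: mon i (N - m.-1).+1).
  by have := idlM idI (mon i 0) h; rewrite mulrDr -!scalerAr !mul_mon addn0 !add0n.
have h2 : mI I (mon m.+1 1).
  have := @mI_mon I 2 0 _ isT h; rewrite mulrDr -!scalerAr !mul_mon => h'.
  have -> : mon m.+1 1 = mon (2 + m.-1) (0 + 1) by congr mon; lia.
  apply: (idl_lead idmI l10 h'); apply: (idlZ idmI); apply: mI_nn.
  by apply: (nn_mon hm); lia.
have h1 : I (mon m 1).
  have := key 1%N; have -> : (1 + m.-1 = m)%N by lia.
  move=> h'; apply: (idl_lead idI l10 h'); apply: (idlZ idI).
  have m1 : (1 <= m.-1 < m)%N by lia.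
  exact: (mI_I (mI_top m1)).
have h1' := good_flip hm gI h1.
have h3 : mI I (mon 1 m.+1) by apply: (mI_mono_mon idI h1'); lia.
have m1N : (1 <= m < N)%N by lia.
have [c1 [c2 [c3 [c4 h4]]]] := weight_span hm m1N wf.
have eN : (N - m = m)%N by lia.
rewrite eN in h4.
have nb : ~ I (mon 0 m.+1).
  have m1m : (1 <= m <= m)%N by lia.
  by have := line_proper m1m h1; rewrite eN.
have hs : I (c1 *: mon m 0 + c2 *: mon 0 m).
  have h5 : I (c1 *: mon m 0 + c2 *: mon 0 m + c3 *: mon m.+1 1 + c4 *: mon 1 m.+1).
    by rewrite -(subKr f (_ + c4 *: _)); apply: (idlB idI) => //; exact: nnI.
  apply: (idlDl idI _ (idlDl idI _ h5)); apply: (idlZ idI); exact: mI_I.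
have c20 : c2 = 0.
  apply/eqP/negP => /negP c20; apply: nb.
  have := idlM idI (mon 0 1) hs; rewrite mulrDr -!scalerAr !mul_mon addrC !add0n add1n addn0 => h6.
  by apply: (idl_lead idI c20 h6); apply: (idlZ idI).
have c10 : c1 = 0.
  apply/eqP/negP => /negP c10; apply: nb.
  have := idlM idI (mon 1 0) hs; rewrite mulrDr -!scalerAr !mul_mon !add0n add1n addn0 => h6.
  apply: (good_flip hm gI).
  by apply: (idl_lead idI c10 h6); apply: (idlZ idI).
rewrite c10 c20 !scale0r !add0r in h4.
apply: nf; apply: (idl_cong idmI (@mI_nn I _ h4)).
by apply: (idlD idmI); apply: (idlZ idmI).
Qed.

End Facts.

End Lines.

(** * Test ideals and bases of weight spaces *)

Section Points.
Variables (R : realType) (m : nat) (hm : (3 <= m)%N).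
Local Notation C := R[i].
Local Notation P := {mpoly C[2]}.
Local Notation N := m.*2.
Local Notation z := (zeta R m).
Local Notation mon := (@mon R).
Local Notation cf := (@cf R).
Local Notation tau := (tau R).
Local Notation nn := (nn R m).
Implicit Types (f p q u v : P) (I J S : set P) (c : C).

Lemma ideal_gen_act g (S T : set P) : (forall f, S f -> ideal_gen T (ac g f)) ->
  forall f, ideal_gen S f -> ideal_gen T (ac g f).
Proof.
move=> h; have idT := ideal_gen_ideal T; apply: ideal_gen_min => //.
split.
- by rewrite act0; exact: (idl0 idT).
- by move=> a b ha hb; rewrite actD; exact: (idlD idT).
- by move=> a b hb; rewrite actM; exact: (idlM idT).
Qed.

Lemma H_stable_gen (S : set P) : (forall s f, s ^+ N = 1 -> S f -> ideal_gen S (ac (hs s) f)) ->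
  (forall s f, s ^+ N = 1 -> S f -> ideal_gen S (ac (ht s) f)) ->
  H_stable m (ideal_gen S).
Proof.
move=> h1 h2 h f Hh hf; rewrite -acE.
have [k _ e] := H_cases hm Hh.
have zk : (z ^+ k) ^+ N = 1 by rewrite -exprM zetaXN.
by case: e => ->; apply: ideal_gen_act hf => g Sg; [exact: h1 | exact: h2].
Qed.

(** The span of the monomials outside a rectangle of exponents; these ideals
   serve to show that given monomials are not in an ideal. *)
Definition rect (A B : nat) : set P :=
  [set f | forall i j, (i <= A)%N -> (j <= B)%N -> cf f i j = 0].

Lemma rect_ideal A B : is_ideal (rect A B).
Proof.
apply: xy_ideal.
- by move=> i j _ _; rewrite cf0.
- by move=> f g hf hg i j hi hj; rewrite cfD hf // hg // addr0.
- by move=> a f hf i j hi hj; rewrite cfZ hf // mulr0.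
- by move=> f hf [|i] j hi hj; rewrite cfMx //; apply: hf => //; exact: ltnW.
- by move=> f hf i [|j] hi hj; rewrite cfMy //; apply: hf => //; exact: ltnW.
Qed.

Lemma invariant_cf11 f : ac tau f = f -> cf f 1 1 = 0.
Proof.
move=> tf; have := cf_tau f 1 1; rewrite tf expr1 mulN1r => /eqP.
by rewrite -addr_eq0 -mulr2n mulrn_eq0 /= => /eqP.
Qed.

Lemma nn_rect A B : ((B <= 1) && (A < N) || (A <= 1) && (B < N))%N -> nn `<=` rect A B.
Proof.
move=> AB; apply: (nn_min hm (rect_ideal A B)) => f wf tf f0 i j hi hj.
have [e|ne] := eqVneq (i %% N)%N ((0 + j) %% N)%N; last exact: wf.
have [hij|[hij|hij]] : (i = 0 /\ j = 0 \/ i = 1 /\ j = 1 \/ i <> j)%N.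
- by case/orP: AB => /andP[]; case: i j {e} hi hj => [|[|i]] [|[|j]]; lia.
- by case: hij => -> ->.
- by case: hij => -> ->; exact: invariant_cf11.
- by move: e; rewrite add0n !modn_small //; lia.
Qed.

Lemma rect_mon A B i j : ~~ ((i <= A) && (j <= B))%N -> rect A B (mon i j).
Proof.
move=> h k l hk hl; rewrite cf_mon.
by case: eqP h => [->|//]; case: eqP => [->|//]; rewrite hk hl.
Qed.

Section Span.
Variables (J : set P) (idJ : is_ideal J) (nnJ : nn `<=` J).

Definition in_span p q f := exists c1 c2 : C, J (f - (c1 *: p + c2 *: q)).

Lemma in_spanD p q f g : in_span p q f -> in_span p q g -> in_span p q (f + g).
Proof.
move=> [c1 [c2 h]] [d1 [d2 k]]; exists (c1 + d1), (c2 + d2).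
by have := idlD idJ h k; rewrite addrACA -opprD addrACA -!scalerDl.
Qed.

Lemma in_spanZ p q c f : in_span p q f -> in_span p q (c *: f).
Proof.
move=> [c1 [c2 h]]; exists (c * c1), (c * c2).
by have := idlZ idJ c h; rewrite scalerBr scalerDr !scalerA.
Qed.

Lemma in_span0 p q f : J f -> in_span p q f.
Proof. by move=> h; exists 0, 0; rewrite !scale0r addr0 subr0. Qed.

Lemma in_spanl p q : in_span p q p.
Proof. by exists 1, 0; rewrite scale1r scale0r addr0 subrr; exact: idl0. Qed.

Lemma in_spanr p q : in_span p q q.
Proof. by exists 0, 1; rewrite scale1r scale0r add0r subrr; exact: idl0. Qed.

Lemma in_span_lin p q f g c : J (f + c *: g) -> in_span p q g -> in_span p q f.
Proof.
move=> h hg; rewrite -(addrK (c *: g) f); apply: in_spanD; first exact: in_span0.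
by rewrite -scaleNr; exact: in_spanZ.
Qed.

Definition indep p q := forall al be : C, J (al *: p + be *: q) -> al = 0 /\ be = 0.

Lemma weight_basisP a p q : (1 <= a < N)%N ->
  in_span p q (mon a 0) -> in_span p q (mon 0 (N - a)) ->
  in_span p q (mon a.+1 1) -> in_span p q (mon 1 (N - a).+1) ->
  indep p q -> weight_basis m J a p q.
Proof.
move=> aN h1 h2 h3 h4 ind; split=> // f wf.
have [c1 [c2 [c3 [c4 /nnJ h]]]] := weight_span hm aN wf.
rewrite -/(in_span p q f) -(subrK (c1 *: mon a 0 + c2 *: mon 0 (N - a) +
  c3 *: mon a.+1 1 + c4 *: mon 1 (N - a).+1) f).
apply: in_spanD; first exact: in_span0.
by do !apply: in_spanD; exact: in_spanZ.
Qed.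

Lemma weight_basis_scale a p q c : c != 0 ->
  weight_basis m J a p q -> weight_basis m J a p (c *: q).
Proof.
move=> c0 [sp ind]; split=> [f wf|al be].
  have [al [be h]] := sp f wf; exists al, (be / c).
  by rewrite scalerA divfK.
rewrite scalerA => /ind [-> /eqP]; rewrite mulf_eq0 (negbTE c0) orbF => /eqP ->.
by [].
Qed.

(** Applied with eigenvectors p and q of tau of opposite eigenvalues and v the image
   of p + q: two lines that tau preserves are replaced by a vector and its image. *)
Lemma weight_basis_mix a p q v c : c != 0 -> J (v - (c *: p - c *: q)) ->
  weight_basis m J a p q -> weight_basis m J a (p + q) v.
Proof.
move=> c0 hv [sp ind].
have two0 := two_neq0 R.
have E al be : al *: (p + q) + be *: (c *: p - c *: q) =
    (al + be * c) *: p + (al - be * c) *: q.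
  by rewrite scalerDr scalerBr !scalerA addrACA -scalerDl -scalerBl.
split=> [f wf|al be h].
- have [al [be h]] := sp f wf.
  exists ((al + be) / 2%:R), ((al - be) / 2%:R / c).
  have := idlB idJ h (idlZ idJ ((al - be) / 2%:R / c) hv).
  rewrite scalerBr opprB addrCA addrA.
  set A := _ *: v; set B := _ *: (c *: p - c *: q).
  have -> : al *: p + be *: q = (al + be) / 2%:R *: (p + q) + B.
    rewrite /B E divfK //; by congr (_ *: _ + _ *: _); field.
  by rewrite [B + _]addrC opprD -!addrA addKr -opprD.
- have : J (al *: (p + q) + be *: (c *: p - c *: q)).
    have := idlB idJ h (idlZ idJ be hv).
    by rewrite scalerBr opprB addrA addrAC addrK.
  rewrite E => /ind [e1 e2].
  have : (al + be * c) + (al - be * c) = 0 by rewrite e1 e2 addr0.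
  rewrite addrACA subrr addr0 -mulr2n -mulr_natl => /eqP.
  rewrite mulf_eq0 (negbTE two0) => /eqP al0.
  by move: e1; rewrite al0 add0r => /eqP; rewrite mulf_eq0 (negbTE c0) orbF => /eqP.
Qed.

End Span.

End Points.

(** * The points where consecutive curves meet *)

Section CurvePoints.
Variables (R : realType) (m : nat) (hm : (3 <= m)%N).
Local Notation C := R[i].
Local Notation P := {mpoly C[2]}.
Local Notation N := m.*2.
Local Notation mon := (@mon R).
Local Notation cf := (@cf R).
Local Notation tau := (tau R).
Local Notation nn := (nn R m).
Local Notation rect := (@rect R).
Implicit Types (f p q u v : P) (I J S : set P) (c : C).

Definition curve_gens (k : nat) : set P := [set f | [\/ f = mon k 1, f = mon 1 k,
  f = mon (N - k).+2 0 | f = mon 0 (N - k).+2]].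

(** The intersection of the curves of index k - 1 and k when both exist. The ideals
   of index 1 and m + 1 are points of the same kind on the first and on the m-th
   curve. *)
Definition curve_pt k : set P := ideal_gen (nn `|` curve_gens k).

Definition end_gens (c : C) : set P := [set f | f = mon m 0 + c *: mon 0 m].

(** The generator spans a line that H preserves when c ^ 2 = (-1) ^ m. *)
Definition end_pt c : set P := ideal_gen (nn `|` end_gens c).

Lemma curve_pt_ideal k : is_ideal (curve_pt k). Proof. exact: ideal_gen_ideal. Qed.
Lemma end_pt_ideal c : is_ideal (end_pt c). Proof. exact: ideal_gen_ideal. Qed.

Lemma curve_pt_nn k : nn `<=` curve_pt k.
Proof. by move=> f hf; apply: ideal_gen_sub; left. Qed.
Lemma end_pt_nn c : nn `<=` end_pt c.
Proof. by move=> f hf; apply: ideal_gen_sub; left. Qed.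

Lemma curve_pt_mem k f : curve_gens k f -> curve_pt k f.
Proof. by move=> hf; apply: ideal_gen_sub; right. Qed.
Lemma end_pt_mem c : end_pt c (mon m 0 + c *: mon 0 m).
Proof. by apply: ideal_gen_sub; right. Qed.

Lemma curve_pt_xy k : curve_pt k (mon k 1). Proof. by apply: curve_pt_mem; constructor 1. Qed.
Lemma curve_pt_yx k : curve_pt k (mon 1 k). Proof. by apply: curve_pt_mem; constructor 2. Qed.
Lemma curve_pt_x k : curve_pt k (mon (N - k).+2 0). Proof. by apply: curve_pt_mem; constructor 3. Qed.
Lemma curve_pt_y k : curve_pt k (mon 0 (N - k).+2). Proof. by apply: curve_pt_mem; constructor 4. Qed.

Lemma curve_pt_stable k : H_stable m (curve_pt k).
Proof.
have id := curve_pt_ideal k.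
apply: (H_stable_gen hm) => s f s1 [hf|].
- apply: ideal_gen_sub; left; apply: nn_G hf => //.
  have [j ->] := prim_rootP (zeta_prim R hm) s1; exact: G_hs.
- by case=> ->; rewrite act_dg; apply: (idlZ id); apply: curve_pt_mem;
    [constructor 1|constructor 2|constructor 3|constructor 4].
- apply: ideal_gen_sub; left; apply: nn_G hf => //.
  have [j ->] := prim_rootP (zeta_prim R hm) s1.
  by case: (H_ht R hm j).
- by case=> ->; rewrite act_ad; apply: (idlZ id); apply: curve_pt_mem;
    [constructor 2|constructor 1|constructor 4|constructor 3].
Qed.

Lemma end_pt_stable c : c * c = (-1) ^+ m -> H_stable m (end_pt c).
Proof.
move=> cc; have id := end_pt_ideal c.
have key := unity_inv_m hm (R := R).
apply: (H_stable_gen hm) => s f s1 [hf|->].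
- apply: ideal_gen_sub; left; apply: nn_G hf => //.
  have [j ->] := prim_rootP (zeta_prim R hm) s1; exact: G_hs.
- rewrite actD actZ !act_dg !expr0 mulr1 mul1r key // scalerA mulrC -scalerA -scalerDr.
  exact: (idlZ id _ (@end_pt_mem c)).
- apply: ideal_gen_sub; left; apply: nn_G hf => //.
  have [j ->] := prim_rootP (zeta_prim R hm) s1.
  by case: (H_ht R hm j).
- rewrite htE_ad actD actZ !act_ad !expr0 mulr1 mul1r exprMn key // -cc.
  rewrite scalerA [c * s ^+ m]mulrC -mulrA [c * s ^+ m]mulrC mulrA [c * s ^+ m]mulrC.
  rewrite -!scalerA -scalerDr addrC -scalerDr.
  exact: (idlZ id _ (idlZ id _ (@end_pt_mem c))).
Qed.

Lemma curve_pt_rect k A B : ((B <= 1) && (A < N) || (A <= 1) && (B < N))%N ->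
  [&& ~~ ((k <= A) && (1 <= B)), ~~ ((1 <= A) && (k <= B)), A < (N - k).+2 &
   B < (N - k).+2]%N -> curve_pt k `<=` rect A B.
Proof.
move=> h1 /and4P[a1 a2 a3 a4]; apply: ideal_gen_min; first exact: rect_ideal.
move=> f [/(nn_rect hm h1)//|]; case=> ->; apply: rect_mon => //.
- by rewrite leqNgt a3.
- by rewrite [X in _ && X]leqNgt a4 andbF.
Qed.

(** A test ideal for y ^ N, which no ideal of the form rect separates from n since
   x ^ N + y ^ N is in n. *)
Definition pure_balanced : set P := [set f | [/\ forall i, (i < N)%N -> cf f i 0 = 0,
  forall j, (j < N)%N -> cf f 0 j = 0 & cf f N 0 = cf f 0 N]].

Lemma pure_balanced_ideal : is_ideal pure_balanced.
Proof.
have N0 : N = N.-1.+1 by lia.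
apply: xy_ideal.
- by split=> [i _|i _|]; rewrite !cf0.
- move=> f g [h1 h2 h3] [k1 k2 k3]; split=> [i hi|i hi|]; rewrite !cfD ?h3 ?k3 //.
    by rewrite h1 // k1 // addr0.
  by rewrite h2 // k2 // addr0.
- move=> a f [h1 h2 h3]; split=> [i hi|i hi|]; rewrite !cfZ ?h3 //.
    by rewrite h1 // mulr0.
  by rewrite h2 // mulr0.
- move=> f [h1 h2 h3]; split=> [[|i] hi|i hi|]; rewrite cfMx //.
    by apply: h1; exact: ltnW.
  by rewrite {1}N0 h1 ?cfMx //; lia.
- move=> f [h1 h2 h3]; split=> [i hi|[|i] hi|]; rewrite cfMy //.
    by apply: h2; exact: ltnW.
  by rewrite cfMy [in RHS]N0 h2 //; lia.
Qed.

Lemma nn_pure_balanced : nn `<=` pure_balanced.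
Proof.
apply: (nn_min hm pure_balanced_ideal) => f wf tf f0; split.
- case=> [//|i] hi; apply: wf; rewrite addn0 mod0n modn_small //.
- by case=> [//|i] hi; apply: wf; rewrite add0n mod0n modn_small // eq_sym.
- by rewrite -{1}tf cf_tau expr0 mul1r.
Qed.

Lemma pure_balanced_mon i j : ~~ [|| (i <= N)%N && (j == 0) | (i == 0) && (j <= N)%N] ->
  pure_balanced (mon i j).
Proof.
rewrite negb_or => /andP[h1 h2]; split=> [k hk|k hk|]; rewrite !cf_mon.
- case: eqP => // ei; case: eqP => // ej; move: h1.
  by rewrite ei ej eqxx andbT (ltnW hk).
- case: eqP => // ei; case: eqP => // ej; move: h2.
  by rewrite ei ej eqxx (ltnW hk).
- have -> : (i == N) && (j == 0)%N = false.
    apply/negbTE; apply: contra h1 => /andP[/eqP -> /eqP ->]; by rewrite leqnn eqxx.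
  suff -> : (i == 0)%N && (j == N) = false by [].
  by apply/negbTE; apply: contra h2 => /andP[/eqP -> /eqP ->]; rewrite leqnn eqxx.
Qed.

Lemma indep_mon J i j k l : (i, j) <> (k, l) -> (forall f, J f -> cf f i j = 0) ->
  (forall f, J f -> cf f k l = 0) -> indep J (mon i j) (mon k l).
Proof.
move=> ne h1 h2 al be h; have := h1 _ h; have := h2 _ h.
rewrite !cfD !cfZ !cf_mon !eqxx /= !mulr1.
have -> : (k == i) && (l == j) = false.
  by apply/negbTE/negP => /andP[/eqP e1 /eqP e2]; apply: ne; rewrite e1 e2.
have -> : (i == k) && (j == l) = false.
  by apply/negbTE/negP => /andP[/eqP e1 /eqP e2]; apply: ne; rewrite e1 e2.
by rewrite !mulr0 add0r addr0.
Qed.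

Lemma opp_cases a b : (a < N)%N -> (b < N)%N -> (N %| a + b)%N ->
  (a = 0 /\ b = 0 \/ (1 <= a)%N /\ b = N - a)%N.
Proof.
move=> aN bN /dvdnP[q e]; case: q e => [|[|q]] e; [left|right|]; lia.
Qed.

(** In weight 0 the vector 1 + e works as soon as e is anti-invariant under tau,
   because 1 is invariant. *)
Lemma weight0_basis J e : is_ideal J -> nn `<=` J -> J (ac tau e + e) ->
  in_span J (mon 0 0) e (mon 1 1) -> in_span J (mon 0 0) e (mon 0 N) ->
  indep J (mon 0 0) e -> weight_basis m J 0 (mon 0 0 + e) (ac tau (mon 0 0 + e)).
Proof.
move=> idJ nnJ he h1 h2 ind; apply: (weight_basis_mix idJ (oner_neq0 _)).
- rewrite !scale1r actD tau_mon expr0 scale1r addrC opprB addrA subrK //.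
  by rewrite addrC.
- split=> // f wf; have [c1 [c2 [c3 /nnJ h]]] := weight0_span hm wf.
  rewrite -/(in_span J (mon 0 0) e f).
  rewrite -(subrK (c1 *: mon 0 0 + c2 *: mon 1 1 + c3 *: mon 0 N) f).
  apply: (in_spanD idJ); first exact: in_span0.
  by do !apply: (in_spanD idJ); apply: (in_spanZ idJ) => //; exact: in_spanl.
Qed.

(** Monomials outside the ideal; in weight 0, the sum of the invariant 1 and of
   an element that is anti-invariant modulo the ideal. *)
Definition curve_u k b : P :=
  if b == 0%N then mon 0 0 + (if k == 1%N then mon N 0 else mon 1 1)
  else if (b <= (N - k).+1)%N then mon b 0 else mon 1 (N - b).+1.

(** Every weight space of the quotient is spanned by the two monomials that
   survive among those of weight_span. *)
Lemma curve_pt_good k : (1 <= k <= m.+1)%N -> good m (curve_pt k).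
Proof.
move=> km; have id := curve_pt_ideal k; have nJ := @curve_pt_nn k.
have hx i j : (k <= i)%N -> (1 <= j)%N -> curve_pt k (mon i j).
  by apply: (idl_mon id (@curve_pt_xy k)).
have hy i j : (1 <= i)%N -> (k <= j)%N -> curve_pt k (mon i j).
  by apply: (idl_mon id (@curve_pt_yx k)).
have hxx i : ((N - k).+2 <= i)%N -> curve_pt k (mon i 0).
  by move=> h; apply: (idl_mon id (@curve_pt_x k)).
have hyy i : ((N - k).+2 <= i)%N -> curve_pt k (mon 0 i).
  by move=> h; apply: (idl_mon id (@curve_pt_y k)).
split=> //.
- exact: curve_pt_stable.
- by move=> f /(@curve_pt_rect k 0 0); apply => //; lia.
exists (curve_u k); split=> [a aN|a b aN bN hab].
  rewrite /curve_u; case: eqP => [->|/eqP a0].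
    apply: WtD; first exact: Wt_mon.
    by case: ifP => _; apply: Wt_mon => //; rewrite mod0n modnn.
  case: ifP => _; apply: Wt_mon; first by rewrite addn0.
  by rewrite addnS subnKC 1?ltnW // -(addn1 N) modnDl.
have [[-> ->]|[a1 ->]] := opp_cases aN bN hab.
  rewrite /curve_u /=; case: eqP => [k1|/eqP k1].
  - subst k; apply: weight0_basis => //.
    + by rewrite tau_mon sqrN1 scale1r addrC; apply: nJ; exact: nn_sum.
    + by apply: in_span0; exact: hx.
    + apply: (in_span_lin id (c := 1) (g := mon N 0)); last exact: in_spanr.
      by rewrite scale1r addrC; apply: nJ; exact: nn_sum.
    + move=> al be h; have N0 : (N == 0)%N = false by lia.
      have al0 : al = 0.
        have : rect 0 0 (al *: mon 0 0 + be *: mon N 0).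
          by apply: (@curve_pt_rect 1 0 0) => //; lia.
        move=> /(_ 0 0 isT isT); rewrite cfD !cfZ !cf_mon N0 /=.
        by rewrite mulr1 mulr0 addr0.
      split=> //; have sub : curve_pt 1 `<=` pure_balanced.
        apply: (ideal_gen_min pure_balanced_ideal) => f [|]; first exact: nn_pure_balanced.
        by case=> ->; apply: pure_balanced_mon; lia.
      have [_ _] := sub _ h; rewrite al0 scale0r add0r !cfZ !cf_mon !eqxx N0 /=.
      by rewrite mulr1 mulr0.
  - apply: weight0_basis => //.
    + by rewrite tau_mon expr1 scaleN1r addNr; exact: idl0.
    + exact: in_spanr.
    + by apply: in_span0; apply: hyy; lia.
    + apply: indep_mon => // f hf.
        by apply: (@curve_pt_rect k 0 0 _ _ _ hf) => //; lia.
      by apply: (@curve_pt_rect k 1 1 _ _ _ hf) => //; lia.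
have eN : (N - (N - a) = a)%N by lia.
have a0 : (a == 0)%N = false by lia.
have b0 : (N - a == 0)%N = false by lia.
have a1N : (1 <= a < N)%N by lia.
have cx i : (i <= (N - k).+1)%N -> (i < N)%N -> forall f, curve_pt k f -> cf f i 0 = 0.
  by move=> h h' f /(@curve_pt_rect k i 0); apply => //; lia.
have cy i : (i <= (N - k).+1)%N -> (i < N)%N -> forall f, curve_pt k f -> cf f 0 i = 0.
  by move=> h h' f /(@curve_pt_rect k 0 i); apply => //; lia.
have cxy i : (i < k)%N -> forall f, curve_pt k f -> cf f i 1 = 0.
  by move=> h f /(@curve_pt_rect k i 1); apply => //; lia.
have cyx i : (i < k)%N -> forall f, curve_pt k f -> cf f 1 i = 0.
  by move=> h f /(@curve_pt_rect k 1 i); apply => //; lia.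
rewrite /curve_u a0 b0 eN.
case: ifP => ha; case: ifP => hb; rewrite tau_mon;
  (apply: weight_basis_scale; first by rewrite signr_eq0); apply: (weight_basisP hm id nJ a1N).
- exact: in_spanl.
- exact: in_spanr.
- by apply: in_span0; apply: hx; lia.
- by apply: in_span0; apply: hy; lia.
- apply: indep_mon; first by case; lia.
    by apply: cx; lia.
  by apply: cy; lia.
- exact: in_spanl.
- by apply: in_span0; apply: hyy; lia.
- exact: in_spanr.
- by apply: in_span0; apply: hy; lia.
- apply: indep_mon; first by case; lia.
    by apply: cx; lia.
  by apply: cxy; lia.
- by apply: in_span0; apply: hxx; lia.
- exact: in_spanr.
- by apply: in_span0; apply: hx; lia.
- exact: in_spanl.
- apply: indep_mon; first by case; lia.
    by apply: cyx; lia.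
  by apply: cy; lia.
- by apply: in_span0; apply: hxx; lia.
- by apply: in_span0; apply: hyy; lia.
- exact: in_spanr.
- exact: in_spanl.
- apply: indep_mon; first by case; lia.
    by apply: cyx; lia.
  by apply: cxy; lia.
Qed.

End CurvePoints.

(** * Points on the two end curves *)

Section EndPoints.
Variables (R : realType) (m : nat) (hm : (3 <= m)%N).
Local Notation C := R[i].
Local Notation P := {mpoly C[2]}.
Local Notation N := m.*2.
Local Notation mon := (@mon R).
Local Notation cf := (@cf R).
Local Notation nn := (nn R m).
Local Notation end_pt := (@end_pt R m).
Implicit Types (f p q u v : P) (I J S : set P) (c : C).

(** The coefficient relations satisfied by the multiples of x ^ m + c y ^ m in
   the range that n does not touch. *)
Definition end_balanced c : set P := [set f | [/\
  forall i j, (i < m)%N -> (j <= 1)%N -> cf f i j = 0,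
  forall i j, (i <= 1)%N -> (j < m)%N -> cf f i j = 0 &
  forall a b, (a <= 1)%N -> (b <= 1)%N -> cf f a (m + b) = c * cf f (m + a) b]].

Lemma end_balanced_ideal c : is_ideal (end_balanced c).
Proof.
have m0 : m = m.-1.+1 by lia.
apply: xy_ideal.
- by split=> [i j _ _|i j _ _|a b _ _]; rewrite !cf0 ?mulr0.
- move=> f g [h1 h2 h3] [k1 k2 k3]; split=> [i j hi hj|i j hi hj|a b ha hb]; rewrite !cfD.
  + by rewrite h1 // k1 // addr0.
  + by rewrite h2 // k2 // addr0.
  + by rewrite h3 // k3 // mulrDr.
- move=> a f [h1 h2 h3]; split=> [i j hi hj|i j hi hj|b d hb hd]; rewrite !cfZ.
  + by rewrite h1 // mulr0.
  + by rewrite h2 // mulr0.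
  + by rewrite h3 // mulrCA.
- move=> f [h1 h2 h3]; split=> [[|i] j hi hj|[|i] j hi hj|[|[|//]] b ha hb]; rewrite !cfMx //.
  + by apply: h1 => //; exact: ltnW.
  + by apply: h2 => //; exact: ltnW.
  + by rewrite addn0 {1}m0 h1 ?mulr0 //; lia.
  + by rewrite addn1 h3 ?addn0.
- move=> f [h1 h2 h3]; split=> [i [|j] hi hj|i [|j] hi hj|a [|[|//]] ha hb]; rewrite !cfMy //.
  + by apply: h1 => //; exact: ltnW.
  + by apply: h2 => //; exact: ltnW.
  + by rewrite addn0 {1}m0 h2 ?mulr0 //; lia.
  + by rewrite addn1 -{1}[m]addn0 h3.
Qed.

Lemma nn_end_balanced c : nn `<=` end_balanced c.
Proof.
apply: (nn_min hm (@end_balanced_ideal c)) => f wf tf f0.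
have z i j : (i < N)%N -> (j < N)%N -> ~~ ((i == j) && (1 < i))%N -> cf f i j = 0.
  move=> hi hj ne; have [e|ne'] := eqVneq i j; last first.
    by apply: wf; rewrite add0n !modn_small.
  have [[-> ->]|[-> ->]] : (i = 0 /\ j = 0 \/ i = 1 /\ j = 1)%N.
    by move: ne; rewrite e eqxx /=; lia.
  - by [].
  - exact: invariant_cf11.
split=> [i j hi hj|i j hi hj|a b ha hb].
- by apply: z; lia.
- by apply: z; lia.
- by rewrite !z ?mulr0 //; lia.
Qed.

Lemma end_pt_balanced c : end_pt c `<=` end_balanced c.
Proof.
have id := @end_balanced_ideal c.
apply: (ideal_gen_min id) => f [|->]; first exact: nn_end_balanced.
split=> [i j hi hj|i j hi hj|a b ha hb]; rewrite !cfD !cfZ !cf_mon.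
- have -> : (m == i) = false by lia.
  have -> : (m == j) = false by lia.
  by rewrite andbF mulr0 addr0.
- have -> : (m == i) = false by lia.
  have -> : (m == j) = false by lia.
  by rewrite andbF mulr0 addr0.
- have -> : (m == a) = false by lia.
  have -> : (m == b) = false by lia.
  have e i : (m == m + i)%N = (i == 0)%N by lia.
  rewrite !e andbF /= mulr0 addr0 add0r; congr (_ * _%:R).
  by case: a ha => [|[|//]] _; case: b hb => [|[|//]] _.
Qed.

Section EndGood.
Variables (c : C) (cc : c * c = (-1) ^+ m).

Lemma end_c_neq0 : c != 0.
Proof.
by apply/eqP => c0; move: cc; rewrite c0 mul0r => /eqP; rewrite eq_sym signr_eq0.
Qed.

(** In weight m, x ^ m and x ^ (m + 1) y are eigenvectors of tau modulo the ideal,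
   with eigenvalues - c and c, whence their sum. *)
Definition end_u b : P :=
  if b == 0%N then mon 0 0 + mon 1 1
  else if b == m then mon m 0 + mon m.+1 1
  else if (b < m)%N then mon b 0 else mon 1 (N - b).+1.

Lemma end_pt_mul i j : end_pt c (mon (m + i) j + c *: mon i (m + j)).
Proof.
have := idlM (@end_pt_ideal R m c) (mon i j) (@end_pt_mem R m c).
by rewrite mulrDr -scalerAr !mul_mon !addn0 [(m + i)%N]addnC [(m + j)%N]addnC.
Qed.

Lemma end_pt_high_x i j : (m.+2 <= i)%N -> end_pt c (mon i j).
Proof.
move=> hi; have id := @end_pt_ideal R m c.
suff h : end_pt c (mon m.+2 0) by apply: (idl_mon id h).
have := end_pt_mul 2 0; rewrite addn2 addn0 => h.
apply: (idlDl id _ h); apply: (idlZ id); apply: end_pt_nn.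
by apply: (nn_mon hm); lia.
Qed.

Lemma end_pt_high_y i j : (m.+2 <= j)%N -> end_pt c (mon i j).
Proof.
move=> hi; have id := @end_pt_ideal R m c.
suff h : end_pt c (mon 0 m.+2) by apply: (idl_mon id h).
have := end_pt_mul 0 2; rewrite addn2 addn0 addrC => h.
apply: (idl_lead id end_c_neq0 h); apply: end_pt_nn.
by apply: (nn_mon hm); lia.
Qed.

Lemma end_pt_good : good m (end_pt c).
Proof.
have id := @end_pt_ideal R m c; have nJ := @end_pt_nn R m c.
have c0 := end_c_neq0.
have m0 : (m == 0)%N = false by lia.
have cV : c^-1 != 0 by rewrite invr_eq0.
split=> //.
- exact: end_pt_stable.
- by move=> f /end_pt_balanced[h _ _]; apply: h; lia.
exists end_u; split=> [a aN|a b aN bN hab].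
  rewrite /end_u; case: eqP => [->|/eqP a0].
    by apply: WtD; apply: Wt_mon.
  case: eqP => [->|_].
    by apply: WtD; apply: Wt_mon; rewrite ?addn0 ?addn1.
  case: ifP => _; apply: Wt_mon; first by rewrite addn0.
  by rewrite addnS subnKC 1?ltnW // -(addn1 N) modnDl.
have [[-> ->]|[a1 ->]] := opp_cases hm aN bN hab.
  rewrite /end_u /=; apply: (weight0_basis hm) => //.
  - by rewrite tau_mon expr1 scaleN1r addNr; exact: idl0.
  - exact: in_spanr.
  - by apply: in_span0; apply: end_pt_high_y; lia.
  - by apply: indep_mon => // f /end_pt_balanced[h _ _]; apply: h; lia.
have a0 : (a == 0)%N = false by lia.
have b0 : (N - a == 0)%N = false by lia.
have a1N : (1 <= a < N)%N by lia.
have eN : (N - (N - a) = a)%N by lia.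
rewrite /end_u a0 b0 eN.
have [am|am|am] := ltngtP a m.
- have -> : (N - a == m)%N = false by lia.
  have -> : (N - a < m)%N = false by lia.
  rewrite tau_mon; apply: weight_basis_scale; first by rewrite signr_eq0.
  apply: (weight_basisP hm id nJ a1N).
  + exact: in_spanl.
  + have [ea|ea] := eqVneq a m.-1; last by apply: in_span0; apply: end_pt_high_y; lia.
    apply: (in_span_lin id (c := c^-1) (g := mon a.+1 1)); last exact: in_spanr.
    have := idl_swap id c0 (end_pt_mul 0 1).
    have -> : (m + 0 = a.+1)%N by lia.
    by have -> : (m + 1 = N - a)%N by lia.
  + exact: in_spanr.
  + by apply: in_span0; apply: end_pt_high_y; lia.
  + move=> al be /end_pt_balanced[h1 _ h3].
    have := h1 a 0 am isT; rewrite cfD !cfZ !cf_mon !eqxx andbF mulr0 addr0 mulr1 => al0.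
    split=> //; have [ea|ea] := eqVneq a.+1 m.
      have := h3 0 1 isT isT; rewrite al0 scale0r add0r !cfZ !cf_mon -ea addn0 !eqxx /=.
      rewrite mulr0 mulr1 => /eqP; rewrite eq_sym mulf_eq0 (negbTE c0) => /eqP //.
    have a1m : (a.+1 < m)%N by lia.
    have := h1 a.+1 1 a1m isT; rewrite al0 scale0r add0r !cfZ !cf_mon !eqxx.
    by rewrite mulr1.
- have -> : (N - a == m)%N = false by lia.
  have -> : (N - a < m)%N by lia.
  have bm : (N - a < m)%N by lia.
  rewrite tau_mon; apply: weight_basis_scale; first by rewrite signr_eq0.
  apply: (weight_basisP hm id nJ a1N).
  + have [ea|ea] := eqVneq a m.+1; last by apply: in_span0; apply: end_pt_high_x; lia.
    apply: (in_span_lin id (c := c) (g := mon 1 (N - a).+1)); last exact: in_spanl.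
    have := end_pt_mul 1 0.
    have -> : (m + 1 = a)%N by lia.
    by have -> : (m + 0 = (N - a).+1)%N by lia.
  + exact: in_spanr.
  + by apply: in_span0; apply: end_pt_high_x; lia.
  + exact: in_spanl.
  + move=> al be /end_pt_balanced[_ h2 h3].
    have := h2 0 (N - a)%N isT bm; rewrite cfD !cfZ !cf_mon !eqxx /= mulr0 add0r mulr1 => be0.
    split=> //; have [ea|ea] := eqVneq (N - a).+1 m.
      have := h3 1 0 isT isT; rewrite be0 scale0r addr0 !cfZ !cf_mon addn0 ea !eqxx /=.
      have -> : (1 == m + 1)%N = false by lia.
      by rewrite !mulr0 mulr1.
    have b1m : ((N - a).+1 < m)%N by lia.
    have := h2 1 (N - a).+1 isT b1m; rewrite be0 scale0r addr0 !cfZ !cf_mon !eqxx.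
    by rewrite mulr1.
have -> : (N - a = m)%N by lia.
rewrite eqxx; subst a.
have e1 : end_pt c (mon 0 m + c^-1 *: mon m 0).
  by have := idl_swap id c0 (end_pt_mul 0 0); rewrite !addn0.
have e2 : end_pt c (mon 1 m.+1 + c^-1 *: mon m.+1 1).
  by have := idl_swap id c0 (end_pt_mul 1 1); rewrite !addn1.
have ccV : (-1) ^+ m * c^-1 = c by rewrite -cc mulfK.
apply: (weight_basis_mix id (c := - c)); first by rewrite oppr_eq0.
  rewrite actD !tau_mon exprS mulN1r !scaleNr opprK.
  have f1 := idlZ id ((-1) ^+ m) e1; have f2 := idlZ id ((-1) ^+ m) e2.
  rewrite scalerDr scalerA ccV in f1; rewrite scalerDr scalerA ccV in f2.
  by have := idlB id f1 f2; rewrite opprD addrACA opprD opprK.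
apply: (weight_basisP hm id nJ a1N).
- exact: in_spanl.
- have -> : (N - m = m)%N by lia.
  by apply: (in_span_lin id e1); exact: in_spanl.
- exact: in_spanr.
- have -> : (N - m = m)%N by lia.
  by apply: (in_span_lin id e2); exact: in_spanr.
- move=> al be /end_pt_balanced[_ _ h3].
  have := h3 0 0 isT isT; have := h3 1 1 isT isT.
  rewrite !addn0 !addn1 !cfD !cfZ !cf_mon !eqxx m0 /=.
  have -> : (m == m.+1) = false by lia.
  have -> : (m.+1 == m) = false by lia.
  have -> : (m == 1)%N = false by lia.
  have -> : (m.+1 == 1)%N = false by lia.
  rewrite /= !mulr0 !addr0 add0r !mulr1 => /eqP h1 /eqP h2.
  move: h1 h2; rewrite ![0 == _]eq_sym !mulf_eq0 (negbTE c0) /=.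
  by move=> /eqP -> /eqP ->.
Qed.

End EndGood.

End EndPoints.

(** * Containment, isolation and the action on ideals *)

Section Bases.
Variables (R : realType).
Local Notation C := R[i].
Local Notation P := {mpoly C[2]}.
Implicit Types (f p q : P) (I J : set P).

(** The matrix that expresses a basis modulo J in terms of a basis modulo I of the
   same cardinal is invertible. *)
Lemma basis_mod_eq n I J (B B' : 'I_n -> P) : is_ideal I -> is_ideal J -> I `<=` J ->
  basis_mod I B -> basis_mod J B' -> J `<=` I.
Proof.
move=> idI idJ sub [spB _] [_ indB'] f Jf.
have [c hc] := choice (fun j => spB (B' j)).
have comb (d : 'I_n -> C) (F G : 'I_n -> P) : (forall j, I (F j - G j)) ->
    I (\sum_j d j *: F j - \sum_j d j *: G j).
  move=> h; rewrite -sumrB; apply: idl_sum => // j _; rewrite -scalerBr.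
  exact: idlZ.
pose M : 'M[C]_n := \matrix_(j, k) c j k.
have swap (d : 'I_n -> C) : \sum_j d j *: \sum_k c j k *: B k =
    \sum_k ((\row_j d j) *m M) 0 k *: B k.
  under eq_bigr => j _ do rewrite scaler_sumr.
  rewrite exchange_big; apply: eq_bigr => k _ /=; rewrite mxE scaler_suml.
  by apply: eq_bigr => j _; rewrite !mxE scalerA.
have uM : M \in unitmx.
  rewrite -row_free_unit -kermx_eq0; apply/eqP/row_matrixP => i; rewrite row0.
  set v := row i _; have vM : v *m M = 0 by apply/sub_kermxP/row_sub.
  apply/rowP => j; rewrite [RHS]mxE; move: j; apply: indB'.
  have := comb (fun j => v 0 j) _ _ hc; rewrite swap => h.
  have e : \row_j v 0 j = v by apply/rowP => j; rewrite mxE.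
  move: h; rewrite e vM; rewrite [X in _ - X]big1 => [|k _]; last by rewrite mxE scale0r.
  by rewrite subr0; exact: sub.
have [d hd] := spB f.
pose e := (\row_k d k) *m invmx M.
have := comb (fun j => e 0 j) _ _ hc; rewrite swap.
have -> : \row_j e 0 j = e by apply/rowP => j; rewrite mxE.
rewrite /e mulmxKV // -/e.
under [X in _ - X]eq_bigr => k _ do rewrite mxE.
move=> he; have h := idlB idI hd he.
rewrite opprB addrA subrK in h.
suff e0 : forall j, e 0 j = 0.
  move: h; rewrite big1 => [|j _]; last by rewrite e0 scale0r.
  by rewrite subr0.
apply: indB'; have := idlB idJ Jf (sub _ h).
by rewrite opprB addrC subrK.
Qed.

Lemma basis_exchange n I (B : 'I_n -> P) q : is_ideal I -> basis_mod I B -> ~ I q ->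
  exists (B' : 'I_n -> P) j0, basis_mod I B' /\ B' j0 = q.
Proof.
move=> idI [spB indB] nq; have [c hc] := spB q.
have [j0 cj0] : exists j0, c j0 != 0.
  apply/existsP; rewrite -negb_forall; apply/negP => /forallP c0; apply: nq.
  apply: (idl_cong idI hc); rewrite big1 => [|j _]; first exact: idl0.
  by rewrite (eqP (c0 j)) scale0r.
pose B' j := if j == j0 then q else B j.
exists B', j0; split; last by rewrite /B' eqxx.
have split_B' (d : 'I_n -> C) :
    I (\sum_j d j *: B' j - \sum_j ((j != j0)%:R * d j + d j0 * c j) *: B j).
  under [X in _ - X]eq_bigr => j _ do rewrite scalerDl.
  rewrite big_split /= opprD addrA.
  rewrite (bigD1 j0) //= [X in _ - X - _](bigD1 j0) //= /B' eqxx mul0r scale0r add0r.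
  rewrite (eq_bigr (fun j => ((j != j0)%:R * d j) *: B j)) => [|j ne]; last first.
    by rewrite (negbTE ne) mul1r.
  rewrite addrK.
  under [X in _ - X]eq_bigr => j _ do rewrite -scalerA.
  by rewrite -scaler_sumr -scalerBr; exact: idlZ.
split.
- move=> p; have [d hd] := spB p.
  pose k : C := d j0 / c j0.
  pose d' j := if j == j0 then k else d j - k * c j; exists d'; have := idlB idI hd (split_B' d').
  suff -> : \sum_j ((j != j0)%:R * d' j + d' j0 * c j) *: B j = \sum_j d j *: B j.
    by rewrite opprB addrA subrK.
  apply: eq_bigr => j _; congr (_ *: _); rewrite /d' eqxx.
  by case: (j =P j0) => [->|_]; rewrite ?mul0r ?add0r ?mul1r ?subrK // /k divfK.
- move=> d hd; have := idlB idI hd (split_B' d); rewrite subKr => /indB h.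
  have dj0 : d j0 = 0.
    by have := h j0; rewrite eqxx mul0r add0r => /eqP; rewrite mulf_eq0 (negbTE cj0) orbF => /eqP.
  move=> j; have := h j; rewrite dj0 mul0r addr0.
  by case: (j =P j0) => [->|_]; rewrite ?mul1r.
Qed.

(** A basis of the quotient that contains q defines a basic open set, and no
   ideal in this set contains q. *)
Lemma isolated_by n m I (B : 'I_n -> P) q : is_ideal I -> basis_mod I B -> ~ I q ->
  fixed_exceptional R m I ->
  (forall J, fixed_exceptional R m J -> ~ J q -> J = I) -> isolated_fixed_point R m I.
Proof.
move=> idI bB nq fI uniq; split=> [J ->//|J ->].
have [B' [j0 [bB' ej0]]] := basis_exchange idI bB nq.
exists n, 0%N, B', (fun=> 0), 1; split.
  split=> //; exists 0; split; first by case.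
  by rewrite meval1 oner_neq0.
move=> K [fK [[_ indK] _]]; apply: uniq => // Kq.
(* q is a member of a basis modulo K. *)
have := indK (fun j => (j == j0)%:R).
rewrite (bigD1 j0) //= eqxx scale1r ej0 big1 ?addr0 => [|j /negbTE ->]; last by rewrite scale0r.
by move=> /(_ Kq j0); rewrite eqxx => /eqP; rewrite oner_eq0.
Qed.

End Bases.

Section Transport.
Variables (R : realType) (m : nat) (hm : (3 <= m)%N).
Local Notation C := R[i].
Local Notation P := {mpoly C[2]}.
Local Notation N := m.*2.
Local Notation tau := (tau R).
Local Notation dl := (dl R).
Local Notation nn := (nn R m).
Local Notation mI := (@mI_n R m).
Local Notation x := ('X_ord0 : P).
Local Notation y := ('X_ord_max : P).
Implicit Types (f p q u v : P) (I J S : set P) (c : C).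

Lemma good_basis I : good m I -> exists B : 'I_(N + N) -> P, basis_mod I B.
Proof.
move=> [idI HI _ _ [u hu]]; have [p hp] := regular_weights_cyclic hm idI HI hu.
exact: (cyclic_basis_mod idI hp).
Qed.

(** Both ideals have colength 2 N. *)
Lemma good_sub_eq I J : good m I -> good m J -> I `<=` J -> I = J.
Proof.
move=> gI gJ sub; apply/seteqP; split=> //.
have [B hB] := good_basis gI; have [B' hB'] := good_basis gJ.
exact: (basis_mod_eq (good_ideal gI) (good_ideal gJ) sub hB hB').
Qed.

Lemma dl_dl : dl *m dl = 1%:M.
Proof. by rewrite dgM mulrNN !mulr1 dg1. Qed.

Lemma ac_dl_dl f : ac dl (ac dl f) = f.
Proof. by rewrite -act_mulmx dl_dl act_id. Qed.

Lemma gactE g I : gact g I = [set ac g f | f in I].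
Proof. by apply/seteqP; split=> f [p Ip <-]; exists p => //; rewrite acE. Qed.

Lemma gact_dl I f : gact dl I f <-> I (ac dl f).
Proof.
rewrite gactE; split=> [[p Ip <-]|If]; first by rewrite ac_dl_dl.
by exists (ac dl f) => //; rewrite ac_dl_dl.
Qed.

Lemma tau_dl b f : Wt m b f -> ac tau (ac dl f) = (-1) ^+ b *: ac dl (ac tau f).
Proof.
move=> wf; apply: eq_cf => i j; rewrite cfZ cf_tau !cf_dg cf_tau !expr1n !mulr1.
have [e|ne] := eqVneq (j %% N)%N ((b + i) %% N)%N; last by rewrite wf ?mulr0.
rewrite !mulrA -!exprD; congr (_ * _).
have hodd : odd j = odd (b + i).
  by rewrite -(odd_mod j (odd_double m)) e odd_mod ?odd_double.
by rewrite -signr_odd -[RHS]signr_odd !oddD hodd oddD; case: (odd b); case: (odd i).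
Qed.

(** The substitution x |-> - x preserves weights, normalizes H, and commutes with
   tau up to a sign on each weight. *)
Lemma good_dl I : good m I -> good m (gact dl I).
Proof.
move=> [idI HI nI I0 [u [wu bu]]].
have E f : gact dl I f <-> I (ac dl f) := gact_dl I f.
have idJ : is_ideal (gact dl I).
  split.
  - by apply/E; rewrite act0; exact: idl0.
  - by move=> f g /E hf /E hg; apply/E; rewrite actD; exact: idlD.
  - by move=> f g /E hg; apply/E; rewrite actM; exact: idlM.
have Gd : G R m dl := @G_dl R m.
split=> //.
- move=> h f Hh /E hf; rewrite -acE; apply/E.
  have Hh' := HJ hm Gd Hh.
  have iv : invmx dl = dl by apply: invmx_eq; exact: dl_dl.
  have -> : ac dl (ac h f) = ac (invmx dl *m h *m dl) (ac dl f).
    by rewrite -!act_mulmx iv -[_ *m h *m dl *m dl]mulmxA dl_dl mulmx1.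
  by rewrite acE; apply: HI.
- by move=> f hf; apply/E; apply: nI; exact: nn_G.
- by move=> f /E /I0; rewrite (cf_ac_00 hm).
exists (fun a => ac dl (u a)); split=> [a aN|a b aN bN hab]; first exact/Wt_dl/wu.
rewrite (tau_dl (wu b bN)); apply: weight_basis_scale; first by rewrite signr_eq0.
have [sp ind] := bu a b aN bN hab; split.
- move=> f wf; have [al [be h]] := sp _ (Wt_dl wf).
  exists al, be; apply/E; rewrite actB actD !actZ !ac_dl_dl //.
- by move=> al be /E; rewrite actD !actZ !ac_dl_dl; exact: ind.
Qed.

Lemma gact_H h I : H R m h -> good m I -> gact h I = I.
Proof.
move=> Hh gI; have HI := good_stable gI.
apply/seteqP; split=> f; first by case=> p Ip <-; exact: HI.
move=> If; exists (act (invmx h) f); first by apply: HI => //; exact: HV.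
rewrite -!acE -act_mulmx mulmxV ?act_id //.
by case: Hh => Gh _; exact: (G_unit hm Gh).
Qed.

Lemma gact_comp g h I : gact (g *m h) I = gact g (gact h I).
Proof.
rewrite !gactE; apply/seteqP; split=> f.
- by case=> p Ip <-; exists (ac h p); rewrite ?act_mulmx //; exists p.
- by case=> _ [p Ip <-] <-; exists p; rewrite ?act_mulmx.
Qed.

Lemma good_gact g I : G R m g -> good m I -> good m (gact g I).
Proof.
move=> /(G_cases hm)[Hg|[h Hh ->]] gI; first by rewrite (gact_H Hg gI).
by rewrite gact_comp (gact_H Hh gI); exact: good_dl.
Qed.

Lemma gact_inv g I : G R m g -> gact (invmx g) (gact g I) = I.
Proof.
move=> Gg; rewrite -gact_comp mulVmx ?(G_unit hm Gg) // gactE.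
by apply/seteqP; split=> f; [case=> p Ip <-; rewrite act_id | move=> If; exists f; rewrite ?act_id].
Qed.

(** H fixes I, and G is generated by H and the substitution x |-> - x. *)
Lemma A_fixedP I : good m I -> (A_fixed R m I <-> forall f, I f -> I (ac dl f)).
Proof.
move=> gI; split=> [fI f If|fI].
  rewrite -{1}(fI _ (@G_dl R m)) gact_dl ac_dl_dl //.
move=> g /(G_cases hm)[Hg|[h Hh ->]]; first by rewrite (gact_H Hg gI).
rewrite gact_comp (gact_H Hh gI); apply/seteqP; split=> f; first by move/gact_dl/fI; rewrite ac_dl_dl.
by move=> /fI If; apply/gact_dl.
Qed.

Lemma mm_G g f : mm f -> mm (ac g f).
Proof.
apply: ideal_gen_act => // {}f.
have idm := ideal_gen_ideal [set x; y].
case=> ->; rewrite act_X; apply: (idlD idm); apply: (idlZ idm); apply: ideal_gen_sub;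
  by [left|right].
Qed.

Lemma mI_G g I f : G R m g -> mI I f -> mI (gact g I) (ac g f).
Proof.
move=> Gg; apply: ideal_gen_act => {}f [[a ha [b Ib <-]]|hf].
- rewrite actM; apply: mI_mul; first exact: mm_G.
  by rewrite gactE; exists b.
- by apply: mI_nn; exact: nn_G.
Qed.

(** m is generated by x and y, so only the products of these with generators
   of I have to be tested. *)
Lemma mI_gen_min S (Q : set P) : is_ideal Q -> nn `<=` Q ->
  (forall g, S g -> Q (x * g) /\ Q (y * g)) -> mI (ideal_gen (nn `|` S)) `<=` Q.
Proof.
move=> idQ nQ hS.
have step g : ideal_gen (nn `|` S) g -> Q (x * g) /\ Q (y * g).
  move: g; apply: ideal_gen_min => [|g [hg|]]; last exact: hS.
  - split.
    + by rewrite !mulr0; split; exact: idl0.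
    + by move=> f g [h1 h2] [k1 k2]; rewrite !mulrDr; split; exact: idlD.
    + by move=> f g [h1 h2]; rewrite !(mulrCA _ f); split; exact: idlM.
  - by split; apply: (idlM idQ); exact: nQ.
apply: ideal_gen_min => // f [[a ha [b /step[h1 h2] <-]]|]; last exact: nQ.
move: a ha; apply: ideal_gen_min => [|a []->//].
split.
- by rewrite mul0r; exact: idl0.
- by move=> f' g h k; rewrite mulrDl; exact: idlD.
- by move=> f' g h; rewrite -mulrA; exact: idlM.
Qed.

End Transport.

(** * Fixed points on the curves *)

Section Fixed.
Variables (R : realType) (m : nat) (hm : (3 <= m)%N).
Local Notation C := R[i].
Local Notation P := {mpoly C[2]}.
Local Notation N := m.*2.
Local Notation mon := (@mon R).
Local Notation cf := (@cf R).
Local Notation dl := (dl R).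
Local Notation nn := (nn R m).
Local Notation mI := (@mI_n R m).
Local Notation rect := (@rect R).
Local Notation curve_pt := (@curve_pt R m).
Local Notation end_pt := (@end_pt R m).
Implicit Types (f p q u v : P) (I J S : set P) (c : C).

Lemma curve_pt_mI_rect k A B : ((B <= 1) && (A < N) || (A <= 1) && (B < N))%N ->
  [&& ~~ ((k < A) && (1 <= B)), ~~ ((k <= A) && (2 <= B)), ~~ ((2 <= A) && (k <= B)),
    ~~ ((1 <= A) && (k < B)), A < (N - k).+3, ~~ (((N - k).+2 <= A) && (1 <= B)),
    ~~ ((1 <= A) && ((N - k).+2 <= B)) & B < (N - k).+3]%N ->
  mI (curve_pt k) `<=` rect A B.
Proof.
move=> h1 h2; apply: mI_gen_min; first exact: rect_ideal.
  exact: nn_rect.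
by move=> g [] ->; rewrite mulx_mon muly_mon; split; apply: rect_mon; move: h1 h2; lia.
Qed.

Lemma curve_pt_mI_xy k f : (1 <= k <= m)%N -> mI (curve_pt k) f ->
  cf f k 1 = 0 /\ cf f 1 k = 0.
Proof.
move=> km h; split.
- by apply: (@curve_pt_mI_rect k k 1 _ _ f h) => //; lia.
- by apply: (@curve_pt_mI_rect k 1 k _ _ f h) => //; lia.
Qed.

Lemma curve_pt_mI_y k f : (3 <= k <= m.+1)%N -> mI (curve_pt k) f ->
  cf f (N - k).+2 0 = 0 /\ cf f 0 (N - k).+2 = 0.
Proof.
move=> km h; split.
- by apply: (@curve_pt_mI_rect k (N - k).+2 0 _ _ f h) => //; lia.
- by apply: (@curve_pt_mI_rect k 0 (N - k).+2 _ _ f h) => //; lia.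
Qed.

Lemma curve_pt_mI_2 : mI (curve_pt 2) `<=` @pure_balanced R m.
Proof.
apply: mI_gen_min; first exact: pure_balanced_ideal.
  exact: nn_pure_balanced.
by move=> g [] ->; rewrite mulx_mon muly_mon; split; apply: pure_balanced_mon; lia.
Qed.

Lemma end_pt_mI c f : mI (end_pt c) f -> cf f m 0 = 0.
Proof.
suff h : mI (end_pt c) `<=` rect m 0 by move=> /h; apply.
apply: mI_gen_min; first exact: rect_ideal.
  by apply: nn_rect => //; lia.
have id := rect_ideal R m 0.
move=> g ->; rewrite !mulrDr -!scalerAr !mulx_mon !muly_mon.
by split; apply: (idlD id); try apply: (idlZ id); apply: rect_mon; lia.
Qed.

Lemma curve_pt_dl k f : curve_pt k f -> curve_pt k (ac dl f).
Proof.
have id := @curve_pt_ideal R m k.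
apply: ideal_gen_act => {}f [hf|].
  by apply: curve_pt_nn; apply: nn_G hf => //; exact: G_dl.
by case=> ->; rewrite dl_mon; apply: (idlZ id); apply: curve_pt_mem;
  [constructor 1|constructor 2|constructor 3|constructor 4].
Qed.

Lemma end_pt_dl c f : ~~ odd m -> end_pt c f -> end_pt c (ac dl f).
Proof.
move=> em; have id := @end_pt_ideal R m c.
apply: ideal_gen_act => {}f [hf|->].
  by apply: end_pt_nn; apply: nn_G hf => //; exact: G_dl.
rewrite actD actZ !dl_mon -signr_odd (negbTE em) !expr0 !scale1r.
exact: end_pt_mem.
Qed.

Lemma curve_pt_sub k J : good m J -> J (mon k 1) -> J (mon 0 (N - k).+2) ->
  curve_pt k `<=` J.
Proof.
move=> gJ h1 h2; apply: (ideal_gen_min (good_ideal gJ)) => f [|].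
  exact: good_nn gJ _.
by case=> ->; [ | apply: (good_flip hm gJ) | apply: (good_flip hm gJ) | ].
Qed.

(** The monomials that generate the ideal of index k are in J; equal colength
   does the rest. *)
Lemma curve_pt_eq k J : (1 <= k <= m.+1)%N -> good m J -> J (mon k 1) ->
  J (mon 0 (N - k).+2) -> J = curve_pt k.
Proof.
move=> km gJ h1 h2; apply/esym/(good_sub_eq hm) => //; first exact: curve_pt_good.
exact: curve_pt_sub.
Qed.

Lemma end_pt_eq c J : c * c = (-1) ^+ m -> good m J -> J (mon m 0 + c *: mon 0 m) ->
  J = end_pt c.
Proof.
move=> cc gJ h; apply/esym/(good_sub_eq hm) => //; first exact: end_pt_good.
apply: (ideal_gen_min (good_ideal gJ)) => f [|-> //].
exact: good_nn gJ _.
Qed.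

Lemma idl_half I p q : is_ideal I -> I (p + q) -> I (p - q) -> I p /\ I q.
Proof.
move=> idI h1 h2; split; apply: (idlZr idI (two_neq0 R)); rewrite scaler_nat mulr2n.
  by have := idlD idI h1 h2; rewrite addrACA subrr addr0.
by have := idlB idI h1 h2; rewrite opprD addrACA subrr add0r opprK.
Qed.

(** For odd k the substitution x |-> - x changes the sign of x ^ k y and fixes
   y ^ (N - k + 1), so both terms of the relation of index k are in J. *)
Lemma odd_fixed k J : odd k -> (1 <= k <= m)%N -> good m J ->
  (forall f, J f -> J (ac dl f)) -> J (mon k 1) \/ J (mon 0 (N - k).+1).
Proof.
move=> ok km gJ fJ; have id := good_ideal gJ.
have [l1 [l2 [nz h]]] := line_ex hm gJ km.
have := fJ _ h; rewrite actD !actZ !dl_mon -signr_odd ok expr1 expr0 scale1r.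
rewrite scaleN1r scalerN addrC => h'.
rewrite addrC in h.
have [h2 h1] := idl_half id h h'.
have [l10|l10] := eqVneq l1 0; last by left; exact: (idlZr id l10).
have l20 : l2 != 0 by move: nz; rewrite l10 eqxx.
by right; exact: (idlZr id l20).
Qed.

(** Each weight component of an element of I is reduced to the four spanning
   monomials. The part outside I of a reduced element lies in the pencil of index k,
   where x |-> - x acts by a single sign as k is even, or, in weight m, is a
   combination of x ^ m and y ^ m, which are fixed for even m and do not occur for
   odd m. Weights above m are brought back below m by tau. *)
Lemma even_fixed k I : ~~ odd k -> (2 <= k <= m)%N -> good m I -> I (mon k.+1 1) ->
  I (mon 0 (N - k).+2) -> forall f, I f -> I (ac dl f).
Proof.
move=> ek km gI hxy hy; have id := good_ideal gI; have nI := good_nn gI.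
have red f g : nn (f - g) -> I f -> (I g -> I (ac dl g)) -> I (ac dl f).
  move=> h If hg; apply: (idl_cong id (g := ac dl g)).
    by rewrite -actB; apply: nI; apply: nn_G h => //; exact: G_dl.
  by apply: hg; rewrite -(subKr f g); apply: (idlB id) => //; exact: nI.
have dZ c p : I (c *: p) -> ac dl p = p \/ ac dl p = - p -> I (ac dl (c *: p)).
  by move=> h [] e; rewrite actZ e // scalerN; exact: idlN.
have dM i j : ac dl (mon i j) = mon i j \/ ac dl (mon i j) = - mon i j.
  rewrite dl_mon -signr_odd; case: (odd i); rewrite ?expr1 ?expr0 ?scale1r ?scaleN1r;
  by [left|right].
have low a f : (a <= m)%N -> Wt m a f -> I f -> I (ac dl f).
  have [->|a0] := eqVneq a 0%N => am wf If.
    have [c1 [c2 [c3 h]]] := weight0_span hm wf.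
    apply: (red _ _ h If) => hs.
    have N0 : (N == 0)%N = false by lia.
    have c10 : c1 = 0.
      by have := good_origin gI hs; rewrite !cfD !cfZ !cf_mon N0 /= !mulr0 !addr0 mulr1.
    have h3 : I (c3 *: mon 0 N) by apply: (idlZ id); apply: (idl_mon id hy); lia.
    move: hs; rewrite c10 scale0r add0r => hs.
    have h2 := idlDl id h3 hs.
    by rewrite actD; apply: (idlD id); apply: dZ.
  have aN : (1 <= a < N)%N by lia.
  have [c1 [c2 [c3 [c4 h]]]] := weight_span hm aN wf.
  apply: (red _ _ h If) => hs.
  have [lt|ge] := ltnP a m; last first.
    have ea : a = m by lia.
    have eN : (N - m = m)%N by lia.
    move: hs; rewrite ea eN => hs.
    have m3 : I (mon m.+1 1) by apply: (idl_mon id hxy); lia.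
    have m4 := good_flip hm gI m3.
    have h3 : I (c3 *: mon m.+1 1) by exact: idlZ.
    have h4 : I (c4 *: mon 1 m.+1) by exact: idlZ.
    have h12 := idlDl id h3 (idlDl id h4 hs).
    rewrite actD [ac dl (_ + c3 *: _)]actD; apply: (idlD id); last exact: dZ.
    apply: (idlD id); last exact: dZ.
    (* For odd m the two pure powers do not occur: y times or x times their
       combination would put y ^ (m + 1) into I, next to x ^ m y. *)
    case: (boolP (odd m)) => om; last first.
      by rewrite actD !actZ !dl_mon -signr_odd (negbTE om) !expr0 !scale1r.
    have k1m : (k.+1 <= m)%N.
      have [e|] := eqVneq k m; first by move: ek; rewrite e om.
      by lia.
    have hm1 : I (mon m 1) by apply: (idl_mon id hxy); lia.
    have h1m := good_flip hm gI hm1.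
    have nb : ~ I (mon 0 m.+1).
      have mm : (1 <= m <= m)%N by lia.
      by have := line_proper hm gI mm hm1; rewrite eN.
    have c20 : c2 = 0.
      apply/eqP/negP => /negP c20; apply: nb.
      have := idlM id (mon 0 1) h12; rewrite mulrDr -!scalerAr !mul_mon addrC !add0n add1n addn0 => h6.
      by apply: (idl_lead id c20 h6); apply: (idlZ id).
    have c10 : c1 = 0.
      apply/eqP/negP => /negP c10; apply: nb.
      have := idlM id (mon 1 0) h12; rewrite mulrDr -!scalerAr !mul_mon !add0n add1n addn0 => h6.
      apply: (good_flip hm gI).
      by apply: (idl_lead id c10 h6); apply: (idlZ id).
    by rewrite c10 c20 !scale0r addr0 act0; exact: idl0.
  have alt : (1 <= a < m)%N by lia.
  have c10 := initial_coef0 hm gI alt hs.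
  have m4 : I (mon 1 (N - a).+1) by exact: (mI_sub id nI (mI_top hm gI alt)).
  have h4 : I (c4 *: mon 1 (N - a).+1) by exact: idlZ.
  have h23 := idlDl id h4 hs; move: h23; rewrite c10 scale0r add0r => h23.
  rewrite actD; apply: (idlD id); last exact: dZ.
  case: (ltngtP a.+1 k) => hak.
  - have h2 : I (c2 *: mon 0 (N - a)) by apply: (idlZ id); apply: (idl_mon id hy); lia.
    by rewrite actD; apply: (idlD id); apply: dZ => //; exact: (idlDr id h2 h23).
  - have h3 : I (c3 *: mon a.+1 1) by apply: (idlZ id); apply: (idl_mon id hxy); lia.
    by rewrite actD; apply: (idlD id); apply: dZ => //; exact: (idlDl id h3 h23).
  - by rewrite actD !actZ !dl_mon hak -(signr_odd _ k) (negbTE ek) !expr0 !scale1r -hak.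
move=> f If; rewrite (sum_pr hm f) act_sum; apply: (idl_sum id) => a _.
have Ia : I (pr m a f) by exact: (good_pr hm gI).
have wa : Wt m a (pr m a f) by exact: Wt_pr.
have [le|gt] := leqP a m; first exact: (low _ _ le wa Ia).
have aN := ltn_ord a.
have le : (N - a <= m)%N by lia.
have hab : (N %| (N - a) + a)%N by rewrite subnK ?dvdnn // ltnW.
have := low _ _ le (Wt_tau hab wa) (good_tau hm gI Ia).
move=> /(good_tau hm gI); rewrite (tau_dl (Wt_tau hab wa)) (tau_tau hm) (Wt_hs hm _ wa).
by rewrite actZ scalerA; apply: (idlZr id); rewrite mulf_neq0 ?signr_eq0 ?(zeta_neq0 R hm).
Qed.

End Fixed.

(** * Explicit representations and transport of curves *)

Section Reps.
Variables (R : realType) (m : nat) (hm : (3 <= m)%N).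
Local Notation C := R[i].
Local Notation P := {mpoly C[2]}.
Local Notation N := m.*2.
Local Notation z := (zeta R m).
Local Notation dl := (dl R).
Local Notation mI := (@mI_n R m).
Implicit Types (f p q u v : P) (I J S : set P) (c : C) (g h : 'M[C]_2).

Definition monomial_mx g := exists s t, g = dg s t \/ g = ad s t.

Lemma G_monomial g : G R m g -> monomial_mx g.
Proof. by move=> /(G_form hm)[s [t [_ _ e]]]; exists s, t. Qed.

Lemma H_monomial g : H R m g -> monomial_mx g.
Proof. by move=> [/G_monomial]. Qed.

Definition powmx n g : 'M[C]_2 := map_mx (fun a => a ^+ n.+1) g.

Lemma powmx_dg n s t : powmx n (dg s t) = dg (s ^+ n.+1) (t ^+ n.+1).
Proof.
apply/matrixP => i j; rewrite !mxE.
by case: i => [[|[|//]] hi]; case: j => [[|[|//]] hj] //=; rewrite expr0n.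
Qed.

Lemma powmx_ad n s t : powmx n (ad s t) = ad (s ^+ n.+1) (t ^+ n.+1).
Proof.
apply/matrixP => i j; rewrite !mxE.
by case: i => [[|[|//]] hi]; case: j => [[|[|//]] hj] //=; rewrite expr0n.
Qed.

Lemma powmx1 n : powmx n 1%:M = 1%:M.
Proof. by rewrite -dg1 powmx_dg !expr1n. Qed.

Lemma powmxM n g h : monomial_mx g -> monomial_mx h ->
  powmx n (g *m h) = powmx n g *m powmx n h.
Proof.
move=> [s [t eg]] [s' [t' eh]].
by case: eg => ->; case: eh => ->;
  rewrite ?(dgM, adM, dgadM, addgM, powmx_dg, powmx_ad) !exprMn.
Qed.

Lemma Vrep_mul n g h : H R m g -> H R m h -> powmx n (g *m h) = powmx n g *m powmx n h.
Proof. by move=> Hg Hh; apply: powmxM; exact: H_monomial. Qed.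

(** The span of x ^ (n + 1) and y ^ (n + 1). *)
Definition Vrep n : rep R m := Rep (powmx1 n) (@Vrep_mul n).

Section Characters.
Variables (ch : 'M[C]_2 -> C) (ch1 : ch 1%:M = 1)
  (chM : forall g h, H R m g -> H R m h -> ch (g *m h) = ch g * ch h).

Lemma char_mx1 : (ch 1%:M)%:M = 1%:M :> 'M[C]_1. Proof. by rewrite ch1. Qed.
Lemma char_mxM g h : H R m g -> H R m h ->
  (ch (g *m h))%:M = (ch g)%:M *m (ch h)%:M :> 'M[C]_1.
Proof. by move=> Hg Hh; rewrite chM // scalar_mxM. Qed.

Definition char_rep : rep R m := Rep char_mx1 char_mxM.
End Characters.

(** The character through which H acts on x y. *)
Definition sgn g : C := g ord0 ord0 * g ord_max ord_max + g ord0 ord_max * g ord_max ord0.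

Lemma sgn_dg s t : sgn (dg s t) = s * t.
Proof. by rewrite /sgn !mxE /= mulr0 addr0. Qed.
Lemma sgn_ad s t : sgn (ad s t) = s * t.
Proof. by rewrite /sgn !mxE /= mulr0 add0r. Qed.

Lemma sgn1 : sgn 1%:M = 1. Proof. by rewrite -dg1 sgn_dg mulr1. Qed.

Lemma sgnM g h : monomial_mx g -> monomial_mx h -> sgn (g *m h) = sgn g * sgn h.
Proof.
move=> [s [t eg]] [s' [t' eh]].
by case: eg => ->; case: eh => ->; rewrite ?(dgM, adM, dgadM, addgM, sgn_dg, sgn_ad); ring.
Qed.

Definition sgn_rep := char_rep sgn1 (fun g h Hg Hh => sgnM (H_monomial Hg) (H_monomial Hh)).

(** The character through which H acts on x ^ m + c y ^ m; it is multiplicative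
   on H when c ^ 2 = (-1) ^ m. *)
Definition chi c g : C := g ord0 ord0 ^+ m + c * g ord0 ord_max ^+ m.

Lemma chi_dg c s t : chi c (dg s t) = s ^+ m.
Proof.
rewrite /chi !mxE /= expr0n.
have -> : (m == 0)%N = false by lia.
by rewrite mulr0n mulr0 addr0.
Qed.
Lemma chi_ad c s t : chi c (ad s t) = c * s ^+ m.
Proof.
rewrite /chi !mxE /= expr0n.
have -> : (m == 0)%N = false by lia.
by rewrite mulr0n add0r.
Qed.

Lemma chi1 c : chi c 1%:M = 1. Proof. by rewrite -dg1 chi_dg expr1n. Qed.

Lemma H_form g : H R m g -> exists2 s : C, s ^+ N = 1 & g = hs s \/ g = ht s.
Proof.
move=> /(H_cases hm)[k _ e]; exists (z ^+ k) => //.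
by rewrite -exprM zetaXN.
Qed.

Lemma chiM c g h : c * c = (-1) ^+ m -> H R m g -> H R m h ->
  chi c (g *m h) = chi c g * chi c h.
Proof.
move=> cc /H_form[s s1 eg] /H_form[t t1 eh].
case: eg => ->; case: eh => ->; rewrite /hs ?htE_ad ?(dgM, adM, dgadM, addgM, chi_dg, chi_ad).
- by rewrite exprMn.
- by rewrite exprMn mulrCA.
- by rewrite exprMn (unity_inv_m hm) // mulrA.
- by rewrite !exprMn (unity_inv_m hm) // -cc; ring.
Qed.

Definition chi_rep c (cc : c * c = (-1) ^+ m) :=
  char_rep (chi1 c) (fun g h Hg Hh => chiM cc Hg Hh).

Definition triv_rep := char_rep (ch := fun=> 1) erefl (fun _ _ _ _ => esym (mulr1 1)).

(** Change of coordinates along a homomorphism T of representations. *)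
Lemma intertwine n k (A : 'M[C]_n) (B : 'M[C]_k) (T : 'M[C]_(n, k)) (f : 'I_n -> P) j :
  A *m T = T *m B ->
  \sum_i B i j *: (\sum_l T l i *: f l) = \sum_i T i j *: \sum_l A l i *: f l.
Proof.
move=> e; transitivity (\sum_l (T *m B) l j *: f l).
  under eq_bigr => i _ do rewrite scaler_sumr.
  rewrite exchange_big; apply: eq_bigr => l _ /=; rewrite mxE scaler_suml.
  by apply: eq_bigr => i _; rewrite scalerA mulrC.
rewrite -e; under [RHS]eq_bigr => i _ do rewrite scaler_sumr.
rewrite exchange_big; apply: eq_bigr => l _ /=; rewrite mxE scaler_suml.
by apply: eq_bigr => i _; rewrite scalerA mulrC.
Qed.

(** The twist of r by g is isomorphic to s. *)
Definition twist_iso g (r s : rep R m) :=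
  exists (T : 'M[C]_(rep_dim r, rep_dim s)) (T' : 'M[C]_(rep_dim s, rep_dim r)),
  [/\ T *m T' = 1%:M, T' *m T = 1%:M &
     forall h, H R m h -> r (invmx g *m h *m g) *m T = T *m s h].

(** If the f i span a copy of r in V(I), then their images under g span a copy of
   the twist of r by g in V(g I). *)
Lemma E_twist g r s I : G R m g -> twist_iso g r s -> E r I -> E s (gact g I).
Proof.
move=> Gg [T [T' [TT' T'T eT]]] [eI [f [If eqf indf]]].
have gI := exceptional_good hm eI.
split; first exact: (good_exceptional hm (good_gact hm Gg gI)).
have idU : is_ideal (mI (gact g I)) := @mI_ideal _ _ _.
have idJ := good_ideal (good_gact hm Gg gI).
pose F j := \sum_i T i j *: ac g (f i).
exists F; split.
- move=> j; apply: (idl_sum idJ) => i _; apply: (idlZ idJ).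
  by rewrite gactE; exists (f i).
- move=> h Hh j; rewrite -acE.
  pose h' := invmx g *m h *m g.
  have Hh' : H R m h' := HJ hm Gg Hh.
  have ehg : h *m g = g *m h' by rewrite /h' !mulmxA mulmxV ?(G_unit hm Gg) // mul1mx.
  have -> : \sum_i s h i j *: F i = \sum_i T i j *: \sum_l r h' l i *: ac g (f l).
    by apply: intertwine; exact: eT.
  rewrite /F act_sum -sumrB; apply: (idl_sum idU) => i _.
  rewrite actZ -scalerBr; apply: (idlZ idU).
  rewrite -act_mulmx ehg act_mulmx.
  have -> : \sum_l r h' l i *: ac g (f l) = ac g (\sum_l r h' l i *: f l).
    by rewrite act_sum; apply: eq_bigr => l _; rewrite actZ.
  by rewrite -actB; apply: (mI_G hm Gg); rewrite acE; apply: eqf.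
- move=> d hd.
  have : mI I (\sum_i (T *m \col_j d j) i 0 *: f i).
    have := mI_G hm (GV Gg) hd; rewrite (gact_inv hm _ Gg) act_sum.
    under eq_bigr => j _ do rewrite actZ /F act_sum scaler_sumr.
    rewrite exchange_big /=; congr (mI I _); apply: eq_bigr => i _.
    rewrite mxE scaler_suml; apply: eq_bigr => j _.
    rewrite actZ -act_mulmx mulVmx ?(G_unit hm Gg) // act_id scalerA !mxE.
    by rewrite mulrC.
  move=> /indf h.
  have h0 : T *m \col_j d j = 0 by apply/colP => i; rewrite h mxE.
  move=> j; have := congr1 (fun A : 'cV_(rep_dim s) => A j 0) (congr1 (mulmx T') h0).
  by rewrite mulmxA T'T mul1mx mulmx0 !mxE.
Qed.

Lemma twist_iso_inv g r s : G R m g -> twist_iso g r s -> twist_iso (invmx g) s r.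
Proof.
move=> Gg [T [T' [TT' T'T eT]]]; exists T', T; split=> // h Hh.
have ug := G_unit hm Gg.
have Hh' : H R m (invmx (invmx g) *m h *m invmx g) by apply: (HJ hm) => //; exact: GV.
have := eT _ Hh'; rewrite invmxK.
have -> : invmx g *m (g *m h *m invmx g) *m g = h.
  by rewrite !mulmxA mulVmx // mul1mx -mulmxA mulVmx // mulmx1.
move=> e; have := congr1 (fun A => T' *m A *m T') e => /=.
rewrite [T' *m (T *m _)]mulmxA T'T mul1mx => <-.
by rewrite -mulmxA -mulmxA TT' mulmx1.
Qed.

Lemma maps_curve_twist g r s : G R m g -> twist_iso g r s -> maps_curve g (E r) (E s).
Proof.
move=> Gg tw; apply/seteqP; split=> J; first by case=> I EI <-; exact: E_twist EI.
move=> EJ; exists (gact (invmx g) J).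
  exact: (E_twist (GV Gg) (twist_iso_inv Gg tw)).
by have := gact_inv hm J (GV Gg); rewrite invmxK.
Qed.

Lemma rep_iso_sym (r s : rep R m) : rep_iso r s -> rep_iso s r.
Proof.
move=> [T [T' [TT' T'T e]]]; exists T', T; split=> // h Hh.
have := congr1 (fun A => T' *m A *m T') (e h Hh) => /=.
by rewrite mulmxA -mulmxA -mulmxA TT' mulmx1 mulmxA T'T mul1mx.
Qed.

Lemma rep_iso_trans (r s t : rep R m) : rep_iso r s -> rep_iso s t -> rep_iso r t.
Proof.
move=> [T [T' [TT' T'T e]]] [S [S' [SS' S'S e']]].
exists (T *m S), (S' *m T'); split.
- by rewrite -mulmxA [S *m _]mulmxA SS' mul1mx.
- by rewrite -mulmxA [T' *m _]mulmxA T'T mul1mx.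
- by move=> h Hh; rewrite mulmxA e // -mulmxA e' // mulmxA.
Qed.

Lemma E_iso_sub (r s : rep R m) : rep_iso r s -> E r `<=` E s.
Proof.
move=> [T [T' [TT' T'T e]]] I EI.
have gI : good m I by case: EI => /(exceptional_good hm).
rewrite -(gact_H hm (H1 R m) gI); apply: E_twist EI; first exact: G1.
exists T, T'; split=> // h Hh.
by rewrite invmx1 mul1mx mulmx1 e.
Qed.

Lemma E_iso (r s : rep R m) : rep_iso r s -> E r = E s.
Proof.
move=> rs; apply/seteqP; split; apply: E_iso_sub => //; exact: rep_iso_sym.
Qed.

(** The entrywise power of g intertwines, being multiplicative on monomial
   matrices. *)
Lemma twist_V g n : G R m g -> twist_iso g (Vrep n) (Vrep n).
Proof.
move=> Gg; have ug := G_unit hm Gg; have Gv := GV Gg.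
exists (powmx n (invmx g)), (powmx n g); split.
- by rewrite -powmxM ?mulVmx ?powmx1 //; exact: G_monomial.
- by rewrite -powmxM ?mulmxV ?powmx1 //; exact: G_monomial.
- move=> h [Gh _] /=.
  have Ghg := GM Gh Gg.
  rewrite -!powmxM -?mulmxA ?mulmxV ?mulmx1 //; apply: G_monomial => //.
  by apply: GM => //; apply: GM.
Qed.

Lemma twist_char g (ch ch' : 'M[C]_2 -> C) ch1 chM ch1' chM' :
  (forall h, H R m h -> ch (invmx g *m h *m g) = ch' h) ->
  twist_iso g (@char_rep ch ch1 chM) (@char_rep ch' ch1' chM').
Proof.
move=> e; exists 1%:M, 1%:M; split; rewrite ?mulmx1 // => h Hh /=.
by rewrite mulmx1 mul1mx e.
Qed.

Lemma twist_sgn g : G R m g -> twist_iso g sgn_rep sgn_rep.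
Proof.
move=> Gg; apply: twist_char => h [Gh _]; have Gv := GV Gg.
rewrite !sgnM; try exact: G_monomial; last exact: (G_monomial (GM Gv Gh)).
rewrite mulrAC -sgnM; try exact: G_monomial.
by rewrite mulVmx ?(G_unit hm Gg) // sgn1 mul1r.
Qed.

Lemma chi_H c g h : c * c = (-1) ^+ m -> H R m g -> H R m h ->
  chi c (invmx g *m h *m g) = chi c h.
Proof.
move=> cc Hg Hh; have Hv := HV Hg.
rewrite !chiM //; last exact: HM.
rewrite mulrAC -chiM // mulVmx ?chi1 ?mul1r //.
by case: Hg => Gg _; exact: (G_unit hm Gg).
Qed.

Lemma twist_chi_H c (cc : c * c = (-1) ^+ m) g : H R m g ->
  twist_iso g (chi_rep cc) (chi_rep cc).
Proof. by move=> Hg; apply: twist_char => h Hh; exact: chi_H. Qed.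

(** Conjugation by the substitution x |-> - x negates the entry of an antidiagonal
   matrix whose m-th power the character takes. *)
Lemma twist_chi_dl c d (cc : c * c = (-1) ^+ m) (dd : d * d = (-1) ^+ m) g :
  G R m g -> ~ H R m g -> d = (-1) ^+ m * c -> twist_iso g (chi_rep cc) (chi_rep dd).
Proof.
move=> Gg nHg ed; have [//|[h0 Hh0 eg]] := G_cases hm Gg.
apply: twist_char => h Hh.
have udl : dl *m dl = 1%:M := dl_dl R.
have u0 : h0 \in unitmx by case: (Hh0) => G0 _; exact: (G_unit hm G0).
have -> : invmx g = invmx h0 *m dl.
  apply: invmx_eq; rewrite eg -!mulmxA [h0 *m _]mulmxA mulmxV // mul1mx; exact: udl.
rewrite eg; have -> : invmx h0 *m dl *m h *m (dl *m h0) = invmx h0 *m (dl *m h *m dl) *m h0.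
  by move: (dl) (invmx h0) => ? ?; rewrite !mulmxA.
have Hd : H R m (dl *m h *m dl).
  have := HJ hm (@G_dl R m) Hh.
  by rewrite (invmx_eq udl).
rewrite chi_H //; have [s s1 eh] := H_form Hh; case: eh => ->.
  by rewrite !dgM !chi_dg !mulN1r mulrN1 opprK.
rewrite htE_ad dgadM addgM !chi_ad ed mulr1 mulN1r [(- s) ^+ m]exprNn.
by rewrite mulrCA mulrA.
Qed.

Lemma twist_chi_even c (cc : c * c = (-1) ^+ m) g : ~~ odd m -> G R m g ->
  twist_iso g (chi_rep cc) (chi_rep cc).
Proof.
move=> em Gg; case: (pselect (H R m g)) => Hg; first exact: twist_chi_H.
by apply: twist_chi_dl => //; rewrite -signr_odd (negbTE em) expr0 mul1r.
Qed.

End Reps.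

(** * Membership in the curves *)

Section Curves.
Variables (R : realType) (m : nat) (hm : (3 <= m)%N).
Local Notation C := R[i].
Local Notation P := {mpoly C[2]}.
Local Notation N := m.*2.
Local Notation z := (zeta R m).
Local Notation mon := (@mon R).
Local Notation mI := (@mI_n R m).
Local Notation curve_pt := (@curve_pt R m).
Local Notation end_pt := (@end_pt R m).
Implicit Types (f p q u v : P) (I J S : set P) (c : C) (g h : 'M[C]_2).

Definition i_pow : C := 'i%C ^+ (m + 2).

Lemma i_pow_sqr : i_pow * i_pow = (-1) ^+ m.
Proof.
rewrite /i_pow -exprD addnn -mul2n exprM.
rewrite sqr_i.
by rewrite exprD sqrrN expr1n mulr1.
Qed.

Lemma Ni_pow_sqr : (- i_pow) * (- i_pow) = (-1) ^+ m.
Proof. by rewrite mulrNN i_pow_sqr. Qed.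

(** The vertices of the Dynkin diagram, in the order of the labeling. *)
Definition vertex_rep (k : nat) : rep R m :=
  if k == 0%N then triv_rep R m else if k == 1%N then sgn_rep R hm
  else if (k <= m)%N then Vrep R hm (k - 2)
  else if k == m.+1 then chi_rep hm Ni_pow_sqr else chi_rep hm i_pow_sqr.

(** An eigenvector of the diagonal generator modulo m I + n may be replaced by
   its component of that weight. *)
Lemma weight_vector I a f : good m I -> I f -> ~ mI I f ->
  (forall k, mI I (ac (hs (z ^+ k)) f - z ^+ (a * k) *: f)) ->
  exists f', [/\ Wt m a f', I f' & ~ mI I f'].
Proof.
move=> gI If nf h; exists (pr m a f); split; first exact: Wt_pr.
  exact: (good_pr hm gI).
have idU := @mI_ideal R m I.
move=> hp; apply: nf; apply: (idl_cong idU _ hp).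
rewrite -opprB; apply: (idlN idU).
have -> : pr m a f - f =
    N%:R^-1 *: \sum_(k < N) z ^- (a * k) *: (ac (hs (z ^+ k)) f - z ^+ (a * k) *: f).
  have {2}-> : f = N%:R^-1 *: \sum_(k < N) f.
    by rewrite sumr_const card_ord -[f *+ _]scaler_nat scalerA mulVf ?scale1r // (N_neq0 R hm).
  rewrite prE -scalerBr -sumrB; congr (_ *: _); apply: eq_bigr => k _.
  by rewrite scalerBr scalerA mulVf ?scale1r // (zeta_neq0 R hm).
by apply: (idlZ idU); apply: (idl_sum idU) => k _; exact: (idlZ idU).
Qed.

Lemma V_weight n I : E (Vrep R hm n) I ->
  good m I /\ exists f, [/\ Wt m n.+1 f, I f & ~ mI I f].
Proof.
move=> [eI [f [If eqf indf]]]; have gI := exceptional_good hm eI; split=> //.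
have nf : ~ mI I (f ord0).
  move=> h; have := indf (fun j => (j == ord0)%:R).
  rewrite sum2 eqxx scale1r scale0r addr0 => /(_ h ord0); rewrite eqxx => /eqP.
  by rewrite oner_eq0.
apply: (weight_vector gI (If ord0) nf) => k.
have := eqf (hs (z ^+ k)) (H_hs R hm k) ord0.
rewrite -acE sum2 /= powmx_dg !mxE /= scale0r addr0.
by rewrite -exprM mulnC.
Qed.

Lemma char_weight (ch : 'M[C]_2 -> C) ch1 chM a I : E (@char_rep R m ch ch1 chM) I ->
  (forall k, ch (hs (z ^+ k)) = z ^+ (a * k)) ->
  good m I /\ exists f, [/\ Wt m a f, I f & ~ mI I f].
Proof.
move=> [eI [f [If eqf indf]]] hch; have gI := exceptional_good hm eI; split=> //.
have nf : ~ mI I (f ord0).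
  move=> h; have := indf (fun j => 1).
  rewrite big_ord1 scale1r => /(_ h ord0) /eqP.
  by rewrite oner_eq0.
apply: (weight_vector gI (If ord0) nf) => k.
have := eqf (hs (z ^+ k)) (H_hs R hm k) ord0.
by rewrite -acE big_ord1 /= !mxE eqxx mulr1n hch.
Qed.

Lemma curve_fwd k I : (1 <= k <= m)%N -> E (vertex_rep k) I ->
  [/\ good m I, I (mon k.+1 1) & I (mon 0 (N - k).+2)].
Proof.
move=> km EI.
suff [gI [f [wf If nf]]] : good m I /\ exists f, [/\ Wt m k.-1 f, I f & ~ mI I f].
  by have [h1 h2] := gen_curve hm gI km wf If nf.
move: EI; rewrite /vertex_rep.
have -> : (k == 0)%N = false by lia.
case: eqP => [k1 EI|/eqP k1].
  rewrite k1; apply: (char_weight EI) => j.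
  by rewrite sgn_dg mulfV ?mul0n // (zeta_neq0 R hm).
have -> : (k <= m)%N by lia.
move=> /V_weight[gI [f [wf If nf]]]; split=> //; exists f; split=> //.
by have -> : (k.-1 = (k - 2).+1)%N by lia.
Qed.

Lemma end_fwd c (cc : c * c = (-1) ^+ m) I : E (chi_rep hm cc) I ->
  good m I /\ I (mon 0 m.+2).
Proof.
move=> EI.
have [|gI [f [wf If nf]]] := char_weight (a := m) EI.
  by move=> k; rewrite /hs (chi_dg hm) -exprM mulnC.
by split=> //; exact: (gen_end hm gI wf If nf).
Qed.

(** By H_form the action on the two generators only has to be checked for the
   two kinds of elements of H. *)
Lemma E_V n I f0 f1 : good m I -> I f0 -> I f1 ->
  (forall s : C, s ^+ N = 1 -> [/\ ac (hs s) f0 = s ^+ n.+1 *: f0,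
     ac (hs s) f1 = s^-1 ^+ n.+1 *: f1,
     ac (ht s) f0 = (- s^-1) ^+ n.+1 *: f1 & ac (ht s) f1 = s ^+ n.+1 *: f0]) ->
  (forall c0 c1 : C, mI I (c0 *: f0 + c1 *: f1) -> c0 = 0 /\ c1 = 0) ->
  E (Vrep R hm n) I.
Proof.
move=> gI h0 h1 hact hind; split; first exact: good_exceptional.
exists (fun j : 'I_2 => if j == ord0 then f0 else f1); split.
- by move=> j; case: ifP.
- move=> h Hh j; rewrite -acE sum2 eqxx.
  suff -> : ac h (if j == ord0 then f0 else f1) =
      powmx n h ord0 j *: f0 + powmx n h ord_max j *: f1.
    by rewrite subrr; exact: idl0 (@mI_ideal R m I).
  have [s s1 eh] := H_form hm Hh; have [e1 e2 e3 e4] := hact s s1.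
  case: eh => ->; rewrite ?powmx_dg ?powmx_ad !mxE; case: j => [[|[|//]] hj] /=.
  + by rewrite scale0r addr0; exact: e1.
  + by rewrite scale0r add0r; exact: e2.
  + by rewrite scale0r add0r; exact: e3.
  + by rewrite scale0r addr0; exact: e4.
- move=> d; rewrite sum2 eqxx => /hind[d0 d1] j.
  by case: j => [[|[|//]] hj]; [rewrite -[RHS]d0|rewrite -[RHS]d1]; congr d; apply/val_inj.
Qed.

Lemma E_char (ch : 'M[C]_2 -> C) ch1 chM I f : good m I -> I f -> ~ mI I f ->
  (forall h, H R m h -> mI I (ac h f - ch h *: f)) -> E (@char_rep R m ch ch1 chM) I.
Proof.
move=> gI If nf hact; split; first exact: good_exceptional.
exists (fun=> f); split=> //.
- move=> h Hh j; rewrite -acE big_ord1.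
  have -> : j = ord0 by exact: ord1.
  by rewrite /= mxE eqxx mulr1n; exact: hact.
- move=> d; rewrite big_ord1 => h j; rewrite (ord1 j); apply/eqP/negP => /negP d0.
  by apply: nf; exact: (idlZr (@mI_ideal R m I) d0 h).
Qed.

(** The representation of index k is spanned by the minimal generators x ^ k y and
   - x y ^ k; for k = 1 it is the line of x y. *)
Lemma curve_bwd k : (1 <= k <= m)%N -> E (vertex_rep k) (curve_pt k).
Proof.
move=> km; have k0 : (k == 0)%N = false by lia.
have gI : good m (curve_pt k) by apply: curve_pt_good => //; lia.
have idI := good_ideal gI.
rewrite /vertex_rep k0; case: eqP => [k1|/eqP k1].
  subst k; apply: (E_char _ _ gI (f := mon 1 1)).
  - exact: curve_pt_xy.
  - by move=> /(curve_pt_mI_xy hm km)[/eqP]; rewrite cf_mon oner_eq0.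
  - move=> h /(H_monomial hm)[s [t [] ->]];
    by rewrite ?act_dg ?act_ad ?sgn_dg ?sgn_ad !expr1 ?[t * s]mulrC subrr; exact: idl0 (@mI_ideal R m _).
have -> : (k <= m)%N by lia.
have ek : (k - 2).+2 = k by lia.
apply: (E_V gI (f0 := mon k 1) (f1 := - mon 1 k)).
- exact: curve_pt_xy.
- by apply: (idlN idI); exact: curve_pt_yx.
- move=> s s1; have s0 := unity_neq0 hm s1.
  rewrite htE_ad !actN !act_dg !act_ad expr1 !expr1.
  have eS t : t ^+ k = t * t ^+ (k - 2).+1 :> C by rewrite -exprS ek.
  rewrite !eS; split.
  + by rewrite mulrAC mulfV // mul1r.
  + by rewrite mulrA mulfV // mul1r scalerN.
  + rewrite mulN1r scalerN -scaleNr; congr (_ *: _).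
    by rewrite mulrC mulrA mulrN mulfV // mulN1r.
  + rewrite -scaleNr; congr (_ *: _).
    by rewrite mulrA mulfVK // mulN1r opprK.
- move=> c0 c1 h; have := curve_pt_mI_xy hm km h.
  rewrite !cfD !cfZ !cfN !cf_mon !eqxx.
  have -> : (1 == k)%N = false by lia.
  have -> : (k == 1)%N = false by lia.
  rewrite /= !oppr0 !mulr0 addr0 add0r mulr1 mulrN1 => -[-> /eqP].
  by rewrite oppr_eq0 => /eqP.
Qed.

(** In the ideal of index k + 1, the representation of index k is spanned by the
   pure powers y ^ (N - k + 1) and x ^ (N - k + 1), up to sign; for k = 1 it is the line
   of y ^ N. *)
Lemma curve_bwdS k : (1 <= k <= m)%N -> E (vertex_rep k) (curve_pt k.+1).
Proof.
move=> km; have k0 : (k == 0)%N = false by lia.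
have gI : good m (curve_pt k.+1) by apply: curve_pt_good => //; lia.
have idI := good_ideal gI.
have hy := @curve_pt_y R m k.+1; have hx := @curve_pt_x R m k.+1.
rewrite /vertex_rep k0; case: eqP => [k1|/eqP k1].
  subst k; have eN : ((N - 2).+2 = N)%N by lia.
  rewrite eN in hx hy.
  apply: (E_char _ _ gI hy).
  - move=> /(curve_pt_mI_2 hm)[_ _ /eqP]; rewrite !cf_mon !eqxx.
    have -> : (0 == N)%N = false by lia.
    by rewrite /= eq_sym oner_eq0.
  - move=> h /(H_form hm)[s s1 [] ->].
      by rewrite act_dg sgn_dg mulfV ?(unity_neq0 hm s1) // expr0 mul1r exprVn s1 invr1 subrr;
        exact: idl0 (@mI_ideal R m _).
    rewrite htE_ad act_ad sgn_ad mulrCA mulfV ?(unity_neq0 hm s1) // expr0 mul1r s1.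
    rewrite mulN1r scale1r scaleN1r opprK; apply: mI_nn; exact: nn_sum.
have -> : (k <= m)%N by lia.
have ek : (k - 2).+1 = k.-1 by lia.
have eN : (N - k.+1).+2 = (N - k.-1)%N by lia.
rewrite eN in hx hy.
apply: (E_V gI (f0 := mon 0 (N - k.-1)) (f1 := (-1) ^+ k.-1 *: mon (N - k.-1) 0)) => //.
- exact: (idlZ idI).
- move=> s s1; have s0 := unity_neq0 hm s1.
  rewrite ek !actZ htE_ad !act_dg !act_ad !expr0 !mul1r !mulr1 !scalerA.
  have eS : s ^+ (N - k.-1) = s^-1 ^+ k.-1.
    apply: (mulIf (expf_neq0 k.-1 s0)); rewrite -exprD subnK; last by lia.
    by rewrite s1 -exprMn mulVf // expr1n.
  have eV : s^-1 ^+ (N - k.-1) = s ^+ k.-1.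
    by rewrite exprVn eS exprVn invrK.
  split.
  + by rewrite eV.
  + by rewrite eS mulrC.
  + rewrite eS; congr (_ *: _).
    by rewrite -[- s^-1]mulN1r exprMn mulrAC -exprD addnn sqrN1 mul1r.
  + congr (_ *: _); rewrite exprMn eV mulrA -exprD.
    have -> : (k.-1 + (N - k.-1) = m.*2)%N by lia.
    by rewrite sqrN1 mul1r.
- have k3 : (3 <= k.+1 <= m.+1)%N by lia.
  move=> c0 c1 h; have := curve_pt_mI_y hm k3 h.
  rewrite eN !cfD !cfZ !cf_mon !eqxx.
  have -> : (0 == N - k.-1)%N = false by lia.
  have -> : (N - k.-1 == 0)%N = false by lia.
  rewrite /= !mulr0 addr0 add0r !mulr1 => -[/eqP].
  by rewrite mulf_eq0 signr_eq0 orbF => /eqP -> ->.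
Qed.

Lemma chi_eigen c (cc : c * c = (-1) ^+ m) h : H R m h ->
  ac h (mon m 0 + c *: mon 0 m) = chi m c h *: (mon m 0 + c *: mon 0 m).
Proof.
move=> /(H_form hm)[s s1 e].
case: e => ->; rewrite ?htE_ad actD actZ ?act_dg ?act_ad ?(chi_dg hm) ?(chi_ad hm) !expr0 !mul1r !mulr1.
  by rewrite (unity_inv_m hm s1) scalerA mulrC -scalerA -scalerDr.
rewrite exprMn (unity_inv_m hm s1) scalerA scalerDr scalerA addrC -cc.
by congr (_ + _ *: _); ring.
Qed.

Lemma end_bwd c (cc : c * c = (-1) ^+ m) : E (chi_rep hm cc) (end_pt c).
Proof.
have gI := end_pt_good hm cc.
apply: (E_char _ _ gI (@end_pt_mem R m c)).
- move=> /(end_pt_mI hm); rewrite cfD cfZ !cf_mon !eqxx.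
  have -> : (0 == m)%N = false by lia.
  by rewrite /= mulr0 addr0 => /eqP; rewrite oner_eq0.
- by move=> h Hh; rewrite chi_eigen // subrr; exact: idl0 (@mI_ideal R m _).
Qed.

End Curves.

(** * Irreducibility and McKay adjacency *)

Section Identification.
Variables (R : realType) (m : nat) (hm : (3 <= m)%N).
Local Notation C := R[i].
Local Notation P := {mpoly C[2]}.
Local Notation N := m.*2.
Local Notation z := (zeta R m).
Local Notation vertex := (vertex_rep R hm).
Implicit Types (f p q u v : P) (I J S : set P) (c : C) (g h : 'M[C]_2).

Lemma char_irreducible ch ch1 chM : irreducible (@char_rep R m ch ch1 chM).
Proof.
split=> // U _ U0; rewrite /row_full; apply/eqP/anti_leq.
by rewrite rank_leq_row /= lt0n mxrank_eq0.
Qed.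

Definition rv (a b : C) : 'rV[C]_2 := \row_j (if j == ord0 then a else b).

Lemma rv_eta (u : 'rV[C]_2) : u = rv (u 0 ord0) (u 0 ord_max).
Proof.
apply/rowP => j; rewrite mxE; case: ifP => [/eqP -> //|h].
by congr (u _ _); apply/val_inj; case: j h => [[|[|//]] hj].
Qed.

Lemma rv_dg a b s t : rv a b *m (dg s t)^T = rv (a * s) (b * t).
Proof.
by apply/rowP => j; rewrite !mxE sum2 !mxE; case: j => [[|[|//]] hj] /=;
  rewrite ?mulr0 ?addr0 ?add0r.
Qed.

Lemma rv_ad a b s t : rv a b *m (ad s t)^T = rv (b * s) (a * t).
Proof.
by apply/rowP => j; rewrite !mxE sum2 !mxE; case: j => [[|[|//]] hj] /=;
  rewrite ?mulr0 ?addr0 ?add0r.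
Qed.

Lemma rvZ c a b : c *: rv a b = rv (c * a) (c * b).
Proof. by apply/rowP => j; rewrite !mxE; case: ifP. Qed.

Lemma rvD a b a' b' : rv a b + rv a' b' = rv (a + a') (b + b').
Proof. by apply/rowP => j; rewrite !mxE; case: ifP. Qed.

Lemma rv_full n (U : 'M[C]_(n, 2)) : (rv 1 0 <= U)%MS -> (rv 0 1 <= U)%MS -> row_full U.
Proof.
move=> h1 h2; rewrite -sub1mx; apply/row_subP => i.
rewrite [row i _]rv_eta !mxE.
have -> : forall a b, rv a b = a *: rv 1 0 + b *: rv 0 1.
  by move=> a b; rewrite !rvZ rvD !mulr1 !mulr0 addr0 add0r.
by apply: addmx_sub; apply: scalemx_sub.
Qed.

Lemma zeta_sep n : (n.+1 < m)%N -> z ^+ n.+1 != (z ^+ n.+1)^-1.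
Proof.
move=> nm; apply/eqP => e; have : z ^+ (n.+1 + n.+1) == 1.
  by rewrite exprD {2}e mulfV // (zeta_neq0 R hm).
by apply/negP/(zeta_neq1 R hm); lia.
Qed.

(** A nonzero stable subspace contains one of the two coordinate lines, as the
   diagonal generator has distinct eigenvalues, and tau exchanges the two lines. *)
Lemma V_irreducible n : (n.+1 < m)%N -> irreducible (Vrep R hm n).
Proof.
move=> nm; split=> //= U stU U0.
pose w := z ^+ n.+1.
have Hw : H R m (hs z) by have := H_hs R hm 1; rewrite expr1.
have cl (u : 'rV[C]_2) g : H R m g -> (u <= U)%MS -> (u *m (powmx n g)^T <= U)%MS.
  by move=> Hg uU; apply: (submx_trans _ (stU g Hg)); exact: submxMr.
have sw a b : (rv a b <= U)%MS -> (rv (b * 1 ^+ n.+1)%R (a * (-1) ^+ n.+1)%R <= U)%MS.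
  by move=> /(cl _ _ (H_tau R hm)); rewrite powmx_ad rv_ad.
have sep a b : (rv a b <= U)%MS -> (rv ((w^-1 - w) * a)%R 0 <= U)%MS.
  move=> ab; have := cl _ _ Hw ab; rewrite powmx_dg rv_dg exprVn -/w => ab'.
  have := addmx_sub (scalemx_sub w^-1 ab) (scalemx_sub (-1) ab').
  by rewrite !rvZ rvD !mulN1r [b / w]mulrC subrr [a * w]mulrC -mulrBl.
have wn : w^-1 - w != 0 by rewrite subr_eq0 eq_sym zeta_sep.
have e1 a b : a != 0 -> (rv a b <= U)%MS -> (rv 1 0 <= U)%MS.
  move=> a0 /sep h; have := scalemx_sub ((w^-1 - w) * a)^-1 h.
  by rewrite rvZ mulr0 mulVf // mulf_neq0.
have [i Ui] : exists i, row i U != 0.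
  apply/existsP; rewrite -negb_forall; apply/negP => /forallP h; move/negP: U0; apply.
  by apply/eqP/row_matrixP => i; rewrite row0; apply/eqP.
have rU := row_sub i U; rewrite [row i U]rv_eta in Ui rU.
have h1 : (rv 1 0 <= U)%MS.
  have [a0|a0] := eqVneq (row i U 0 ord0) 0; last exact: e1 rU.
  apply: (e1 _ _ _ (sw _ _ rU)); rewrite expr1n mulr1.
  apply: contraNneq Ui => ->; rewrite a0.
  by apply/eqP/rowP => j; rewrite !mxE; case: ifP.
apply: rv_full => //; have := sw _ _ h1; rewrite mul0r mul1r => h.
have := scalemx_sub ((-1) ^+ n.+1) h.
by rewrite rvZ mulr0 -expr2 sqrr_sign.
Qed.

Lemma vertex_irreducible k : (k <= m.+2)%N -> irreducible (vertex k).
Proof.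
move=> km; rewrite /vertex; case: ifP => _; first exact: char_irreducible.
case: ifP => k1; first exact: char_irreducible.
case: ifP => k2; first by apply: V_irreducible; lia.
by case: ifP => _; exact: char_irreducible.
Qed.

Lemma adjacent_iso (r s r' s' : rep R m) : rep_iso r r' -> rep_iso s s' ->
  mckay_adjacent r s -> mckay_adjacent r' s'.
Proof.
move=> [A [A' [AA' A'A eA]]] [B [B' [BB' B'B eB]]] [T [/row_fullP[L LT] eT]].
exists (tensmx A' 1%:M *m T *m B); split.
  apply/row_fullP; exists (B' *m L *m tensmx A 1%:M).
  rewrite -!mulmxA [tensmx A _ *m (_ *m _)]mulmxA tensmx_mul AA' mul1mx.
  have -> : tensmx (1%:M : 'M[C]_(rep_dim r)) (1%:M : 'M[C]_2) = 1%:M.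
    apply/matrixP => k l; case: (mxtens_indexP k) => i a; case: (mxtens_indexP l) => j b.
    by rewrite tensmxE !mxE (can_eq (@mxtens_indexK _ _)) xpair_eqE -natrM mulnb.
  by rewrite mul1mx [L *m _]mulmxA LT mul1mx.
move=> h Hh.
have eA' : r' h *m A' = A' *m r h.
  have := congr1 (fun X => A' *m X *m A') (eA h Hh) => /=.
  by rewrite -!mulmxA AA' mulmx1 [A' *m (A *m _)]mulmxA A'A mul1mx.
rewrite !mulmxA tensmx_mul eA' mulmx1.
have -> : tensmx (A' *m r h) h = tensmx A' 1%:M *m tensmx (r h) h.
  by rewrite tensmx_mul mul1mx.
by rewrite -[_ *m T]mulmxA eT // -!mulmxA eB.
Qed.

(** F is the matrix of the embedding into the tensor product, with rows indexed
   by pairs, and L is a left inverse. *)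
Lemma adjacent_by (r s : rep R m) (F : 'I_(rep_dim r) -> 'I_2 -> 'I_(rep_dim s) -> C)
    (L : 'I_(rep_dim s) -> 'I_(rep_dim r) -> 'I_2 -> C) :
  (forall l j, \sum_i \sum_a L l i a * F i a j = (l == j)%:R) ->
  (forall h, H R m h -> forall i a j,
     \sum_k \sum_b r h i k * h a b * F k b j = \sum_l F i a l * s h l j) ->
  mckay_adjacent r s.
Proof.
have resum (G : 'I_(rep_dim r * 2) -> C) :
    \sum_k G k = \sum_i \sum_a G (mxtens_index (i, a)).
  rewrite pair_big (reindex (@mxtens_index (rep_dim r) 2)) /=.
    by apply: eq_bigr => -[i a] _.
  by exists (@mxtens_unindex (rep_dim r) 2) => k _; rewrite ?mxtens_indexK ?mxtens_unindexK.
pose T : 'M[C]_(rep_dim r * 2, rep_dim s) :=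
  \matrix_(k, j) F (mxtens_unindex k).1 (mxtens_unindex k).2 j.
pose T' : 'M[C]_(rep_dim s, rep_dim r * 2) :=
  \matrix_(l, k) L l (mxtens_unindex k).1 (mxtens_unindex k).2.
move=> hL hF; exists T; split.
  apply/row_fullP; exists T'; apply/matrixP => l j; rewrite !mxE -hL resum.
  by apply: eq_bigr => i _; apply: eq_bigr => a _; rewrite !mxE mxtens_indexK.
move=> h Hh; apply/matrixP => k j; case: (mxtens_indexP k) => i a.
rewrite !mxE resum; under [RHS]eq_bigr => l _ do rewrite !mxE mxtens_indexK.
rewrite -hF //; apply: eq_bigr => k' _; apply: eq_bigr => b _.
by rewrite tensmxE !mxE mxtens_indexK.
Qed.

Lemma monomial_rowcol h i a j : monomial_mx h -> (a == i) = false -> h a j * h i j = 0.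
Proof.
move=> [s [t e]] ne; case: e => ->; rewrite !mxE.
  by case: i a j ne => [[|[|//]] hi] [[|[|//]] ha] [[|[|//]] hj] //= _; rewrite ?mulr0 ?mul0r.
by case: i a j ne => [[|[|//]] hi] [[|[|//]] ha] [[|[|//]] hj] //= _; rewrite ?mulr0 ?mul0r.
Qed.

Lemma adjacent_triv_V : mckay_adjacent (triv_rep R m) (Vrep R hm 0).
Proof.
apply: (@adjacent_by (triv_rep R m) (Vrep R hm 0) (fun _ a j => (a == j)%:R)
  (fun l _ a => (a == l)%:R)) => [l j|h Hh i a j].
- rewrite big_ord1 (bigD1 l) //= eqxx mul1r big1 ?addr0 // => a /negbTE ->.
  by rewrite mul0r.
- rewrite big_ord1 (bigD1 j) //= eqxx mulr1 big1 ?addr0 => [|b /negbTE ->]; last by rewrite mulr0.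
  rewrite (bigD1 a) //= eqxx mul1r big1 ?addr0 => [|b ne]; last first.
    by rewrite eq_sym (negbTE ne) mul0r.
  by rewrite [in RHS]mxE expr1 (ord1 i) mxE eqxx mul1r.
Qed.

(** The embedding is (1, -1) on the coordinates, since sgn takes the value -1 on
   antidiagonal elements of H. *)
Lemma adjacent_sgn_V : mckay_adjacent (sgn_rep R hm) (Vrep R hm 0).
Proof.
pose e (a : 'I_2) : C := if a == ord0 then 1 else -1.
apply: (@adjacent_by (sgn_rep R hm) (Vrep R hm 0) (fun _ a j => (a == j)%:R * e a)
  (fun l _ a => (a == l)%:R * e a)) => [l j|h Hh i a j].
- rewrite big_ord1 sum2 /e /=.
  by case: l j => [[|[|//]] hl] [[|[|//]] hj] /=; rewrite ?(mul0r, mulr0, mul1r, mulr1, addr0, add0r, mulrNN).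
- rewrite big_ord1 !sum2 /= !mxE (ord1 i) eqxx !expr1 /e mulr1n.
  have [s s1 [] ->] := H_form hm Hh; have s0 := unity_neq0 hm s1.
    rewrite sgn_dg mulfV // !mxE.
    by case: a j => [[|[|//]] ha] [[|[|//]] hj] /=; ring.
  rewrite sgn_ad mulrN mulfV // !mxE.
  by case: a j => [[|[|//]] ha] [[|[|//]] hj] /=; ring.
Qed.

(** The vector of index j is sent to the tensor product of the two vectors of
   index j. *)
Lemma adjacent_V_V n : mckay_adjacent (Vrep R hm n) (Vrep R hm n.+1).
Proof.
pose d (i a j : 'I_2) : C := (i == a)%:R * (a == j)%:R.
apply: (@adjacent_by (Vrep R hm n) (Vrep R hm n.+1) d (fun l i a => d i a l)) => [l j|h Hh i a j].
- rewrite /d !sum2 /=.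
  by case: l j => [[|[|//]] hl] [[|[|//]] hj] /=; ring.
- transitivity (h i j ^+ n.+1 * h a j).
    rewrite (bigD1 j) //= (bigD1 j) //= /d eqxx !mulr1 mxE.
    rewrite big1 ?addr0 => [|b /negbTE ->]; last by rewrite !mulr0.
    rewrite big1 ?addr0 // => k /negbTE kj; rewrite big1 // => b _.
    by case: eqP => [<-|]; rewrite ?kj ?mulr0 // mul0r mulr0.
  rewrite (bigD1 i) //= big1 ?addr0 => [|b]; last first.
    rewrite /d; case: (i =P a) => [<-|] ; rewrite ?mul0r ?mul1r // eq_sym => /negbTE ->.
    by rewrite mul0r.
  rewrite /d mxE; have [ea|ne] := eqVneq i a.
    by rewrite !mul1r ea -exprSr.
  rewrite !mul0r exprSr -mulrA [h i j * _]mulrC monomial_rowcol ?mulr0 //.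
    exact: (H_monomial hm).
  by rewrite eq_sym; exact/negbTE.
Qed.

(** This is the decomposition x ^ (m - 1) x + c y ^ (m - 1) y. *)
Lemma adjacent_V_chi c (cc : c * c = (-1) ^+ m) :
  mckay_adjacent (Vrep R hm (m - 2)) (chi_rep hm cc).
Proof.
pose e (a : 'I_2) : C := if a == ord0 then 1 else c.
apply: (@adjacent_by (Vrep R hm (m - 2)) (chi_rep hm cc) (fun i a _ => (i == a)%:R * e a)
  (fun _ i a => (i == ord0)%:R * (a == ord0)%:R)) => [l j|h Hh i a j].
- by rewrite !sum2 /= (ord1 l) (ord1 j) /e /=; ring.
- have em : ((m - 2).+1.+1 = m)%N by lia.
  rewrite big_ord1 !sum2 /= !mxE (ord1 j) eqxx mulr1n /e /=.
  have m0 : (m - 2).+1 != 0%N by lia.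
  have [s s1 eh] := H_form hm Hh; have s0 := unity_neq0 hm s1.
  have eV := unity_inv_m hm s1.
  case: eh => ->; rewrite ?htE_ad ?(chi_dg hm) ?(chi_ad hm) !mxE.
    case: i a => [[|[|//]] hi] [[|[|//]] ha] /=;
      rewrite ?(mul0r, mulr0, mul1r, mulr1, addr0, add0r, expr0n) //= ?(mul0r, mulr0, addr0) //.
    - by rewrite -exprSr em.
    - by rewrite -exprSr em eV mulrC.
  case: i a => [[|[|//]] hi] [[|[|//]] ha] /=;
      rewrite ?(mul0r, mulr0, mul1r, mulr1, addr0, add0r, expr0n) //= ?(mul0r, mulr0, addr0) //.
  - by rewrite -exprSr em mulrC.
  - by rewrite -exprSr em mulN1r exprNn eV -cc mulrA.
Qed.

End Identification.

(** * Comparing representations *)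

Section Labeling.
Variables (R : realType) (m : nat) (hm : (3 <= m)%N).
Local Notation C := R[i].
Local Notation P := {mpoly C[2]}.
Local Notation N := m.*2.
Local Notation z := (zeta R m).
Local Notation mon := (@mon R).
Local Notation cf := (@cf R).
Local Notation nn := (nn R m).
Local Notation i_pow := (i_pow R m).
Local Notation vertex := (vertex_rep R hm).
Implicit Types (f p q u v : P) (I J S : set P) (c : C) (g h : 'M[C]_2).

Lemma iso_dim (r s : rep R m) : rep_iso r s -> rep_dim r = rep_dim s.
Proof.
move=> [T [T' [TT' T'T _]]]; apply/anti_leq.
by rewrite (mulmx1_min TT') (mulmx1_min T'T).
Qed.

Lemma iso_entry (r s : rep R m) : (0 < rep_dim r)%N -> rep_iso r s ->
  exists (T : 'M[C]_(rep_dim r, rep_dim s)) i j,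
    T i j != 0 /\ forall h, H R m h -> r h *m T = T *m s h.
Proof.
move=> d0 [T [T' [TT' T'T e]]]; exists T.
have [T0|[i [j h]]] : T = 0 \/ exists i j, T i j != 0.
- case: (boolP [exists i, exists j, T i j != 0]) => [/existsP[i /existsP[j h]]|].
    by right; exists i, j.
  rewrite negb_exists => /forallP h; left; apply/matrixP => i j.
  have := h i; rewrite negb_exists => /forallP/(_ j); rewrite negbK mxE => /eqP.
  exact.
- have := congr1 (fun A : 'M_(rep_dim r) => A (Ordinal d0) (Ordinal d0)) TT'.
  by rewrite T0 mul0mx !mxE eqxx => /eqP; rewrite eq_sym oner_eq0.
- by exists i, j.
Qed.

Lemma trivial_iso (r : rep R m) : trivial_rep r -> rep_iso (triv_rep R m) r.
Proof.
case: r => d mx mx1 mxM [/= d1 ht]; subst d.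
by exists 1%:M, 1%:M; split; rewrite ?mulmx1 // => h Hh /=; rewrite mulmx1 mul1mx ht.
Qed.

Lemma sgn_not_triv : ~ rep_iso (sgn_rep R hm) (triv_rep R m).
Proof.
move=> e; have [//|T [i [j [Tij /(_ _ (H_tau R hm))]]]] := iso_entry _ e.
move=> /(congr1 (fun A : 'M_1 => A i j)) /=.
rewrite sgn_ad mul1r mulmx1 mul_scalar_mx mxE mulN1r => /eqP.
by rewrite -subr_eq0 -opprD oppr_eq0 -mulr2n mulrn_eq0 (negbTE Tij).
Qed.

(** The eigenvalues of the diagonal generator determine n. *)
Lemma V_iso_inj n l : (n.+1 < m)%N -> (l.+1 < m)%N ->
  rep_iso (Vrep R hm n) (Vrep R hm l) -> n = l.
Proof.
move=> nm lm e; have [//|T [i [j [Tij /(_ _ (H_hs R hm 1))]]]] := iso_entry _ e.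
move=> /(congr1 (fun A : 'M_2 => A i j)) /=; rewrite expr1 !powmx_dg !mxE !sum2 !mxE.
have zV k : (k < m)%N -> z^-1 ^+ k = z ^+ (N - k).
  move=> km; rewrite exprVn; apply: zetaVX => //.
  by rewrite subnKC ?dvdnn //; lia.
have key a b : z ^+ a * T i j = T i j * z ^+ b -> (a = b %[mod N])%N.
  by rewrite mulrC => /(mulfI Tij)/eqP; rewrite (eq_zetaX R hm) => /eqP.
have ei (k : 'I_2) : k = ord0 \/ k = ord_max.
  by case: k => [[|[|//]] hk]; [left|right]; apply/val_inj.
move: key; case: (ei i) (ei j) => -> [] -> /=;
  rewrite ?(mul0r, mulr0, addr0, add0r) ?zV // => key /key; rewrite !modn_small; lia.

Qed.

Lemma vertex_V k : (2 <= k <= m)%N -> vertex k = Vrep R hm (k - 2).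
Proof.
move=> km; rewrite /vertex_rep.
have -> : (k == 0)%N = false by lia.
have -> : (k == 1)%N = false by lia.
by have -> : (k <= m)%N by lia.
Qed.

Lemma vertex_minus : vertex m.+1 = chi_rep hm (Ni_pow_sqr R m).
Proof.
rewrite /vertex_rep eqxx /=.
have -> : (m.+1 == 1)%N = false by lia.
by have -> : (m < m)%N = false by lia.
Qed.

Lemma vertex_plus : vertex m.+2 = chi_rep hm (i_pow_sqr R m).
Proof.
rewrite /vertex_rep /=.
have -> : (m.+2 == m.+1)%N = false by lia.
by have -> : (m.+2 <= m)%N = false by lia.
Qed.

Lemma vertex_dim k : rep_dim (vertex k) = (if 2 <= k <= m then 2 else 1)%N.
Proof.
rewrite /vertex_rep; case: eqP => [->//|k0]; case: eqP => [->//|k1].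
have -> : (2 <= k)%N by lia.
by case: ifP => // _; case: ifP.
Qed.

(** * Submodules of m / n *)
Lemma submodule_min S W : is_subspace W -> H_stable m W -> nn `<=` W -> S `<=` W ->
  submodule R m S `<=` W.
Proof.
by move=> W1 W2 nW SW; apply: smallest_sub => // f []; [exact: nW|exact: SW].
Qed.

Lemma submodule_nn S : nn `<=` submodule R m S.
Proof. by move=> f hf W [_ hW]; apply: hW; left. Qed.

Lemma submodule_sub S : S `<=` submodule R m S.
Proof. by move=> f hf W [_ hW]; apply: hW; right. Qed.

Lemma submodule_subspace S : is_subspace (submodule R m S).
Proof.
split.
- by move=> W [[[h _ _] _] _].
- by move=> f g hf hg W hW; have [[[_ h _] _] _] := hW; apply: h; [exact: hf|exact: hg].
- by move=> a f hf W hW; have [[[_ _ h] _] _] := hW; apply: h; exact: hf.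
Qed.

(** The submodule of C[x, y] / n spanned by q, as a preimage. *)
Definition line q : set P := [set p | exists b : C, nn (p - b *: q)].

Lemma line_mem q : line q q.
Proof. by exists 1; rewrite scale1r subrr; exact: idl0 (nn_ideal R m). Qed.

Lemma line_nn q : nn `<=` line q.
Proof. by move=> p hp; exists 0; rewrite scale0r subr0. Qed.

Lemma line_subspace q : is_subspace (line q).
Proof.
have idn := nn_ideal R m; split; first by apply: line_nn; exact: idl0.
- move=> f g [a ha] [b hb]; exists (a + b).
  by rewrite scalerDl opprD addrACA; exact: (idlD idn ha hb).
- by move=> a f [b hb]; exists (a * b); rewrite -scalerA -scalerBr; exact: (idlZ idn).
Qed.

Lemma submodule_line q (ch : 'M[C]_2 -> C) : (forall h, H R m h -> ac h q = ch h *: q) ->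
  submodule R m [set q] = line q.
Proof.
move=> hq; have idn := nn_ideal R m; apply/seteqP; split.
  apply: submodule_min; [exact: line_subspace| |exact: line_nn|].
    move=> h f Hh [b hb]; exists (b * ch h); rewrite -acE -scalerA -hq // -actZ -actB.
    by apply: (nn_G hm) hb; case: Hh.
  by move=> _ ->; exact: line_mem.
move=> p [b hb]; have [_ D Z] := submodule_subspace [set q].
rewrite -[p](subrK (b *: q)); apply: D; first exact: submodule_nn.
by apply: Z; exact: submodule_sub.
Qed.

Lemma Vdeg_sub i (r s : rep R m) : rep_iso r s -> Vdeg i r `<=` Vdeg i s.
Proof.
move=> [T [T' [TT' T'T eT]]]; have idn := nn_ideal R m.
apply: smallest_sub.
  split.
  - by move=> W [[h _ _] _].
  - by move=> f g hf hg W hW; have [[_ h _] _] := hW; apply: h; [exact: hf|exact: hg].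
  - by move=> a f hf W hW; have [[_ _ h] _] := hW; apply: h; exact: hf.
move=> f [hf|[F [j [hF eF ->]]]]; first by move=> W [_ hW]; apply: hW; left.
pose F' l := \sum_i T i l *: F i.
have -> : F j = \sum_l T' l j *: F' l.
  under eq_bigr => l _ do rewrite scaler_sumr.
  rewrite exchange_big /= (bigD1 j) //=.
  have col k : \sum_l T' l j *: (T k l *: F k) = (k == j)%:R *: F k.
    under eq_bigr => l _ do rewrite scalerA mulrC.
    have := congr1 (fun A : 'M_(rep_dim r) => A k j) TT'; rewrite !mxE => <-.
    by rewrite scaler_suml.
  rewrite col eqxx scale1r big1 ?addr0 // => k /negbTE kj.
  by rewrite col kj scale0r.
move=> W hW; have [[W0 WD WZ] sub] := hW.
elim/big_ind: _ => // l _; apply: WZ; apply: sub; right; exists F', l; split=> //.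
- move=> k; split.
    by apply: (idl_sum (ideal_gen_ideal _)) => i' _; apply: (idlZ (ideal_gen_ideal _)); case: (hF i').
  by apply: rpred_sum => i' _; apply: rpredZ; case: (hF i').
- move=> h Hh k; rewrite -acE.
  have -> : \sum_i0 s h i0 k *: F' i0 = \sum_i0 T i0 k *: \sum_l0 r h l0 i0 *: F l0.
    by apply: intertwine; exact: eT.
  rewrite act_sum -sumrB; apply: (idl_sum idn) => i' _.
  rewrite actZ -scalerBr; apply: (idlZ idn).
  by rewrite acE; exact: eF.
Qed.

Lemma Vdeg_iso i (r s : rep R m) : rep_iso r s -> Vdeg i r = Vdeg i s.
Proof.
by move=> rs; apply/seteqP; split; apply: Vdeg_sub => //; exact: rep_iso_sym.
Qed.

Lemma mon_homog i j : mon i j \is (i + j).-homog.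
Proof.
by rewrite monE dhomogX /= /mnm2 mdegD !mdegMn !mdeg1 !mul1n.
Qed.

Lemma Vdeg_char i ch ch1 chM f : mm f -> f \is i.-homog ->
  (forall h, H R m h -> ac h f = ch h *: f) -> Vdeg i (@char_rep R m ch ch1 chM) f.
Proof.
move=> mf hf ef W [_]; apply; right; exists (fun=> f), ord0; split=> // h Hh j.
rewrite -acE big_ord1 (ord1 j) /= mxE eqxx mulr1n ef // subrr.
exact: idl0 (nn_ideal R m).
Qed.

(** x ^ m + c y ^ m lies in the degree m part attached to its character; the
   coefficients of x ^ m and y ^ m vanish on n, so they determine c. *)
Lemma chi_label c (cc : c * c = (-1) ^+ m) (d : C) (r : rep R m) : d * d = (-1) ^+ m ->
  rep_iso (chi_rep hm cc) r -> Vdeg m r = submodule R m [set mon m 0 + d *: mon 0 m] -> c = d.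
Proof.
move=> dd iso eV; have idm := ideal_gen_ideal (R := R) [set 'X_ord0; 'X_ord_max].
have : Vdeg m r (mon m 0 + c *: mon 0 m).
  rewrite -(Vdeg_iso _ iso); apply: Vdeg_char; last exact: chi_eigen.
    by apply: (idlD idm); [|apply: (idlZ idm)]; apply: mm_mon; lia.
  have hx : mon m 0 \is m.-homog by have := mon_homog m 0; rewrite addn0.
  have hy : mon 0 m \is m.-homog by exact: mon_homog 0 m.
  by apply: rpredD => //; exact: rpredZ.
rewrite eV (submodule_line (chi_eigen hm dd)) => -[b hb].
have m0 : (m == 0)%N = false by lia.
have h1 : cf (mon m 0 + c *: mon 0 m - b *: (mon m 0 + d *: mon 0 m)) m 0 = 0.
  by apply: (nn_rect hm (A := m) (B := 0) _ hb) => //; lia.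
have h2 : cf (mon m 0 + c *: mon 0 m - b *: (mon m 0 + d *: mon 0 m)) 0 m = 0.
  by apply: (nn_rect hm (A := 0) (B := m) _ hb) => //; lia.
move: h1 h2; rewrite !(cfB, cfZ, cfD, cfN, cf_mon) !eqxx [(0 == m)%N]eq_sym m0 /=.
rewrite !mulr0 !addr0 !add0r !mulr1 => /subr0_eq <-.
by rewrite mul1r => /subr0_eq.
Qed.

(** * Identification of the labeling *)
Lemma adjacent_vertex j k : (k <= m.+2)%N -> [|| (j == 0) && (k == 2), (j == 1) && (k == 2),
  [&& 2 <= j, j < m & k == j.+1], (j == m) && (k == m.+1) | (j == m) && (k == m.+2)]%N ->
  mckay_adjacent (vertex j) (vertex k).
Proof.
move=> km; case/or4P => [/andP[/eqP-> /eqP->]|/andP[/eqP-> /eqP->]|/and3P[j2 jm /eqP->]|].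
- by rewrite (@vertex_V 2); [exact: adjacent_triv_V|lia].
- by rewrite (@vertex_V 2); [exact: adjacent_sgn_V|lia].
- rewrite !vertex_V; try lia.
  have -> : (j.+1 - 2 = (j - 2).+1)%N by lia.
  exact: adjacent_V_V.
- case/orP => /andP[/eqP-> /eqP->]; rewrite vertex_V ?vertex_minus ?vertex_plus; try lia;
  exact: adjacent_V_chi.
Qed.

Section Walk.
Variables (rho : nat -> rep R m) (hrho : mckay_labeling rho).
Let iota j k := (k <= m.+2)%N /\ rep_iso (vertex j) (rho k).

Lemma vertex_label j : (j <= m.+2)%N -> exists k, iota j k.
Proof.
move=> jm; case: hrho => -[_ _ /(_ _ (vertex_irreducible R hm jm))[k km iso]] _ _ _ _.
by exists k.
Qed.

Lemma label_edge i j i' j' : iota i i' -> iota j j' ->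
  mckay_adjacent (vertex i) (vertex j) -> dynkin_edge m i' j'.
Proof.
move=> [i'm ii] [j'm jj] adj; case: hrho => _ _ /(_ _ _ i'm j'm)[h _] _ _.
by apply: h; exact: adjacent_iso ii jj adj.
Qed.

Lemma label_inj i j k : iota i k -> iota j k -> rep_iso (vertex i) (vertex j).
Proof. by move=> [_ ii] [_ jj]; exact: (rep_iso_trans ii (rep_iso_sym jj)). Qed.

Lemma label_dim i j k : iota i k -> iota j k -> (2 <= i <= m)%N = (2 <= j <= m)%N.
Proof.
by move=> ii jj; have := iso_dim (label_inj ii jj); rewrite !vertex_dim; case: ifP; case: ifP.
Qed.

Lemma label_0 : iota 0 0.
Proof. by split=> //; apply: trivial_iso; case: hrho. Qed.

(** The trivial vertex has a single neighbor. *)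
Lemma label_2 : iota 2 2.
Proof.
have [k ik] := vertex_label (j := 2) isT.
have h : dynkin_edge m 0 k by apply: (label_edge label_0 ik); exact: adjacent_vertex.
have ek : k = 2%N by move: h; rewrite /dynkin_edge /dynkin_arrow; lia.
by rewrite ek in ik.
Qed.

(** The dimension and the eigenvalues of the diagonal generator tell i and j apart. *)
Lemma label_not_V i j k : (2 <= i <= m)%N -> iota i k -> iota j k -> (j <> i)%N -> False.
Proof.
move=> im ii jj ne; have jm : (2 <= j <= m)%N by rewrite -(label_dim ii jj).
have := label_inj ii jj; rewrite !vertex_V // => /V_iso_inj h.
by have : (i - 2 = j - 2)%N; [apply: h|]; lia.
Qed.

(** The candidates are the neighbors 0, 1 and 3 of 2. The index 0 has the wrong
   dimension, and 1 has no neighbor but 2, so that it leaves no room for the next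
   vertex. *)
Lemma label_3 : iota 3 3.
Proof.
have [k ik] := vertex_label (j := 3) ltac:(lia); have [l il] := vertex_label (j := 4) ltac:(lia).
have e23 : dynkin_edge m 2 k.
  by apply: (label_edge label_2 ik); apply: adjacent_vertex => //; lia.
have e34 : dynkin_edge m k l.
  by apply: (label_edge ik il); apply: adjacent_vertex; lia.
have k0 : k <> 0 by move=> e; rewrite e in ik; have := label_dim ik label_0; lia.
have l2 : l <> 2.
  by move=> e; rewrite e in il; apply: (label_not_V _ label_2 il) => //; lia.
move: e23 e34; rewrite /dynkin_edge /dynkin_arrow => e23 e34.
have ek : k = 3%N by lia.
by rewrite ek in ik.
Qed.

Lemma label_1 : iota 1 1.
Proof.
have [k ik] := vertex_label (j := 1) isT.
have e : dynkin_edge m k 2.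
  by apply: (label_edge ik label_2); apply: adjacent_vertex.
have k3 : k <> 3.
  by move=> ek; rewrite ek in ik; apply: (label_not_V _ label_3 ik).
have k0 : k <> 0.
  by move=> ek; rewrite ek in ik; apply: sgn_not_triv; exact: (label_inj ik label_0).
move: e; rewrite /dynkin_edge /dynkin_arrow => e.
have ek : k = 1%N by lia.
by rewrite ek in ik.
Qed.

(** Walking along the chain, the next vertex is one of two neighbors, and the
   other one is already taken. *)
Lemma label_V k : (3 <= k <= m)%N -> iota k.-1 k.-1 /\ iota k k.
Proof.
elim: k => [//|k ih] km; have [e|k3] := eqVneq k 2%N.
  by rewrite e; split; [exact: label_2|exact: label_3].
have [h1 h2] := ih ltac:(lia); split=> //.
have [l il] := vertex_label (j := k.+1) ltac:(lia).
have e : dynkin_edge m k l.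
  by apply: (label_edge h2 il); apply: adjacent_vertex; lia.
have lk : l <> k.-1.
  by move=> ek; rewrite ek in il; apply: (label_not_V _ h1 il); lia.
move: e; rewrite /dynkin_edge /dynkin_arrow => e.
have ek : l = k.+1 by lia.
by rewrite ek in il.
Qed.

Lemma label_end k : (m < k <= m.+2)%N -> iota k m.+1 \/ iota k m.+2.
Proof.
move=> km; have [l il] := vertex_label (j := k) ltac:(lia).
have [h1 h2] := label_V (k := m) ltac:(lia).
have e : dynkin_edge m m l.
  by apply: (label_edge h2 il); apply: adjacent_vertex; lia.
have lk : l <> m.-1.
  by move=> ek; rewrite ek in il; apply: (label_not_V _ h1 il); lia.
move: e; rewrite /dynkin_edge /dynkin_arrow => e.
have [<-|<-] : l = m.+1 \/ l = m.+2 by lia.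
  by left.
by right.
Qed.

Lemma poly_minusE : poly_minus R m = mon m 0 + (- i_pow) *: mon 0 m.
Proof. by rewrite monx0 mon0y scaleNr. Qed.

Lemma poly_plusE : poly_plus R m = mon m 0 + i_pow *: mon 0 m.
Proof. by rewrite monx0 mon0y. Qed.

Lemma i_pow_neqN : i_pow <> - i_pow.
Proof.
move=> /eqP; rewrite -addr_eq0 -mulr2n mulrn_eq0 /= => /eqP h.
have := i_pow_sqr R m; rewrite h mul0r => /esym/eqP.
by rewrite signr_eq0.
Qed.

(** The walk along the diagram determines all vertices but the last two, which
   the prescribed spaces of degree m tell apart. *)
Lemma label k : (k <= m.+2)%N -> rep_iso (vertex k) (rho k).
Proof.
move=> km; have [k2|k2] := leqP k 2.
  case: k k2 {km} => [_|[_|[_|//]]].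
  - by case: label_0.
  - by case: label_1.
  - by case: label_2.
have [k3|k3] := leqP k m.
  by have [_ []] := label_V (k := k) ltac:(lia).
have [_ _ _ eM eP] := hrho; rewrite poly_minusE in eM; rewrite poly_plusE in eP.
have [ek|ek] : k = m.+1 \/ k = m.+2 by lia.
- case: (label_end (k := k) ltac:(lia)) => -[_]; rewrite ek //.
  rewrite vertex_minus => iso; case: i_pow_neqN.
  exact: esym (chi_label (i_pow_sqr R m) iso eP).
- case: (label_end (k := k) ltac:(lia)) => -[_]; rewrite ek //.
  rewrite vertex_plus => iso; case: i_pow_neqN.
  exact: chi_label (Ni_pow_sqr R m) iso eM.
Qed.

Lemma E_label k : (k <= m.+2)%N -> E (rho k) = E (vertex k).
Proof. by move=> /label/rep_iso_sym/(E_iso hm). Qed.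

End Walk.
End Labeling.

(** * Intersections of curves *)

Section Points.
Variables (R : realType) (m : nat) (hm : (3 <= m)%N).
Local Notation C := R[i].
Local Notation P := {mpoly C[2]}.
Local Notation N := m.*2.
Local Notation z := (zeta R m).
Local Notation mon := (@mon R).
Local Notation cf := (@cf R).
Local Notation tau := (tau R).
Local Notation dl := (dl R).
Local Notation nn := (nn R m).
Local Notation curve_pt := (@curve_pt R m).
Local Notation end_pt := (@end_pt R m).
Local Notation vertex := (vertex_rep R hm).
Implicit Types (f p q u v : P) (I J S : set P) (c : C) (g h : 'M[C]_2).

(** The submodule lies between its generators and I, and these generate I over n. *)
Lemma point_given_eq S I : is_ideal I -> H_stable m I -> nn `<=` I -> S `<=` I ->
  I `<=` ideal_gen (nn `|` S) -> point_given_by (submodule R m S) = I.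
Proof.
move=> idI HI nI SI IS; apply/seteqP; split.
  apply: (ideal_gen_min idI); apply: submodule_min => //.
  by split; [exact: idl0|move=> f g; exact: idlD|move=> a f; exact: idlZ].
move=> f /IS; apply: (ideal_gen_min (ideal_gen_ideal _)) => {}f [hf|hf];
  apply: ideal_gen_sub; [exact: submodule_nn|exact: submodule_sub].
Qed.

Lemma homog_cf d f i j : f \is d.-homog -> (i + j != d)%N -> cf f i j = 0.
Proof.
move=> hf ne; rewrite cf_def; apply: (dhomog_nemf_coeff hf).
by rewrite /= /mnm2 mdegD !mdegMn !mdeg1 !mul1n.
Qed.

Lemma homog2 f : f \is 2.-homog ->
  f = cf f 2 0 *: mon 2 0 + cf f 1 1 *: mon 1 1 + cf f 0 2 *: mon 0 2.
Proof.
move=> hf; apply: eq_cf => i j; rewrite !cfD !cfZ !cf_mon.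
case: (boolP (i + j == 2)%N) => [|ne]; last first.
  rewrite (homog_cf hf ne).
  have -> : ((2 == i) && (0 == j) = false)%N by lia.
  have -> : ((1 == i) && (1 == j) = false)%N by lia.
  have -> : ((0 == i) && (2 == j) = false)%N by lia.
  by rewrite !mulr0 !addr0.
case: i j => [|[|[|i]]] [|[|[|j]]] //= _; by rewrite ?mulr0 ?mulr1 ?addr0 ?add0r.
Qed.

Lemma sgn_eigen h : H R m h -> ac h (mon 1 1) = sgn h *: mon 1 1.
Proof.
move=> /(H_monomial hm)[s [t [] ->]]; rewrite ?act_dg ?act_ad ?sgn_dg ?sgn_ad !expr1 //.
by rewrite mulrC.
Qed.

(** Modulo n, the diagonal generator acts on x ^ 2 and y ^ 2 with eigenvalues
   different from 1, so only x y is left in degree two. *)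
Lemma Vdeg_sgn : Vdeg 2 (sgn_rep R hm) = submodule R m [set mon 1 1].
Proof.
have idn := nn_ideal R m.
have Ssub := @submodule_subspace R m [set mon 1 1 : P]; have [_ _ SZ] := Ssub.
apply/seteqP; split; last first.
  rewrite (submodule_line hm sgn_eigen) => p [b hb] W [[W0 WD WZ] sub].
  rewrite -(subrK (b *: mon 1 1) p); apply: WD; first by apply: sub; left.
  apply: WZ; apply: sub; right; exists (fun=> mon 1 1), ord0; split=> //.
    by move=> k; split; [exact: mm_mon|exact: mon_homog 1 1].
  move=> h Hh k; rewrite -acE big_ord1 (ord1 k) /= mxE eqxx mulr1n sgn_eigen // subrr.
  exact: idl0.
apply: smallest_sub => // f [|[F [j [hF eF ->]]]]; first exact: submodule_nn.
have {j}-> : j = ord0 by exact: ord1.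
set f0 := F ord0; have [_ /homog2 ef0] : mm f0 /\ f0 \is 2.-homog := hF ord0.
have := eF _ (H_hs R hm 1) ord0.
rewrite -acE big_ord1 /= mxE eqxx mulr1n sgn_dg mulfV ?(zeta_neq0 R hm) //.
rewrite scale1r expr1 -/f0 => hn.
have z2 : z ^+ 2 - 1 != 0 by rewrite subr_eq0; apply: (zeta_neq1 R hm); lia.
have v2 : z^-1 ^+ 2 - 1 != 0.
  rewrite subr_eq0 exprVn -invr1 (inj_eq invr_inj) -subr_eq0; exact: z2.
have c20 : cf f0 2 0 = 0.
  have : cf (ac (hs z) f0 - f0) 2 0 = 0.
    by apply: (nn_rect hm (A := 2) (B := 0) _ hn) => //; lia.
  rewrite cfB cf_dg expr0 mulr1 -{2}[cf f0 2 0]mul1r -mulrBl => /eqP.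
  by rewrite mulf_eq0 (negbTE z2) => /eqP.
have c02 : cf f0 0 2 = 0.
  have : cf (ac (hs z) f0 - f0) 0 2 = 0.
    by apply: (nn_rect hm (A := 0) (B := 2) _ hn) => //; lia.
  rewrite cfB cf_dg expr0 mul1r -{2}[cf f0 0 2]mul1r -mulrBl => /eqP.
  by rewrite mulf_eq0 (negbTE v2) => /eqP.
rewrite ef0 c20 c02 !scale0r addr0 add0r; apply: SZ; exact: submodule_sub.
Qed.

Lemma fixedP I : fixed_exceptional R m I <-> good m I /\ forall f, I f -> I (ac dl f).
Proof.
split=> [[/(exceptional_good hm) gI /(A_fixedP hm gI)] //|[gI /(A_fixedP hm gI)]].
by split=> //; exact: good_exceptional.
Qed.

Lemma curve_pt_fixed k : (1 <= k <= m.+1)%N -> fixed_exceptional R m (curve_pt k).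
Proof.
move=> km; apply/fixedP; split; first exact: curve_pt_good.
by move=> f; exact: (@curve_pt_dl R m hm).
Qed.

Lemma curve_pt_neq k : (1 <= k <= m)%N -> curve_pt k <> curve_pt k.+1.
Proof.
move=> km e; have gI : good m (curve_pt k) by apply: curve_pt_good => //; lia.
apply: (line_proper hm gI km (@curve_pt_xy R m k)).
have -> : ((N - k).+1 = (N - k.+1).+2)%N by lia.
by rewrite e; exact: curve_pt_y.
Qed.

(** The two fixed coordinates in the pencil of index k are those of the ideals of
   index k and k + 1. *)
Lemma curve_fixed k : odd k -> (1 <= k <= m)%N ->
  E (vertex k) `&` fixed_exceptional R m = [set curve_pt k; curve_pt k.+1].
Proof.
move=> ok km; apply/seteqP; split=> [I [EI /fixedP[gI fI]]|I].
  have [_ hxy hy] := curve_fwd km EI.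
  have [h|h] := odd_fixed hm ok km gI fI.
    by left; apply: (curve_pt_eq hm) => //; lia.
  right; apply: (curve_pt_eq hm) => //; first by lia.
  by have -> : ((N - k.+1).+2 = (N - k).+1)%N by lia.
case=> ->; split; try by apply: curve_pt_fixed; lia.
  exact: curve_bwd.
exact: curve_bwdS.
Qed.

(** The curve of index k provides x ^ (k + 1) y and that of index j the pure power of
   y; they divide the monomials that generate the ideals of index k + 1 and j. *)
Lemma curve_meet k j I : (1 <= k)%N -> (k < j <= m)%N ->
  E (vertex k) I -> E (vertex j) I -> I = curve_pt k.+1 /\ I = curve_pt j.
Proof.
move=> k1 kj Ek Ej.
have km : (1 <= k <= m)%N by lia.
have jm : (1 <= j <= m)%N by lia.
have [gI hk1 hk2] := curve_fwd km Ek; have [_ hj1 hj2] := curve_fwd jm Ej; have id := good_ideal gI.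
split; apply: (curve_pt_eq hm) => //; try lia.
  by apply: (idl_mon id hj2); lia.
by apply: (idl_mon id hk1); lia.
Qed.

(** The monomial y ^ (m + 2) divides the pure power needed for the ideal of
   index k + 1. *)
Lemma curve_meet_end k c (cc : c * c = (-1) ^+ m) I : (1 <= k < m)%N ->
  E (vertex k) I -> E (chi_rep hm cc) I -> I = curve_pt k.+1.
Proof.
move=> km Ek Ec; have km' : (1 <= k <= m)%N by lia.
have [gI hk1 _] := curve_fwd km' Ek.
have [_ hc] := end_fwd Ec; have id := good_ideal gI.
by apply: (curve_pt_eq hm) => //; [lia|apply: (idl_mon id hc); lia].
Qed.

Lemma curve_meet_next k : (1 <= k < m)%N ->
  E (vertex k) `&` E (vertex k.+1) = [set curve_pt k.+1].
Proof.
move=> km; apply/seteqP; split=> [I [Ek Ek1]|I ->].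
  by case: (@curve_meet k k.+1 I _ _ Ek Ek1) => //; lia.
by split; [apply: curve_bwdS|apply: curve_bwd]; lia.
Qed.

(** * Isolated fixed points *)
Lemma isolated_good I q : fixed_exceptional R m I -> ~ I q ->
  (forall J, good m J -> (forall f, J f -> J (ac dl f)) -> ~ J q -> J = I) ->
  isolated_fixed_point R m I.
Proof.
move=> fI nq uniq; have /fixedP[gI _] := fI; have [B hB] := good_basis hm gI.
apply: (isolated_by (good_ideal gI) hB nq fI) => J /fixedP[gJ fJ]; exact: uniq.
Qed.

(** A fixed ideal other than this one contains y ^ N. *)
Lemma isolated_first : isolated_fixed_point R m (curve_pt 1).
Proof.
have g1 : good m (curve_pt 1) by apply: curve_pt_good => //; lia.
have k1 : (1 <= 1 <= m)%N by lia.
have eN : ((N - 1).+1 = N)%N by lia.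
apply: (@isolated_good _ (mon 0 N)).
- by apply: curve_pt_fixed; lia.
- by move=> h; apply: (line_proper hm g1 k1 (@curve_pt_xy R m 1)); rewrite eN.
- move=> J gJ fJ nJ; have id := good_ideal gJ.
  have [h|] := odd_fixed hm (k := 1) isT k1 gJ fJ; last by rewrite eN.
  apply: (curve_pt_eq hm) => //.
  have -> : ((N - 1).+2 = N.+1)%N by lia.
  apply: (idlDl id _ (good_nn gJ (nn_yN1 hm))).
  by apply: (idl_mon id h); lia.
Qed.

(** For odd m, a fixed ideal other than this one contains x ^ m y. *)
Lemma isolated_last : odd m -> isolated_fixed_point R m (curve_pt m.+1).
Proof.
move=> om; have gm : good m (curve_pt m.+1) by apply: curve_pt_good => //; lia.
have km : (1 <= m <= m)%N by lia.
have eN : ((N - m).+1 = (N - m.+1).+2)%N by lia.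
apply: (@isolated_good _ (mon m 1)).
- by apply: curve_pt_fixed; lia.
- by move=> h; apply: (line_proper hm gm km h); rewrite eN; exact: curve_pt_y.
- move=> J gJ fJ nJ; have id := good_ideal gJ.
  have [//|h] := odd_fixed hm om km gJ fJ.
  apply: (curve_pt_eq hm) => //; [by lia| |by rewrite -eN].
  by apply: (idl_mon id (good_flip hm gJ h)); lia.
Qed.

(** Let e = x ^ m + c y ^ m, e' = x ^ m - c y ^ m and q = x y e'. For even m these
   elements of weight m are eigenvectors of tau, with eigenvalues c, - c, c, and of
   x |-> - x, with eigenvalues 1, 1, -1. A fixed ideal J contains a combination of the
   three, hence one of them. As e' in J implies q in J, an ideal J without q contains
   e, which determines it. *)
Lemma isolated_end c : ~~ odd m -> c * c = (-1) ^+ m -> isolated_fixed_point R m (end_pt c).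
Proof.
move=> em cc; have gc := end_pt_good hm cc.
have s1 : (-1) ^+ m = 1 :> C by rewrite -signr_odd (negbTE em).
have s1S : (-1) ^+ m.+1 = -1 :> C by rewrite exprS s1 mulr1.
have c0 : c != 0 by exact: (end_c_neq0 cc).
have c21 : c * c = 1 by rewrite cc.
apply: (@isolated_good _ (mon m.+1 1 - c *: mon 1 m.+1)).
- by apply/fixedP; split=> // f; exact: (@end_pt_dl R m hm).
- move=> /(end_pt_balanced hm)[_ _ /(_ 1%N 1%N isT isT)].
  rewrite !addn1 !cfB !cfZ !cf_mon !eqxx.
  have -> : (m.+1 == 1)%N = false by lia.
  have -> : (1 == m.+1)%N = false by lia.
  rewrite /= !mulr0 subr0 sub0r !mulr1 => /eqP.
  by rewrite eq_sym -addr_eq0 -mulr2n mulrn_eq0 (negbTE c0).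
- move=> J gJ fJ nJ; have id := good_ideal gJ.
  set q := mon m.+1 1 - _ in nJ.
  pose e := mon m 0 + c *: mon 0 m; pose e' := mon m 0 - c *: mon 0 m.
  have w1 : Wt m m (mon m 0) by apply: Wt_mon; rewrite addn0.
  have w2 : Wt m m (mon 0 m) by apply: Wt_mon; rewrite addnn modnn mod0n.
  have w3 : Wt m m (mon m.+1 1) by apply: Wt_mon; rewrite addn1.
  have w4 : Wt m m (mon 1 m.+1) by apply: Wt_mon; rewrite addnS addnn -(addn1 N) modnDl.
  have mN : (m < N)%N by lia.
  have we : Wt m m e by apply: WtD => //; exact: WtZ.
  have we' : Wt m m e' by apply: WtD => //; apply: WtN; exact: WtZ.
  have wq : Wt m m q by apply: WtD => //; apply: WtN; exact: WtZ.
  have [c1 [c2 [c3 [nz h]]]] := weight_le2 hm gJ mN we we' wq.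
  have te : ac tau e = c *: e.
    by rewrite actD actZ !tau_mon expr0 s1 !scale1r scalerDr scalerA c21 scale1r addrC.
  have te' : ac tau e' = - (c *: e').
    by rewrite actB actZ !tau_mon expr0 s1 !scale1r scalerBr scalerA c21 scale1r opprB.
  have tq : ac tau q = c *: q.
    rewrite actB actZ !tau_mon expr1 s1S !scaleN1r scalerN scalerBr scalerA c21 scale1r.
    by rewrite opprK addrC.
  have de : ac dl e = e by rewrite actD actZ !dl_mon expr0 s1 !scale1r.
  have dq : ac dl q = - q.
    by rewrite actB actZ !dl_mon expr1 s1S !scaleN1r scalerN opprB opprK addrC.
  have eqe' : mon 1 1 * e' = q.
    by rewrite mulrBr -scalerAr !mul_mon !addn0 !add1n.
  have Je : J e -> J = end_pt c by exact: end_pt_eq.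
  clearbody e e' q.
  have ht : J ((c1 *: e + c3 *: q) - c2 *: e').
    apply: (idlZr id c0); have := good_tau hm gJ h.
    rewrite !actD !actZ te te' tq !scalerN !scalerA ![_ * c]mulrC -!scalerA.
    by rewrite addrAC -scalerN -!scalerDr.
  have [h13 h2] := idl_half id (p := c1 *: e + c3 *: q) (q := c2 *: e') ltac:(by rewrite addrAC) ht.
  have hd := fJ _ h13; rewrite actD !actZ de dq scalerN in hd.
  have [h1 h3] := idl_half id h13 hd.
  have c30 : c3 = 0 by apply/eqP/negP => /negP n; apply: nJ; exact: (idlZr id n).
  apply: Je; apply: (idlZr id _ h1); apply/negP => c10.
  have c2n : c2 != 0 by move: nz; rewrite c10 c30 eqxx andbT.
  by apply: nJ; rewrite -eqe'; exact: idlM id _ _ (idlZr id c2n h2).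
Qed.

End Points.

(** * Identification of the points and the theorem *)

Section Main.
Variables (R : realType) (m : nat) (hm : (3 <= m)%N).
Variables (rho : nat -> rep R m) (hrho : mckay_labeling rho).
Local Notation C := R[i].
Local Notation P := {mpoly C[2]}.
Local Notation N := m.*2.
Local Notation mon := (@mon R).
Local Notation nn := (nn R m).
Local Notation curve_pt := (@curve_pt R m).
Local Notation end_pt := (@end_pt R m).
Local Notation vertex := (vertex_rep R hm).
Implicit Types (f p q u v : P) (I J S : set P) (c : C) (g h : 'M[C]_2).

Lemma E_curve k : (k <= m.+2)%N -> E (rho k) = E (vertex k).
Proof. exact: E_label. Qed.

Lemma E_minus : E (rho m.+1) = E (chi_rep hm (Ni_pow_sqr R m)).
Proof. by rewrite E_curve ?vertex_minus. Qed.

Lemma E_plus : E (rho m.+2) = E (chi_rep hm (i_pow_sqr R m)).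
Proof. by rewrite E_curve ?vertex_plus. Qed.

Lemma maps_curve_vertex g k : G R m g -> (1 <= k <= m)%N ->
  maps_curve g (E (rho k)) (E (rho k)).
Proof.
move=> Gg km; rewrite E_curve; last by lia.
have [->|k1] := eqVneq k 1%N; apply: (maps_curve_twist hm Gg).
  exact: twist_sgn.
by rewrite vertex_V; [exact: twist_V|lia].
Qed.

(** A point that the k-th curve shares with a curve of lower or higher index is
   the ideal of index k or k + 1, whether or not such a point exists; the neighbors
   k - 1 and k + 1 do contain these points. *)
Lemma curve_adjacent k : (2 <= k < m)%N ->
  [set I | E (rho k) I /\ exists j, adjacent_curves rho k j /\ E (rho j) I] =
  [set curve_pt k; curve_pt k.+1].
Proof.
move=> km; have km' : (1 <= k < m)%N by lia.
have k1 : (1 <= k.-1 < m)%N by lia.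
have kS : k.-1.+1 = k by lia.
have e1 := curve_meet_next R hm k1; rewrite kS in e1.
have e2 := curve_meet_next R hm km'.
apply/seteqP; split=> [I [EI [j [[jm jk _] Ej]]]|I].
  rewrite E_curve in EI; last by lia.
  have [jlt|jge] := ltnP m j.
    right; have [ej|ej] : j = m.+1 \/ j = m.+2 by lia.
      by move: Ej; rewrite ej E_minus => /(curve_meet_end km' EI).
    by move: Ej; rewrite ej E_plus => /(curve_meet_end km' EI).
  rewrite E_curve in Ej; last by lia.
  have [jltk|jgek] := ltnP j k.
    left; have j1 : (1 <= j)%N by lia.
    have jkm : (j < k <= m)%N by lia.
    by case: (curve_meet j1 jkm Ej EI).
  right; have j1 : (1 <= k)%N by lia.
  have jkm : (k < j <= m)%N by lia.
  by case: (curve_meet j1 jkm EI Ej).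
have h1 : (E (vertex k.-1) `&` E (vertex k)) (curve_pt k) by rewrite e1.
have h2 : (E (vertex k) `&` E (vertex k.+1)) (curve_pt k.+1) by rewrite e2.
case: h1 h2 => h1 h1' [h2 h2'].
case=> ->; split; rewrite ?E_curve //; try lia.
- exists k.-1; split; last by rewrite E_curve //; lia.
  split; [lia|lia|exists (curve_pt k)].
  by rewrite !E_curve; try lia.
- exists k.+1; split; last by rewrite E_curve //; lia.
  split; [lia|lia|exists (curve_pt k.+1)].
  by rewrite !E_curve; try lia.
Qed.

Lemma point_first : point_given_by (Vdeg 2 (rho 1)) = curve_pt 1.
Proof.
rewrite -(Vdeg_iso 2 (label hm hrho (k := 1) isT)) (Vdeg_sgn R hm).
have idK := ideal_gen_ideal (nn `|` [set mon 1 1 : P]).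
have K1 : ideal_gen (nn `|` [set mon 1 1 : P]) (mon 1 1) by apply: ideal_gen_sub; right.
have eN : ((N - 1).+2 = N.+1)%N by lia.
apply: point_given_eq; first exact: curve_pt_ideal.
- exact: curve_pt_stable.
- exact: curve_pt_nn.
- by move=> _ ->; exact: curve_pt_xy.
- apply: (ideal_gen_min idK) => f [hf|]; first by apply: ideal_gen_sub; left.
  case=> -> //; rewrite eN.
    apply: (idlDl idK _ (ideal_gen_sub (or_introl (nn_xN1 hm)))).
    by apply: (idl_mon idK K1); lia.
  apply: (idlDl idK _ (ideal_gen_sub (or_introl (nn_yN1 hm)))).
  by apply: (idl_mon idK K1); lia.
Qed.

Lemma point_last : point_given_by (V'_m1 R m) = curve_pt m.+1.
Proof.
set S : set P := [set 'X_ord0 ^+ m.+1; 'X_ord_max ^+ m.+1].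
have idK := ideal_gen_ideal (nn `|` S).
have Kx : ideal_gen (nn `|` S) (mon m.+1 0).
  by apply: ideal_gen_sub; right; left; rewrite monx0.
have Ky : ideal_gen (nn `|` S) (mon 0 m.+1).
  by apply: ideal_gen_sub; right; right; rewrite mon0y.
have eN : ((N - m.+1).+2 = m.+1)%N by lia.
apply: point_given_eq; first exact: curve_pt_ideal.
- exact: curve_pt_stable.
- exact: curve_pt_nn.
- have hx := @curve_pt_x R m m.+1; have hy := @curve_pt_y R m m.+1.
  by rewrite eN in hx hy; move=> _ [] ->; rewrite -?monx0 -?mon0y.
- apply: (ideal_gen_min idK) => f [hf|]; first by apply: ideal_gen_sub; left.
  case=> ->; rewrite ?eN //.
    by apply: (idl_mon idK Kx).
  by apply: (idl_mon idK Ky).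
Qed.

Lemma point_end c : c * c = (-1) ^+ m ->
  point_given_by (submodule R m [set mon m 0 + c *: mon 0 m]) = end_pt c.
Proof.
move=> cc; apply: point_given_eq; first exact: end_pt_ideal.
- exact: end_pt_stable.
- exact: end_pt_nn.
- by move=> _ ->; exact: end_pt_mem.
- by [].
Qed.

End Main.

Theorem propositionA2p3 (R : realType) (m : nat) (hm : (3 <= m)%N)
    (rho : nat -> rep R m) (hrho : mckay_labeling rho) :
  (* (a) *)
  (~~ odd m -> forall g : 'M[R[i]]_2, G R m g -> forall k, (1 <= k <= m.+2)%N ->
     maps_curve g (E (rho k)) (E (rho k)))
  /\
  (* (b) *)
  (odd m ->
     (forall g : 'M[R[i]]_2, G R m g -> ~ H R m g ->
        maps_curve g (E (rho m.+1)) (E (rho m.+2)) /\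
        maps_curve g (E (rho m.+2)) (E (rho m.+1))) /\
     (forall g : 'M[R[i]]_2, G R m g -> forall k, (1 <= k <= m)%N ->
        maps_curve g (E (rho k)) (E (rho k))))
  /\
  (* (c) *)
  (forall k, ~~ odd k -> (2 <= k <= m)%N ->
     forall I : set {mpoly R[i][2]}, E (rho k) I -> A_fixed R m I)
  /\
  (* (d) *)
  (forall k, odd k -> (1 <= k <= m)%N ->
     [/\ exists p q : set {mpoly R[i][2]}, p <> q /\
           E (rho k) `&` fixed_exceptional R m = [set p; q],
         k <> 1%N -> k <> m ->
           E (rho k) `&` fixed_exceptional R m =
           [set I | E (rho k) I /\
                    exists j, adjacent_curves rho k j /\ E (rho j) I],
         k = 1%N -> exists p : set {mpoly R[i][2]},
           E (rho 1%N) `&` E (rho 2%N) = [set p] /\ fixed_exceptional R m p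
       & k = m -> exists p : set {mpoly R[i][2]},
           E (rho m) `&` E (rho m.-1) = [set p] /\ fixed_exceptional R m p])
  /\
  (* (e) *)
  [/\ (* (i) *)
      Vdeg 2 (rho 1%N) = submodule R m [set 'X_ord0 * 'X_ord_max] /\
      E (rho 1%N) (point_given_by (Vdeg 2 (rho 1%N))) /\
      isolated_fixed_point R m (point_given_by (Vdeg 2 (rho 1%N))),
      (* (ii) *)
      odd m ->
        E (rho m) (point_given_by (V'_m1 R m)) /\
        isolated_fixed_point R m (point_given_by (V'_m1 R m))
    & (* (iii) *)
      ~~ odd m ->
        (Vdeg m (rho m.+1) = submodule R m [set poly_minus R m] /\
         E (rho m.+1) (point_given_by (Vdeg m (rho m.+1))) /\
         isolated_fixed_point R m (point_given_by (Vdeg m (rho m.+1)))) /\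
        (Vdeg m (rho m.+2) = submodule R m [set poly_plus R m] /\
         E (rho m.+2) (point_given_by (Vdeg m (rho m.+2))) /\
         isolated_fixed_point R m (point_given_by (Vdeg m (rho m.+2))))].
Proof.
split; [|split; [|split; [|split]]].
- move=> em g Gg k km; have [kle|kgt] := leqP k m.
    by apply: (maps_curve_vertex hm) => //; lia.
  have [->|->] : k = m.+1 \/ k = m.+2 by lia.
    rewrite (E_minus hm hrho); apply: (maps_curve_twist hm Gg).
    exact: twist_chi_even.
  rewrite (E_plus hm hrho); apply: (maps_curve_twist hm Gg).
  exact: twist_chi_even.
- move=> om; split=> [g Gg nHg|g Gg k km]; last exact: (maps_curve_vertex hm).
  have s1 : (-1) ^+ m = -1 :> R[i] by rewrite -signr_odd om expr1.
  rewrite (E_minus hm hrho) (E_plus hm hrho); split; apply: (maps_curve_twist hm Gg);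
    by apply: twist_chi_dl => //; rewrite s1 ?mulrNN ?mulN1r ?mul1r.
- move=> k ek km I; rewrite (E_curve hm hrho); last by lia.
  have km1 : (1 <= k <= m)%N by lia.
  move=> /(curve_fwd km1)[gI hxy hy]; apply/(A_fixedP hm gI).
  exact: (even_fixed hm ek km gI hxy hy).
- move=> k ok km; split.
  + exists (@curve_pt R m k), (@curve_pt R m k.+1); split; first exact: curve_pt_neq.
    rewrite (E_curve hm hrho); last by lia.
    exact: curve_fixed.
  + move=> k1 km'; rewrite (curve_adjacent hm hrho); last by lia.
    rewrite (E_curve hm hrho); last by lia.
    exact: curve_fixed.
  + move=> _; exists (@curve_pt R m 2); split; last by apply: curve_pt_fixed; lia.
    rewrite !(E_curve hm hrho) //; apply: curve_meet_next; lia.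
  + move=> _; exists (@curve_pt R m m); split; last by apply: curve_pt_fixed; lia.
    rewrite !(E_curve hm hrho); try lia.
    have h : (1 <= m.-1 < m)%N by lia.
    have := curve_meet_next R hm h; have -> : m.-1.+1 = m by lia.
    by rewrite setIC.
- have [_ _ _ eM eP] := hrho; split.
  + rewrite (point_first hm hrho) (E_curve hm hrho) //; split.
      rewrite -(Vdeg_iso 2 (label hm hrho (k := 1) isT)) (Vdeg_sgn R hm).
      by rewrite mon11.
    by split; [apply: curve_bwd; lia|exact: isolated_first].
  + move=> om; rewrite (point_last R hm) (E_curve hm hrho); last by lia.
    by split; [apply: curve_bwdS; lia|exact: isolated_last].
  + move=> em; rewrite eM eP poly_minusE poly_plusE !(point_end hm) ?Ni_pow_sqr ?i_pow_sqr //.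
    rewrite (E_minus hm hrho) (E_plus hm hrho).
    split; (split=> //; split; [exact: end_bwd|apply: isolated_end => //]).
      exact: Ni_pow_sqr.
    exact: i_pow_sqr.
Qed.
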